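(* Let $X$ be a Banach space with a Rosenthal basis, and such that the dual space $X^*$ has a Rosenthal basis. Then $X$ is isomorphic to $c_0$ or to $\ell_p$ for some $1<p<\infty$, and any Rosenthal basis of $X$ is equivalent to the unit vector basis of $c_0$ or $\ell_p$.
   Context: Scalars are real. A normalized block basis of a basis $\{e_i\}$ is a sequence of norm-one finite linear combinations of the $e_i$ with successive supports. Two basic sequences $\{x_i\},\{y_i\}$ are equivalent if there is $C\ge 1$ with $C^{-1}\|\sum a_i x_i\|\le\|\sum a_i y_i\|\le C\|\sum a_i x_i\|$ for all finitely supported scalar sequences $(a_i)$. A Rosenthal basis of a Banach space is a normalized Schauder basis $\{e_i\}$ such that every normalized block basis of $\{e_i\}$ has a subsequence equivalent to $\{e_i\}$. *)

(* Defs.v *)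
From HB Require Import structures.
From mathcomp Require Import all_boot all_order all_algebra.
From mathcomp Require Import finmap.
From mathcomp Require Import all_classical all_reals all_analysis.

Set Implicit Arguments.
Unset Strict Implicit.
Unset Printing Implicit Defensive.

Import Order.TTheory GRing.Theory Num.Theory.
Import numFieldNormedType.Exports.

Local Open Scope classical_set_scope.
Local Open Scope ring_scope.

Definition equivalent_seq (R : realType) (V W : normedModType R)
    (x : nat -> V) (y : nat -> W) : Prop :=
  exists2 C : R, 1 <= C & forall (n : nat) (a : nat -> R),
    C^-1 * `|\sum_(i < n) a i *: x i| <= `|\sum_(i < n) a i *: y i| /\
    `|\sum_(i < n) a i *: y i| <= C * `|\sum_(i < n) a i *: x i|.

Definition schauder_basis (R : realType) (V : normedModType R)
    (e : nat -> V) : Prop :=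
  forall x : V, exists! a : nat -> R, series (fun i => a i *: e i) @ \oo --> x.

(* [a n] is the whole (finitely supported) coefficient sequence of [u n]; the
   supports are nonempty because [u n] has norm one. *)
Definition normalized_block_basis (R : realType) (V : normedModType R)
    (e u : nat -> V) : Prop :=
  exists (N : nat -> nat) (a : nat -> nat -> R),
    [/\ forall n i, (N n <= i)%N -> a n i = 0,
        forall n, u n = \sum_(i < N n) a n i *: e i,
        forall m n i j, (m < n)%N -> a m i != 0 -> a n j != 0 -> (i < j)%N
      & forall n, `|u n| = 1].

Definition rosenthal_basis (R : realType) (V : normedModType R)
    (e : nat -> V) : Prop :=
  [/\ forall i, `|e i| = 1,
      schauder_basis e
    & forall u : nat -> V, normalized_block_basis e u ->
        exists2 k : nat -> nat, {homo k : i j / (i < j)%N}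
          & equivalent_seq (fun n => u (k n)) e].

Definition isomorphic (R : realType) (V W : normedModType R) : Prop :=
  exists (T : {linear V -> W}) (S : {linear W -> V}),
    [/\ continuous T, continuous S, cancel T S & cancel S T].

Section Dual.
Context {R : realType} (V : normedModType R).

Definition dual_pred : {pred V -> R^o} :=
  mem [set f : V -> R^o | linear f /\ continuous f].

Record dual := Dual {
  dual_fun :> V -> R^o;
  dual_funP : dual_fun \in dual_pred }.

HB.instance Definition _ := [isSub for dual_fun].
HB.instance Definition _ := [Choice of dual by <:].

Lemma dual_pred_submod : submod_closed dual_pred.
Proof.
split.
  rewrite inE /=; split; last exact: cst_continuous.
  by move=> a x y; rewrite scaler0 addr0.
move=> a f g; rewrite !inE /= => -[lf cf] [lg cg]; split.
  by move=> b x y; rewrite !fctE /= lf lg !scalerDr !scalerA mulrC addrACA.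
move=> x; apply: cvgD; last exact: cg.
by apply: cvgZr; exact: cf.
Qed.

HB.instance Definition _ :=
  GRing.isSubmodClosed.Build R (V -> R^o) dual_pred dual_pred_submod.
HB.instance Definition _ := [SubChoice_isSubLmodule of dual by <:].

Definition dual_norm (f : dual) : R :=
  sup [set `|f x| | x in [set x : V | `|x| <= 1]].

Lemma dual_linear (f : dual) : linear f.
Proof. by have := dual_funP f; rewrite inE => -[]. Qed.

Lemma dual_continuous (f : dual) : continuous f.
Proof. by have := dual_funP f; rewrite inE => -[]. Qed.

Lemma dual_has_sup (f : dual) :
  has_sup [set `|f x| | x in [set x : V | `|x| <= 1]].
Proof.
split; first by exists `|f 0|; exists 0 => //=; rewrite normr0.
pose mf := GRing.isLinear.Build _ _ _ _ f (@dual_linear f).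
pose lf : {linear V -> R^o} := HB.pack (f : V -> R^o) mf.
have : bounded_near lf (nbhs (0 : V)).
  by apply/linear_bounded_continuous; exact: dual_continuous.
move=> /bounded_funP/(_ 1)[M fM].
by exists M => _ [x /= x1 <-]; exact: fM.
Qed.

Lemma dual_norm_ub (f : dual) (x : V) : `|x| <= 1 -> `|f x| <= dual_norm f.
Proof.
move=> x1; apply: ub_le_sup; first by case: (dual_has_sup f).
by exists x.
Qed.

Lemma dual_norm_lub (f : dual) (M : R) :
  (forall x : V, `|x| <= 1 -> `|f x| <= M) -> dual_norm f <= M.
Proof.
move=> fM; apply: ge_sup; first by case: (dual_has_sup f).
by move=> _ [x /= x1 <-]; exact: fM.
Qed.

Lemma dual_normD (f g : dual) : dual_norm (f + g) <= dual_norm f + dual_norm g.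
Proof.
apply: dual_norm_lub => x x1; apply: le_trans (ler_normD _ _) _.
by apply: lerD; exact: dual_norm_ub.
Qed.

Lemma dual_normZ (a : R) (f : dual) : dual_norm (a *: f) = `|a| * dual_norm f.
Proof.
have le b (h : dual) : dual_norm (b *: h) <= `|b| * dual_norm h.
  apply: dual_norm_lub => x x1; rewrite [leLHS]normrM.
  by apply: ler_wpM2l => //; exact: dual_norm_ub.
apply/eqP; rewrite eq_le le /=.
have [->|a0] := eqVneq a 0.
  rewrite normr0 mul0r; apply: le_trans (normr_ge0 ((0 *: f : dual) 0)) _.
  by apply: (@dual_norm_ub _ 0); rewrite normr0.
rewrite -ler_pdivlMl ?normr_gt0// -normfV.
by rewrite -[in leLHS](scale1r f) -(mulVf a0) -scalerA; exact: le.
Qed.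

Lemma dual_norm0_eq0 (f : dual) : dual_norm f = 0 -> f = 0.
Proof.
have f00 : f 0 = 0.
  by have := dual_linear f (-1) 0 0; rewrite scaler0 addr0 scaleN1r addNr.
move=> f0; apply/val_inj/funext => x /=.
have [->//|x0] := eqVneq x 0.
have /dual_norm_ub : `| `|x|^-1 *: x | <= 1.
  by rewrite normrZ normfV normr_id mulVf // normr_eq0.
move=> /(_ f); rewrite f0 normr_le0.
have := dual_linear f `|x|^-1 x 0; rewrite addr0 f00 addr0 => ->.
by rewrite scaler_eq0 invr_eq0 normr_eq0 (negbTE x0) => /eqP.
Qed.

HB.instance Definition _ :=
  Lmodule_isNormed.Build R dual dual_normD dual_normZ dual_norm0_eq0.

End Dual.

Section C0.
Context (R : realType).

Definition c0_pred : {pred nat -> R^o} :=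
  mem [set u : nat -> R^o | u @ \oo --> (0 : R^o)].

Record c0 := C0 {
  c0_seq :> nat -> R^o;
  c0_seqP : c0_seq \in c0_pred }.

HB.instance Definition _ := [isSub for c0_seq].
HB.instance Definition _ := [Choice of c0 by <:].

Lemma c0_pred_submod : submod_closed c0_pred.
Proof.
split; first by rewrite inE /=; exact: cvg_cst.
move=> a u v; rewrite !inE /= => u0 v0.
have -> : (0 : R^o) = a *: (0 : R^o) + 0 by rewrite scaler0 addr0.
by apply: cvgD => //; exact: cvgZr.
Qed.

HB.instance Definition _ :=
  GRing.isSubmodClosed.Build R (nat -> R^o) c0_pred c0_pred_submod.
HB.instance Definition _ := [SubChoice_isSubLmodule of c0 by <:].

Definition c0_norm (u : c0) : R := sup (range (fun n => `|u n|)).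

Lemma c0_has_sup (u : c0) : has_sup (range (fun n => `|u n|)).
Proof.
split; first by exists `|u 0%N|; exists 0%N.
have : u @ \oo --> (0 : R^o) by have := c0_seqP u; rewrite inE.
move=> /cvgP/cvg_seq_bounded[M [_ uM]].
by exists (M + 1) => _ [n _ <-]; apply: uM => //; rewrite ltrDl.
Qed.

Lemma c0_norm_ub (u : c0) (n : nat) : `|u n| <= c0_norm u.
Proof. by apply: ub_le_sup; [case: (c0_has_sup u)|exists n]. Qed.

Lemma c0_norm_lub (u : c0) (M : R) :
  (forall n, `|u n| <= M) -> c0_norm u <= M.
Proof.
move=> uM; apply: ge_sup; first by case: (c0_has_sup u).
by move=> _ [n _ <-]; exact: uM.
Qed.

Lemma c0_normD (u v : c0) : c0_norm (u + v) <= c0_norm u + c0_norm v.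
Proof.
apply: c0_norm_lub => n; apply: le_trans (ler_normD _ _) _.
by apply: lerD; exact: c0_norm_ub.
Qed.

Lemma c0_normZ (a : R) (u : c0) : c0_norm (a *: u) = `|a| * c0_norm u.
Proof.
have le b (h : c0) : c0_norm (b *: h) <= `|b| * c0_norm h.
  apply: c0_norm_lub => n; rewrite [leLHS]normrM.
  by apply: ler_wpM2l => //; exact: c0_norm_ub.
apply/eqP; rewrite eq_le le /=.
have [->|a0] := eqVneq a 0.
  by rewrite normr0 mul0r; apply: le_trans (c0_norm_ub _ 0%N).
rewrite -ler_pdivlMl ?normr_gt0// -normfV.
by rewrite -[in leLHS](scale1r u) -(mulVf a0) -scalerA; exact: le.
Qed.

Lemma c0_norm0_eq0 (u : c0) : c0_norm u = 0 -> u = 0.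
Proof.
move=> u0; apply/val_inj/funext => n /=.
by have := c0_norm_ub u n; rewrite u0 normr_le0 => /eqP.
Qed.

HB.instance Definition _ :=
  Lmodule_isNormed.Build R c0 c0_normD c0_normZ c0_norm0_eq0.

Lemma c0_unit_subproof (n : nat) :
  ((fun k => (k == n)%:R) : nat -> R^o) \in c0_pred.
Proof.
rewrite inE /=; apply: cvg_near_cst.
by exists n.+1 => //= k nk; rewrite gtn_eqF.
Qed.

Definition c0_unit (n : nat) : c0 := C0 (c0_unit_subproof n).

End C0.

Section Lp.
Context {R : realType} (p : R).

(* The Lp space of the counting measure on [nat], whose norm is given by
   [lp_normE] below. *)
Definition lp (p1 : 1 <= p) : Type :=
  LfunType (@counting nat R) (p1 : (1 <= p%:E)%E).

Context (p1 : 1 <= p).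

HB.instance Definition _ := GRing.Lmodule.copy (lp p1)
  (LfunType (@counting nat R) (p1 : (1 <= p%:E)%E)).

Definition lp_seq (u : lp p1) : nat -> R :=
  (u : LfunType (@counting nat R) (p1 : (1 <= p%:E)%E)).

Definition lp_norm (u : lp p1) : R :=
  fine ('N[@counting nat R]_(p%:E)[EFin \o lp_seq u])%E.

Lemma lp_normE (u : lp p1) :
  (lp_norm u)%:E = ((\sum_(k <oo) `|(lp_seq u k)%:E| `^ p) `^ p^-1)%E.
Proof.
rewrite /lp_norm finite_norm_fine Lnorm_counting //.
exact: lt_le_trans ltr01 p1.
Qed.

Lemma lp_normD (u v : lp p1) : lp_norm (u + v) <= lp_norm u + lp_norm v.
Proof. exact: ler_LnormD. Qed.

Lemma lp_normZ (a : R) (u : lp p1) : lp_norm (a *: u) = `|a| * lp_norm u.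
Proof.
apply/EFin_inj; rewrite EFinM /lp_norm !finite_norm_fine.
exact: (@LnormZ _ _ _ _ _ _ (u : LfunType _ _)).
Qed.

Lemma lp_norm0_eq0 (u : lp p1) : lp_norm u = 0 -> u = 0.
Proof.
move=> /fine_Lnormr_eq0[A [_ A0 uA]]; apply/LfuneqP => n.
apply: contrapT => un; have : A n by apply: uA => /= /(_ I).
have [finA|infA] := pselect (finite_set A); last first.
  by move: A0; rewrite /= /counting asboolF.
move: A0; rewrite /= /counting asboolT // => -[] /eqP.
rewrite pnatr_eq0 cardfs_eq0 => /eqP /fset_set_set0.
by move=> /(_ finA) ->.
Qed.

HB.instance Definition _ :=
  Lmodule_isNormed.Build R (lp p1) lp_normD lp_normZ lp_norm0_eq0.

Lemma lp_unit_subproof (n : nat) :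
  ((fun k => (k == n)%:R) : nat -> R) \in Lfun (@counting nat R) p%:E.
Proof.
have p0 : 0 < p by exact: lt_le_trans ltr01 p1.
rewrite !inE /=; apply/andP; split; first by rewrite inE.
rewrite inE /= /finite_norm Lnorm_counting //; apply: poweR_lty.
rewrite (@nneseries_split _ _ 0%N n.+1); last first.
  by move=> k _; exact: poweR_ge0.
rewrite [X in (_ + X)%E]eseries0 ?adde0; last first.
  move=> k nk _ /=; rewrite gtn_eqF //= normr0 powR0//.
  by rewrite gt_eqF.
apply/lte_sum_pinfty => k _; exact: ltry.
Qed.

Definition lp_unit (n : nat) : lp p1 :=
  Lfun_Sub (p1 : (1 <= p%:E)%E) (lp_unit_subproof n).

End Lp.

(* Main.v *)
Require Import Defs.
From HB Require Import structures.
From mathcomp Require Import all_boot all_order all_algebra.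
From mathcomp Require Import all_classical all_reals all_analysis.
From mathcomp Require Import ring lra zify.

Set Implicit Arguments.
Unset Strict Implicit.
Unset Printing Implicit Defensive.

Import Order.TTheory GRing.Theory Num.Theory.
Import numFieldNormedType.Exports.

Local Open Scope classical_set_scope.
Local Open Scope ring_scope.

(** Let [e] be a Rosenthal basis of [X]. An infinite Ramsey argument shows that [e] is
    equivalent, with one constant, to all its subsequences. Averaging telescoping sums
    shows that the differences [e_2i - e_2i+1] are unconditional, and some subsequence
    of them, normalized, is equivalent to [e]; so [e] is unconditional.

    For finite vectors [a], [b] let [a (x) b] be the concatenation of copies of [b]
    scaled by the entries of [a]. Then [|a (x) b| <= C |a| |b|]: otherwise gluing copies
    of bad vectors [b_n] with weights [2^-n] gives a block basis no subsequence of which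
    is dominated by [e]. Now let [f] be a Rosenthal basis of [X*]. For a suitable
    subsequence of any separated bounded sequence in [X*], consecutive differences are
    small perturbations of blocks of [f]. Hence the coordinate functionals of [e] are
    equivalent to [f], and each of their normalized block bases has a subsequence which
    they dominate. They satisfy therefore the same tensor estimate, whose dual is
    [|a| |b| <= C |a (x) b|]. Besides, any two Rosenthal bases of [X] are equivalent,
    both being dual to [f].

    Consequently [|e_1 + ... + e_n|] behaves like [n^(1/q)] with [1 <= q <= oo]. If
    [q = oo], then [e] is equivalent to the basis of [c_0]. Otherwise, take [a] with
    entries in [{0} U {2^-l}]: its tensor power [a^(x)k] has [O(k)] level sets, on which
    the norm is known, so [|a|^k] and [|a|_q^k] agree up to [C^k O(k)]; taking [k]-th
    roots shows that [e] is equivalent to the basis of [l_q]. Finally [q <> 1], since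
    [X*] is separable. *)

(** * Finite combinations, encoded by polynomials *)

Section LinComb.
Context {R : comNzRingType} {V : lmodType R}.
Implicit Types (e : nat -> V) (p q : {poly R}).

(** The gluing argument is asymmetric: coordinate projections carry an upper bound from a glued
    block to each of its pieces, whereas a lower bound for the whole block says nothing about a
    single piece. Hence the lower tensor estimate is obtained as the dual of an upper one. In the
    dual the obstacle is that the coordinate functionals [es] are not given in terms of [f], and
    their coordinates with respect to [f] are not known to tend to zero. Taking differences of terms
    with almost equal coordinates removes the unknown limits, and unconditionality of [es] recovers
    the terms from the differences. Functionals that norm a finite vector are built on finitely many
    coordinates and extended by truncation. In the tensor power argument a constant [C] per factor
    becomes [C ^+ k], which leaves [C] after the root, while a factor affine in [k] leaves nothing.
    Powers of 1/2 are chosen as entries because their exponents add under tensor products, so that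
    the number of distinct values stays affine in [k]. *)

Definition lincomb e p : V := \sum_(i < size p) p`_i *: e i.

Lemma lincomb_wide n e p : (size p <= n)%N ->
  lincomb e p = \sum_(i < n) p`_i *: e i.
Proof.
move=> pn; rewrite /lincomb (big_ord_widen n (fun i => p`_i *: e i) pn).
rewrite big_mkcond; apply: eq_bigr => i _; case: ltnP => // ip.
by rewrite nth_default // scale0r.
Qed.

Lemma lincomb_is_linear e : linear (lincomb e).
Proof.
move=> a p q; set n := maxn (size p) (size q).
rewrite (@lincomb_wide n _ (a *: p + q)); last first.
  apply: leq_trans (size_polyD _ _) _; rewrite geq_max leq_maxr andbT.
  exact: leq_trans (size_scale_leq _ _) (leq_maxl _ _).
rewrite (@lincomb_wide n _ p) ?leq_maxl// (@lincomb_wide n _ q) ?leq_maxr//.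
rewrite scaler_sumr -big_split; apply: eq_bigr => i _ /=.
by rewrite coefD coefZ scalerDl scalerA.
Qed.

HB.instance Definition _ e :=
  GRing.isLinear.Build R {poly R} V *:%R (lincomb e) (lincomb_is_linear e).

Lemma lincombXn e i : lincomb e 'X^i = e i.
Proof.
rewrite /lincomb size_polyXn big_ord_recr/= coefXn eqxx scale1r big1 ?add0r//.
by move=> j _; rewrite coefXn ltn_eqF ?scale0r.
Qed.

Lemma lincomb_poly e n (a : nat -> R) :
  lincomb e (\poly_(i < n) a i) = \sum_(i < n) a i *: e i.
Proof.
rewrite (lincomb_wide _ (size_poly _ _)); apply: eq_bigr => i _.
by rewrite coef_poly ltn_ord.
Qed.

Lemma eq_lincomb e e' p : (forall i, (i < size p)%N -> e i = e' i) ->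
  lincomb e p = lincomb e' p.
Proof. by move=> ee; apply: eq_bigr => i _; rewrite ee. Qed.

Lemma lincombB e e' p :
  lincomb (fun i => e i - e' i) p = lincomb e p - lincomb e' p.
Proof.
by rewrite /lincomb -sumrB; apply: eq_bigr => i _; rewrite scalerBr.
Qed.

Lemma lincombD e e' p :
  lincomb (fun i => e i + e' i) p = lincomb e p + lincomb e' p.
Proof.
by rewrite /lincomb -big_split; apply: eq_bigr => i _; rewrite scalerDr.
Qed.

Lemma lincombZ a e p : lincomb (fun i => a *: e i) p = a *: lincomb e p.
Proof.
by rewrite /lincomb scaler_sumr; apply: eq_bigr => i _; rewrite !scalerA mulrC.
Qed.

Lemma lincomb_sum I (r : seq I) (P : pred I) (E : I -> nat -> V) p :
  lincomb (fun i => \sum_(j <- r | P j) E j i) p =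
  \sum_(j <- r | P j) lincomb (E j) p.
Proof.
rewrite /lincomb exchange_big; apply: eq_bigr => i _ /=.
by rewrite scaler_sumr.
Qed.

End LinComb.

Lemma linear_lincomb (R : comNzRingType) (V W : lmodType R)
    (T : {linear V -> W}) e p :
  T (lincomb e p) = lincomb (fun i => T (e i)) p.
Proof. by rewrite linear_sum; apply: eq_bigr => i _; rewrite linearZ. Qed.

(** As [{poly R}] is itself a module, a sequence of blocks is a map [y] into [{poly R}], and
    [lincomb y p] expands a combination of blocks in the coordinates of [e]. *)
Lemma lincomb_comp (R : comNzRingType) (V : lmodType R) (e : nat -> V)
    (y : nat -> {poly R}) p :
  lincomb e (lincomb y p) = lincomb (fun i => lincomb e (y i)) p.
Proof. exact: linear_lincomb. Qed.

Section Operators.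
Context {R : comNzRingType}.
Implicit Types (p q : {poly R}) (A : pred nat).

(** Diagonal operators, coordinate projections and index changes are all given by the images of the
    unit vectors ['X^i], so they inherit linearity from [lincomb]. *)
Definition mult (v : nat -> R) : {poly R} -> {poly R} :=
  lincomb (fun i => v i *: 'X^i).
Definition restr (A : pred nat) : {poly R} -> {poly R} :=
  mult (fun i => (A i)%:R).
Definition spread (k : nat -> nat) : {poly R} -> {poly R} :=
  lincomb (fun i => 'X^(k i)).

HB.instance Definition _ v := GRing.Linear.on (mult v).
HB.instance Definition _ A := GRing.Linear.on (restr A).
HB.instance Definition _ k := GRing.Linear.on (spread k).

Lemma coef_lincomb (y : nat -> {poly R}) p j :
  (lincomb y p)`_j = \sum_(i < size p) p`_i * (y i)`_j.
Proof. by rewrite coef_sum; apply: eq_bigr => i _; rewrite coefZ. Qed.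

Lemma coef_mult v p i : (mult v p)`_i = v i * p`_i.
Proof.
rewrite coef_lincomb.
under eq_bigr do rewrite coefZ coefXn.
have [ip|pi] := ltnP i (size p).
  rewrite (bigD1 (Ordinal ip))//= eqxx mulr1 big1 ?addr0 1?mulrC//.
  by move=> j /eqP ji; case: eqP => [ij|]; rewrite ?mulr0//; case: ji; exact/val_inj.
rewrite nth_default // mulr0 big1// => j _.
by rewrite gtn_eqF ?mulr0// (leq_trans _ pi).
Qed.

Lemma coef_restr A p i : (restr A p)`_i = if A i then p`_i else 0.
Proof. by rewrite coef_mult; case: ifP; rewrite ?mul1r ?mul0r. Qed.

Lemma lincomb_mult (V : lmodType R) (e : nat -> V) v p :
  lincomb e (mult v p) = lincomb (fun i => v i *: e i) p.
Proof.
rewrite lincomb_comp; congr lincomb; apply/funext => i.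
by rewrite linearZ /= lincombXn.
Qed.

Lemma lincomb_spread (V : lmodType R) (e : nat -> V) k p :
  lincomb e (spread k p) = lincomb (e \o k) p.
Proof.
by rewrite lincomb_comp; congr lincomb; apply/funext => i; rewrite lincombXn.
Qed.

Lemma lincombX p : lincomb (fun i => 'X^i) p = p.
Proof. by rewrite /lincomb -poly_def coefK. Qed.

Lemma restr_id A p : (forall i, p`_i != 0 -> A i) -> restr A p = p.
Proof.
move=> pA; apply/polyP => i; rewrite coef_restr; case: ifPn => // Ai.
by apply/esym/eqP; apply: contraNT Ai; exact: pA.
Qed.

Lemma restr_eq0 A p : (forall i, p`_i != 0 -> ~~ A i) -> restr A p = 0.
Proof.
move=> pA; apply/polyP => i; rewrite coef_restr coef0; case: ifPn => // Ai.
by apply/eqP; apply: contraTT Ai; exact: pA.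
Qed.

Lemma coef_spread k p i : injective k -> (spread k p)`_(k i) = p`_i.
Proof.
move=> kI; rewrite coef_lincomb; under eq_bigr do rewrite coefXn (inj_eq kI).
(* By injectivity of [k] the sum is the one for the identity operator, written as
   [mult (fun=> 1)]. *)
have := coef_mult (fun=> 1) p i; rewrite coef_lincomb mul1r => <-.
by apply: eq_bigr => j _; rewrite scale1r coefXn.
Qed.

Lemma coef_spread_eq0 k p j : (forall i, k i <> j) -> (spread k p)`_j = 0.
Proof.
move=> kj; rewrite coef_lincomb big1// => i _; rewrite coefXn.
by case: eqP => [/esym/kj//|]; rewrite mulr0.
Qed.

End Operators.

Lemma homo_ltn_inj (k : nat -> nat) : {homo k : i j / (i < j)%N} -> injective k.
Proof.
move=> kh i j kij; case: (ltngtP i j) => // /kh; by rewrite kij ltnn.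
Qed.

Lemma homo_ltn_ge (k : nat -> nat) : {homo k : i j / (i < j)%N} ->
  forall i, (i <= k i)%N.
Proof.
by move=> kh; elim=> // i IH; exact: leq_ltn_trans IH (kh _ _ (ltnSn i)).
Qed.

(** * Domination, spreading and unconditionality *)

Section Dominated.
Context {R : realType}.

Definition dominated (V W : normedModType R) (x : nat -> V) (y : nat -> W) :=
  exists2 C : R, 0 < C & forall p, `|lincomb x p| <= C * `|lincomb y p|.

Lemma dominated_trans (U V W : normedModType R) (x : nat -> U) (y : nat -> V)
    (z : nat -> W) : dominated x y -> dominated y z -> dominated x z.
Proof.
move=> [C C0 xy] [D D0 yz]; exists (C * D); first exact: mulr_gt0.
by move=> p; rewrite -mulrA; apply: le_trans (xy p) _; rewrite ler_pM2l.
Qed.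

Lemma equivalent_seqP (V W : normedModType R) (x : nat -> V) (y : nat -> W) :
  equivalent_seq x y <-> dominated x y /\ dominated y x.
Proof.
split=> [[C C1 xy]|[[C C0 xy] [D D0 yx]]].
  have C0 : 0 < C by exact: lt_le_trans C1.
  split; exists C => // p; have [] := xy (size p) (fun i => p`_i).
    by rewrite ler_pdivrMl.
  by [].
exists (Num.max 1 (Num.max C D)); first by rewrite le_max lexx.
set M := Num.max _ _; have M0 : 0 < M by rewrite lt_max ltr01.
move=> n a; rewrite ler_pdivrMl// -!(lincomb_poly _ n a); split.
  by apply: le_trans (xy _) _; apply: ler_wpM2r; rewrite ?normr_ge0// !le_max lexx orbT.
by apply: le_trans (yx _) _; apply: ler_wpM2r; rewrite ?normr_ge0// !le_max lexx !orbT.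
Qed.

Definition spreading (V : normedModType R) K (e : nat -> V) :=
  forall k, {homo k : i j / (i < j)%N} -> forall p,
    `|lincomb (e \o k) p| <= K * `|lincomb e p| /\
    `|lincomb e p| <= K * `|lincomb (e \o k) p|.

(** This is unconditionality, expressed by projections onto coordinate sets instead of signs;
    bounded multipliers follow in [suppression_mult]. *)
Definition suppression (V : normedModType R) K (e : nat -> V) :=
  forall A p, `|lincomb e (restr A p)| <= K * `|lincomb e p|.

Lemma normalized_block (V : normedModType R) (e : nat -> V)
    (y : nat -> {poly R}) :
  (forall m n i j, (m < n)%N -> (y m)`_i != 0 -> (y n)`_j != 0 -> (i < j)%N) ->
  (forall n, `|lincomb e (y n)| = 1) ->
  normalized_block_basis e (fun n => lincomb e (y n)).
Proof.
move=> yb y1; exists (fun n => size (y n)), (fun n i => (y n)`_i); split=> //.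
by move=> n i; exact: nth_default.
Qed.

Lemma normalized_blockP (V : normedModType R) (e u : nat -> V) :
  normalized_block_basis e u -> exists y : nat -> {poly R},
  [/\ u = fun n => lincomb e (y n),
   forall m n i j, (m < n)%N -> (y m)`_i != 0 -> (y n)`_j != 0 -> (i < j)%N
   & forall n, `|lincomb e (y n)| = 1].
Proof.
move=> [N [a [aN ua ab u1]]]; exists (fun n => \poly_(i < N n) a n i).
have ay n i : (\poly_(i < N n) a n i)`_i = a n i.
  by rewrite coef_poly; case: ltnP => // /aN ->.
split.
- by apply/funext => n; rewrite lincomb_poly.
- by move=> m n i j; rewrite !ay; exact: ab.
- by move=> n; rewrite lincomb_poly -ua.
Qed.

End Dominated.

(** * An infinite Ramsey theorem *)

Section OpenRamsey.
Variables (F : set_system nat) (U : set (nat -> nat)).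
Hypotheses (FU : UltraFilter F) (Foo : \oo `<=` F).
Hypothesis Uopen : forall M, U M ->
  exists n, forall N, (forall i, (i < n)%N -> N i = M i) -> U N.

Let FF : ProperFilter F. Proof. exact: ultra_proper. Qed.

(* In the game where a sequence is built one term at a time, each term being chosen
   from a set in the ultrafilter [F] announced by a player who wants to end in [U],
   [winning s] says that this player can force [U] from the position [s]. *)
Inductive winning : seq nat -> Prop :=
| winning_base s : (forall N, mkseq N (size s) = s -> U N) -> winning s
| winning_step s (B : set nat) : F B ->
    (forall n, B n -> winning (rcons s n)) -> winning s.

Lemma winning_strategy s : winning s ->
  exists A : seq nat -> set nat, (forall t, F (A t)) /\
    forall N, mkseq N (size s) = s ->
      (forall n, (size s <= n)%N -> A (mkseq N n) (N n)) -> U N.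
Proof.
elim=> {}s => [sU|B FB _ IH].
  by exists (fun=> setT); split=> [_|N /sU//]; exact: filterT.
have /choice[A AP] (n : nat) : exists A : seq nat -> set nat,
    (forall t, F (A t)) /\ (B n -> forall N,
      mkseq N (size s).+1 = rcons s n ->
      (forall m, (size s < m)%N -> A (mkseq N m) (N m)) -> U N).
  have [Bn|nB] := pselect (B n); last first.
    by exists (fun=> setT); split=> // _; exact: filterT.
  have [A [FA AU]] := IH _ Bn; exists A; split=> // _ N Ns NA.
  by apply: AU; rewrite size_rcons.
(* At [s] the player announces [B]; afterwards the strategy to follow is selected by the move made
   at [s], which is the entry of index [size s]. *)
exists (fun t => if t == s then B else A (nth 0%N t (size s)) t); split.
  by move=> t; case: ifP => // _; case: (AP (nth 0%N t (size s))).
move=> N Ns NA.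
have BN : B (N (size s)) by have := NA _ (leqnn _); rewrite Ns eqxx.
have [_ /(_ BN N)] := AP (N (size s)); apply; first by rewrite mkseqS Ns.
move=> m sm; have := NA m (ltnW sm); rewrite nth_mkseq//.
case: eqP => // ms; have := congr1 size ms; rewrite size_mkseq => mE.
by move: sm; rewrite mE ltnn.
Qed.

(** By the ultrafilter property, from a position that is not winning almost all moves lead to
    positions that are not winning. Membership in the open set [U] would be decided after finitely
    many moves, hence at a winning position. *)
Lemma losing_strategy : ~ winning [::] ->
  exists A : seq nat -> set nat, (forall t, F (A t)) /\
    forall N, (forall n, A (mkseq N n) (N n)) -> ~ U N.
Proof.
move=> nw; exists (fun t => [set n | ~ winning t -> ~ winning (rcons t n)]).
split=> [t|N NA /Uopen[n nU]].
  have [wt|nwt] := pselect (winning t).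
    by apply: filterS filterT => n _ /(_ wt).
  have [Fw|Fw] := in_ultra_setVsetC [set n | winning (rcons t n)] FU.
    by exfalso; apply: nwt; exact: winning_step Fw _.
  by apply: filterS Fw => n nw_ _; exact: nw_.
suff /(_ n) : forall m, ~ winning (mkseq N m).
  apply; apply: winning_base => M; rewrite size_mkseq => MN.
  apply: nU => i ni; have := congr1 (nth 0%N ^~ i) MN.
  by rewrite /= !nth_mkseq.
by elim=> // m IH; rewrite mkseqS; exact: NA.
Qed.

(** There are only finitely many subsequences; those of [x :: s] that begin with [x] are handled by
    the shifted strategy [A \o cons x]. *)
Lemma filter_subseq (A : seq nat -> set nat) s : (forall t, F (A t)) ->
  F [set n | forall t, subseq t s -> A t n].
Proof.
elim: s A => [|x s IH] A FA.
  by apply: filterS (FA [::]) => n An t; rewrite subseq0 => /eqP ->.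
apply: filterS2 (IH _ FA) (IH (A \o cons x) (fun t => FA (x :: t))).
move=> n An Axn [|y t]; first by move=> _; apply: An; exact: sub0seq.
rewrite [subseq _ _]/=; case: eqP => [->|_]; [exact: Axn|exact: An].
Qed.

(** Each new term is taken in the sets announced after every subsequence of the terms already
    chosen, so that each subsequence of [M] is itself a play following [A]. *)
Lemma strategy_diagonal (A : seq nat -> set nat) : (forall t, F (A t)) ->
  exists M, {homo M : i j / (i < j)%N} /\
    forall k, {homo k : i j / (i < j)%N} ->
      forall n, A (mkseq (M \o k) n) (M (k n)).
Proof.
move=> FA.
have /choice[next nextP] (s : seq nat) : exists m : nat,
    (forall t, subseq t s -> A t m) /\ (last 0%N s < m)%N.
  have [//|m [mA ms]] := @filter_ex _ F _ ([set n | forall t, subseq t s -> A t n] `&`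
    [set n | (last 0%N s < n)%N]).
    apply: filterI; first exact: filter_subseq.
    by apply: Foo; exact: nbhs_infty_gt.
  by exists m.
pose pr n := iter n (fun s => rcons s (next s)) [::].
pose M n := next (pr n).
have prE n : pr n = mkseq M n.
  by elim: n => // n IH; rewrite mkseqS -IH.
have ME n : M n.+1 = next (rcons (pr n) (M n)) by [].
have Mh : {homo M : i j / (i < j)%N}.
  apply: homo_ltn => [|n]; first exact: ltn_trans.
  by rewrite ME; have [_] := nextP (rcons (pr n) (M n)); rewrite last_rcons.
exists M; split=> // k kh n.
have [nA _] := nextP (pr (k n)); apply: nA; rewrite prE.
elim: n => [|n IH]; first exact: sub0seq.
rewrite mkseqS; apply: (@subseq_trans _ (mkseq M (k n).+1)).
  by rewrite mkseqS -!cats1; exact: cat_subseq.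
rewrite -(subnKC (kh n n.+1 (ltnSn n))) /mkseq iotaD map_cat.
exact: prefix_subseq.
Qed.

End OpenRamsey.

Lemma free_ultrafilter : exists F : set_system nat, UltraFilter F /\ \oo `<=` F.
Proof. by have [F [FU]] := ultraFilterLemma (@eventually_filter); exists F. Qed.

(** The game for an open set is determined; diagonalizing the strategy of whichever side prevails
    puts all subsequences of one sequence on the same side. *)
Lemma open_ramsey (U : set (nat -> nat)) :
  (forall M, U M ->
     exists n, forall N, (forall i, (i < n)%N -> N i = M i) -> U N) ->
  exists M, {homo M : i j / (i < j)%N} /\
    ((forall k, {homo k : i j / (i < j)%N} -> U (M \o k)) \/
     (forall k, {homo k : i j / (i < j)%N} -> ~ U (M \o k))).
Proof.
move=> Uopen; have [F [FU Foo]] := free_ultrafilter.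
have [w|nw] := pselect (winning F U [::]).
  have [A [FA AU]] := winning_strategy FU w.
  have [M [Mh MA]] := strategy_diagonal FU Foo FA.
  by exists M; split=> //; left=> k kh; apply: AU => // n _; exact: MA.
have [A [FA AU]] := losing_strategy FU Uopen nw.
have [M [Mh MA]] := strategy_diagonal FU Foo FA.
by exists M; split=> //; right=> k kh; apply: AU => n; exact: MA.
Qed.

(** * Schauder bases and duals *)

Lemma cvg_norm_le (R : realType) (V : normedModType R) (u : nat -> V) l (M : R) :
  u @ \oo --> l -> (forall n, `|u n| <= M) -> `|l| <= M.
Proof.
move=> ul uM; have nul : (fun n => `|u n|) @ \oo --> `|l| by exact: cvg_norm.
rewrite -(cvg_lim _ nul)//; apply: limr_le; first by apply/cvg_ex; exists `|l|.
exact: nearW.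
Qed.

(** * Uniform boundedness of the partial sum operators *)

Section SchauderBounded.
Context {R : realType} {X : completeNormedModType R} (e : nat -> X).
Hypotheses (e1 : forall i, `|e i| = 1) (eb : schauder_basis e).

Let aP : {a : X -> nat -> R &
  forall x, series (fun i => a x i *: e i) @ \oo --> x}.
Proof.
apply: (@choice _ _ (fun x b => series (fun i => b i *: e i) @ \oo --> x)) => x.
by have [a [ax _]] := eb x; exists a.
Qed.
Let a := projT1 aP.
Let ax x : series (fun i => a x i *: e i) @ \oo --> x := projT2 aP x.
Let a_uniq x b : series (fun i => b i *: e i) @ \oo --> x -> a x = b.
Proof.
move=> bx; have [c [_ cu]] := eb x.
by rewrite -(cu _ (@ax x)) (cu _ bx).
Qed.

Let S n x := series (fun i => a x i *: e i) n.

Let a_lin c x y i : a (c *: x + y) i = c * a x i + a y i.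
Proof.
suff /a_uniq -> : series (fun i => (c * a x i + a y i) *: e i) @ \oo --> c *: x + y by [].
have -> : series (fun i => (c * a x i + a y i) *: e i) =
  (fun n => c *: series (fun i => a x i *: e i) n + series (fun i => a y i *: e i) n).
  apply/funext => n; rewrite /series /= scaler_sumr -big_split.
  by apply: eq_bigr => j _ /=; rewrite scalerDl scalerA.
by apply: cvgD => //; exact: cvgZr.
Qed.

Let S_lin n c x y : S n (c *: x + y) = c *: S n x + S n y.
Proof.
rewrite /S /series /= scaler_sumr -big_split; apply: eq_bigr => j _ /=.
by rewrite a_lin scalerDl scalerA.
Qed.

Let SB n x y : S n (x - y) = S n x - S n y.
Proof. by rewrite addrC -scaleN1r S_lin scaleN1r addrC. Qed.

Let S0 n : S n 0 = 0.
Proof. by have := SB n 0 0; rewrite !subrr. Qed.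

Let SZ n c x : S n (c *: x) = c *: S n x.
Proof. by rewrite -[c *: x]addr0 S_lin S0 addr0. Qed.

Let S_bounded x : exists m : nat, forall n, `|S n x| <= m%:R.
Proof.
have /cvgP/cvg_seq_bounded[M [_ uM]] := @ax x.
have [m Mm] : exists m : nat, M + 1 < m%:R.
  by exists (Num.truncn (M + 1)).+1; exact: truncnS_gt.
exists m => n; apply: le_trans (ltW Mm).
by apply: (uM (M + 1)) => //; rewrite ltrDl.
Qed.

(** Open mapping argument: by Baire, some [B m] is dense in a ball. A small multiple of [y] is the
    difference of two points of that ball, each of which is approximated within [B m]. *)
Let approx : exists2 K : R, 0 < K & forall y eps, 0 < eps ->
  exists2 b, `|y - b| < eps & forall n, `|S n b| <= K * `|y|.
Proof.
pose B (m : nat) := [set x | forall n, `|S n x| <= m%:R].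
have [m mB] : exists m, ~ dense (~` closure (B m)).
  apply: contrapT => /forallNP nd.
  have : dense (\bigcap_m (~` closure (B m))).
    apply: Baire => m; split; last exact: contrapT (nd m).
    by apply: closed_openC; exact: closed_closure.
  move=> /(_ setT) [||x [_ xB]]; [by exists 0|exact: openT|].
  have [m mx] := S_bounded x.
  by have := xB m Logic.I; apply; exact: subset_closure.
have [x0 [r r0 rB]] : exists x0 : X, exists2 r : R, 0 < r &
    ball x0 r `<=` closure (B m).
  have /denseNE [W [[x xW] WB]] := mB.
  have [_ /nbhs_ballP[r /= r0 rW]] : open_nbhs x W /\ nbhs x W.
    by split; [|exact: open_nbhs_nbhs xW].
  exists x, r => // y /rW Wy; apply: contrapT => nBy.
  by have : (W `&` ~` closure (B m)) y by []; rewrite WB.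
have near y eps : ball x0 r y -> 0 < eps -> exists2 b, B m b & `|y - b| < eps.
  move=> /rB /(_ (ball y eps)) yB eps0.
  have [b [Bb]] := yB (nbhsx_ballx y eps eps0).
  by rewrite -ball_normE /=; exists b.
(* One factor 2 comes from the difference of two elements of [B m], the other from scaling [y] to
   norm [r / 2]; [m + 1] instead of [m] keeps the constant positive. *)
have K0 : 0 < 4 * (m%:R + 1) / r :> R.
  by rewrite divr_gt0 ?mulr_gt0// ltr_wpDl.
exists (4 * (m%:R + 1) / r) => // y eps eps0.
have [->|y0] := eqVneq y 0.
  by exists 0 => [|n]; rewrite ?subrr ?normr0// S0 normr0 mulr0.
have ny0 : 0 < `|y| by rewrite normr_gt0.
pose t := r / 2 / `|y|; have t0 : 0 < t by rewrite !divr_gt0.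
have [b1 Bb1 yb1] : exists2 b, B m b & `|(t *: y + x0) - b| < t * eps / 2.
  apply: near; last by rewrite divr_gt0// mulr_gt0.
  rewrite -ball_normE /= opprD addrCA subrr addr0 normrN normrZ gtr0_norm//.
  by rewrite /t divfK ?gt_eqF// ltr_pdivrMr// ltr_pMr// ltr1n.
have [b0 Bb0 xb0] : exists2 b, B m b & `|x0 - b| < t * eps / 2.
  apply: near; first exact: ballxx.
  by rewrite divr_gt0// mulr_gt0.
exists (t^-1 *: (b1 - b0)) => [|n].
  rewrite -(ltr_pM2l t0) -{1}(gtr0_norm t0) -normrZ scalerBr scalerA.
  rewrite mulfV ?gt_eqF// scale1r.
  have -> : t *: y - (b1 - b0) = (t *: y + x0 - b1) - (x0 - b0).
    by rewrite (addrAC (t *: y) x0) -(addrA (_ - b1)) subKr opprB addrA addrAC.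
  apply: le_lt_trans (ler_normB _ _) _.
  by rewrite [ltRHS]splitr ltrD.
rewrite SZ SB normrZ gtr0_norm ?invr_gt0// /t.
have : `|S n b1 - S n b0| <= 2 * (m%:R + 1).
  apply: le_trans (ler_normB _ _) _.
  have := Bb1 n; have := Bb0 n; lra.
move=> H; rewrite ler_pdivrMl//.
apply: le_trans H _; rewrite /t.
have -> : r / 2 / `|y| * (4 * (m%:R + 1) / r * `|y|) = 2 * (m%:R + 1) :> R.
  by field; rewrite !gt_eqF.
by [].
Qed.

(** The partial sum operators are not yet known to be continuous, so the decomposition of [x] into
    approximants cannot be summed under [S n]. Instead the coefficients of the approximants add up
    to [c], the series with coefficients [c] is shown to converge to [x], and uniqueness of the
    expansion identifies [c] with [a x]. *)
Lemma schauder_bounded : exists2 K : R, 0 < K & forall x b,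
  series (fun i => b i *: e i) @ \oo --> x ->
  forall n, `|series (fun i => b i *: e i) n| <= K * `|x|.
Proof.
have [K K0 KP] := approx; exists (2 * K); first by rewrite mulr_gt0.
suff main x : `|x| <= 1 -> forall n, `|S n x| <= 2 * K.
  move=> x b /a_uniq <- n.
  have [->|x0] := eqVneq x 0; first by rewrite -/(S n 0) S0 !normr0 mulr0.
  have nx0 : 0 < `|x| by rewrite normr_gt0.
  rewrite -ler_pdivrMr// mulrC.
  rewrite -[X in X * _](gtr0_norm) ?invr_gt0// -normrZ -/(S n x) -SZ; apply: main.
  by rewrite normrZ gtr0_norm ?invr_gt0// mulVf// gt_eqF.
move=> x1.
have /choice[b bP] (yk : X * nat) : exists b, `|yk.1 - b| < 2^-1 ^+ yk.2.+1 /\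
    forall n, `|S n b| <= K * `|yk.1|.
  by have [//|b] := KP yk.1 (2^-1 ^+ yk.2.+1); exists b.
pose y := fix y k := if k is k'.+1 then y k' - b (y k', k') else x.
have yS k : y k.+1 = y k - b (y k, k) by [].
have ylt k : `|y k| <= 2^-1 ^+ k.
  case: k => [|k]; first by rewrite expr0.
  by rewrite yS; apply: ltW; have [] := bP (y k, k).
have h0 k : 0 <= 2^-1 ^+ k :> R by rewrite exprn_ge0.
have Sb n k : `|S n (b (y k, k))| <= K * 2^-1 ^+ k.
  have [_ /(_ n)] := bP (y k, k); move=> /le_trans; apply.
  by rewrite ler_pM2l//; exact: ylt.
have Sy n k l : `|S n (y k) - S n (y (k + l)%N)| <= 2 * K * (2^-1 ^+ k - 2^-1 ^+ (k + l)).
  elim: l => [|l IH]; first by rewrite addn0 !subrr normr0 mulr0.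
  have -> : S n (y k) - S n (y (k + l.+1)%N) =
      (S n (y k) - S n (y (k + l)%N)) + S n (b (y (k + l)%N, (k + l)%N)).
    by rewrite addnS yS SB opprB addrCA addrC.
  apply: le_trans (ler_normD _ _) _; have := Sb n (k + l)%N; move: IH.
  rewrite addnS exprS; set q := _ ^+ (k + l); set p := _ ^+ k.
  move: (`|_|) (`|_|) => u v; nra.
have a_b i k : `|a (b (y k, k)) i| <= 2 * K * 2^-1 ^+ k.
  have -> : `|a (b (y k, k)) i| = `|S i.+1 (b (y k, k)) - S i (b (y k, k))|.
    by rewrite /S seriesSr addrC addKr normrZ e1 mulr1.
  apply: le_trans (ler_normB _ _) _.
  have := Sb i.+1 k; have := Sb i k; lra.
have c_cvg i : cvgn (series (fun k => a (b (y k, k)) i : R^o)).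
  apply: normed_cvg; apply: (@series_le_cvg _ _ (fun k => 2 * K * 2^-1 ^+ k)).
  - by move=> n; exact: normr_ge0.
  - by move=> n; rewrite !mulr_ge0// ltW.
  - exact: a_b.
  - by apply: is_cvg_geometric_series; rewrite ger0_norm// invf_lt1// ltr1n.
pose c i := limn (series (fun k => a (b (y k, k)) i : R^o)).
have ser_ab i k : series (fun k => a (b (y k, k)) i : R^o) k = a x i - a (y k) i.
  elim: k => [|k IH]; first by rewrite /series /= big_geq// subrr.
  rewrite seriesSr IH yS.
  have -> : a (y k - b (y k, k)) i = a (y k) i - a (b (y k, k)) i.
    by rewrite addrC -scaleN1r a_lin mulN1r addrC.
  by ring.
(* The first [k] approximants add up to [x - y k]; the remaining ones contribute a geometric
   tail. *)
have Sc n k : `|series (fun i => c i *: e i) n - (S n x - S n (y k))| <= 2 * K * 2^-1 ^+ k.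
  apply: (@cvg_norm_le _ _ (fun l => (S n x - S n (y (k + l)%N)) - (S n x - S n (y k)))).
    apply: cvgB; last exact: cvg_cst.
    suff H : (fun l => S n x - S n (y l)) @ \oo --> series (fun i => c i *: e i) n.
      have := H; rewrite -(cvg_shiftn k); under eq_fun do rewrite addnC; exact.
    have -> : (fun l => S n x - S n (y l)) =
        (fun l => \sum_(0 <= i < n) (series (fun k => a (b (y k, k)) i : R^o) l) *: e i).
      apply/funext => l; rewrite -SB /S /series /=.
      apply: eq_bigr => i _; rewrite -[\sum_(0 <= k0 < l) _]/(series _ l) ser_ab.
      by rewrite addrC -scaleN1r a_lin mulN1r addrC.
    rewrite /series /=; apply: cvg_big => [|i _]; first exact: add_continuous.
    by apply: cvgZl; exact: c_cvg.
  move=> l; have := Sy n k l.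
  have -> : S n x - S n (y (k + l)%N) - (S n x - S n (y k)) = S n (y k) - S n (y (k + l)%N).
    by rewrite opprB addrC addrA subrK addrC.
  move=> /le_trans; apply; rewrite ler_wpM2l//; first by rewrite mulr_ge0// ltW.
  by rewrite gerBl.
suff /a_uniq cE : series (fun i => c i *: e i) @ \oo --> x.
  move=> n; have := Sc n 0%N.
  by rewrite subrr subr0 expr0 mulr1 /S cE.
apply/cvgrPdist_lt => eps eps0.
have [k kP] : exists k, (2 * K + 1) * 2^-1 ^+ k < eps / 2.
  have : (fun k => (2 * K + 1) * 2^-1 ^+ k) @ \oo --> (2 * K + 1) * 0.
    by apply: cvgMr; apply: cvg_expr; rewrite ger0_norm// invf_lt1// ltr1n.
  rewrite mulr0 => /cvgr0Pnorm_lt /(_ (eps / 2)).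
  rewrite divr_gt0// => /(_ isT)[k _ /(_ k (leqnn _))/=].
  by exists k; apply: le_lt_trans (ler_norm _) _.
have : (fun n => S n (x - y k)) @ \oo --> x - y k by exact: ax.
move=> /cvgrPdist_lt /(_ (eps / 2)); rewrite divr_gt0// => /(_ isT).
apply: filterS => n; rewrite SB => nP.
have -> : x - series (fun i => c i *: e i) n = (x - y k - (S n x - S n (y k))) +
   (y k - (series (fun i => c i *: e i) n - (S n x - S n (y k)))).
  by move: (S n x - _) => D; rewrite (addrAC x (- y k)) subrKA opprB subrKA.
apply: le_lt_trans (ler_normD _ _) _; rewrite [ltRHS]splitr ltrD//.
apply: le_lt_trans kP; apply: le_trans (ler_normB _ _) _.
have := ylt k; have := Sc n k; lra.
Qed.

End SchauderBounded.

Lemma near_norm_le (R : realType) (V : normedModType R) T (F : set_system T)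
    {FF : ProperFilter F} (u : T -> V) l (M : R) :
  u @ F --> l -> (\forall x \near F, `|u x| <= M) -> `|l| <= M.
Proof.
move=> ul uM; have nul : (fun n => `|u n|) @ F --> `|l| by exact: cvg_norm.
by rewrite -(cvg_lim _ nul)//; apply: limr_le => //; apply/cvg_ex; exists `|l|.
Qed.

(** * The dual as a Banach space *)

Section DualTheory.
Context {R : realType} {V : normedModType R}.
Implicit Types (f g : dual V).

Definition eval (x : V) (f : dual V) : R^o := f x.

Lemma eval_is_linear x : linear (eval x). Proof. by []. Qed.

HB.instance Definition _ x :=
  GRing.isLinear.Build R (dual V) R^o *:%R (eval x) (eval_is_linear x).

Lemma dualB f g x : (f - g) x = f x - g x.
Proof. exact: (linearB (eval x)). Qed.

Lemma dual_lincomb (es : nat -> dual V) p x :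
  (lincomb es p) x = lincomb (fun i => es i x : R^o) p.
Proof. exact: (linear_lincomb (eval x)). Qed.

Lemma dual_of (f : V -> R^o) M : linear f -> (forall x, `|f x| <= M * `|x|) ->
  exists g : dual V, (g : V -> R^o) = f.
Proof.
move=> lf fM.
pose mf := GRing.isLinear.Build _ _ _ _ f lf.
pose F : {linear V -> R^o} := HB.pack (f : V -> R^o) mf.
have cf : continuous F.
  apply/linear_bounded_continuous/bounded_funP => r; exists (`|M| * r) => x xr.
  apply: le_trans (fM x) _; apply: le_trans (ler_wpM2r _ (ler_norm M)) _ => //.
  exact: ler_wpM2l.
have fd : f \in @dual_pred R V by rewrite inE; split.
by exists (Dual fd).
Qed.

Definition dual_lin f : {linear V -> R^o} :=
  HB.pack (f : V -> R^o) (GRing.isLinear.Build _ _ _ _ f (@dual_linear R V f)).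

Lemma dual_map_lincomb f (e : nat -> V) p :
  f (lincomb e p) = lincomb (fun i => f (e i) : R^o) p.
Proof. exact: (linear_lincomb (dual_lin f)). Qed.

Lemma ler_dual f x : `|f x| <= `|f| * `|x|.
Proof.
have [->|x0] := eqVneq x 0.
  by have -> : f 0 = 0 := linear0 (dual_lin f); rewrite !normr0 mulr0.
have nx0 : 0 < `|x| by rewrite normr_gt0.
have := @dual_norm_ub R V f (`|x|^-1 *: x).
have -> : f (`|x|^-1 *: x) = `|x|^-1 * f x by exact: (linearZ_LR (dual_lin f)).
rewrite normrZ normrM !normfV !normr_id mulVf ?gt_eqF// => /(_ (lexx _)).
by rewrite ler_pdivrMl// mulrC.
Qed.

Lemma dual_norm_le f M : 0 <= M -> (forall x, `|f x| <= M * `|x|) -> `|f| <= M.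
Proof.
move=> M0 fM; apply: dual_norm_lub => x x1; apply: le_trans (fM x) _.
exact: ler_piMr.
Qed.

(** Completeness of the dual allows the theory of Rosenthal bases of Banach spaces to be applied to
    [f]. The limit is taken pointwise; it is bounded because it stays close to one functional
    [f0]. *)
Lemma dual_cauchy_cvg (F : set_system (dual V)) :
  ProperFilter F -> cauchy F -> cvg F.
Proof.
move=> FF /cauchyP Fc.
have near_x x (eps : R) : 0 < eps -> exists f0 : dual V,
    \forall h \near F, `|f0 x - (h : dual V) x| < eps.
  move=> eps0; have x1 : 0 < `|x| + 1 by rewrite ltr_wpDl.
  have [//|f0 Ff0] := Fc (eps / (`|x| + 1)); first by rewrite divr_gt0.
  exists f0; apply: filterS Ff0 => f; rewrite -ball_normE /= => ff0.
  rewrite -dualB; apply: le_lt_trans (ler_dual _ _) _.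
  have : `|f0 - f| * `|x| <= `|f0 - f| * (`|x| + 1) by rewrite ler_wpM2l// lerDl.
  by move=> /le_lt_trans; apply; rewrite -ltr_pdivlMr.
have /choice[phi phiP] (x : V) : exists l : R^o, (fun f : dual V => f x) @ F --> l.
  apply/cvg_ex; apply: R_complete; apply/cauchyP => eps eps0.
  have [f0 Ff0] := near_x x _ eps0; exists (f0 x).
  by near=> f; rewrite -ball_normE /=; near: f.
have phi_lin : linear phi.
  move=> a x y; apply: (cvg_unique _ (phiP _)) => //=.
  under eq_fun do rewrite dual_linear.
  by apply: cvgD; [apply: cvgZr|]; exact: phiP.
have phiM f0 eps : 0 <= eps -> F (ball f0 eps) -> forall x,
    `|f0 x - phi x| <= eps * `|x|.
  move=> e0 Fb x; apply: (@near_norm_le _ _ _ F _ (fun f => f0 x - f x)).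
    by apply: cvgB; [exact: cvg_cst|exact: phiP].
  apply: filterS Fb => f; rewrite -ball_normE /= => ff0.
  rewrite -dualB; apply: le_trans (ler_dual _ _) _.
  by rewrite ler_wpM2r// ltW.
have [f0 Ff0] := Fc 1 ltr01.
have [g gphi] : exists g : dual V, (g : V -> R^o) = phi.
  apply: (@dual_of _ (1 + `|f0|)) => // x.
  have -> : phi x = f0 x - (f0 x - phi x) by rewrite subKr.
  apply: le_trans (ler_normB _ _) _; rewrite mulrDl addrC lerD ?ler_dual//.
  exact: phiM.
apply/cvg_ex; exists g; apply/cvgrPdist_le => eps eps0.
have e20 : 0 < eps / 2 by rewrite divr_gt0.
have [f1 Ff1] := Fc _ e20.
apply: filterS (Ff1) => f; rewrite -ball_normE /= => ff1.
rewrite -(subrKA f1) [leRHS]splitr; apply: le_trans (ler_normD _ _) _.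
apply: lerD; last exact: ltW.
rewrite distrC; apply: dual_norm_le; first exact: ltW.
by move=> x; rewrite dualB gphi; apply: phiM => //; exact: ltW.
Unshelve. all: by end_near. Qed.

HB.instance Definition _ := Uniform_isComplete.Build (dual V) dual_cauchy_cvg.

End DualTheory.

Definition coordinates (R : realType) (X : normedModType R) (K : R)
    (e : nat -> X) (es : nat -> dual X) :=
  [/\ 0 < K,
      forall x, series (fun i => es i x *: e i) @ \oo --> x,
      forall i j, es i (e j) = (i == j)%:R,
      forall n x, `|\sum_(i < n) es i x *: e i| <= K * `|x|
    & forall i x, `|es i x| <= K * `|x|].

Lemma schauder_coordinates (R : realType) (X : completeNormedModType R)
    (e : nat -> X) : (forall i, `|e i| = 1) -> schauder_basis e ->
  exists K es, coordinates K e es.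
Proof.
move=> e1 eb; have [K K0 KP] := schauder_bounded e1 eb.
have /choice[a aP] (x : X) : exists a : nat -> R,
    series (fun i => a i *: e i) @ \oo --> x.
  by have [a [ax _]] := eb x; exists a.
have a_uniq x b : series (fun i => b i *: e i) @ \oo --> x -> a x = b.
  move=> bx; have [c [_ cu]] := eb x.
  by rewrite -(cu _ (aP x)) (cu _ bx).
have a_lin i : linear (fun x => a x i : R^o).
  move=> c x y.
  suff /a_uniq -> : series (fun i => (c * a x i + a y i) *: e i) @ \oo --> c *: x + y by [].
  have -> : series (fun i => (c * a x i + a y i) *: e i) =
    (fun n => c *: series (fun i => a x i *: e i) n + series (fun i => a y i *: e i) n).
    apply/funext => n; rewrite /series /= scaler_sumr -big_split.
    by apply: eq_bigr => j _ /=; rewrite scalerDl scalerA.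
  by apply: cvgD; [apply: cvgZr|]; exact: aP.
have a_b i x : `|a x i| <= 2 * K * `|x|.
  have : `|a x i *: e i| <= 2 * K * `|x|.
    have -> : a x i *: e i = series (fun i => a x i *: e i) i.+1 - series (fun i => a x i *: e i) i.
      by rewrite seriesSr addrC addKr.
    apply: le_trans (ler_normB _ _) _.
    have := KP _ _ (aP x) i.+1; have := KP _ _ (aP x) i; lra.
  by rewrite normrZ e1 mulr1.
have /choice[es esP] (i : nat) : exists g : dual X, (g : X -> R^o) = (fun x => a x i).
  exact: dual_of (a_lin i) (a_b i).
exists (2 * K), es; split.
- by rewrite mulr_gt0.
- by move=> x; under eq_fun do rewrite esP; exact: aP.
- move=> i j; rewrite esP.
  suff /a_uniq -> : series (fun i => (i == j)%:R *: e i) @ \oo --> e j by [].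
  apply: cvg_near_cst; exists j.+1 => // n /= jn.
  rewrite /series /= big_mkord (bigD1 (Ordinal jn))//= eqxx scale1r big1 ?addr0//.
  move=> k /eqP kj; case: eqP => [kE|_]; rewrite ?scale0r//.
  by case: kj; exact: val_inj.
- move=> n x; have := KP _ _ (aP x) n; rewrite /series /= big_mkord.
  under eq_bigr do rewrite esP; move=> /le_trans; apply.
  by rewrite ler_wpM2r// ler_peMl// ?ltW// ltr1n.
- by move=> i x; rewrite esP; exact: a_b.
Qed.

Section CoordinatesTheory.
Context {R : realType} {X : normedModType R} {K : R}.
Context {e : nat -> X} {es : nat -> dual X}.
Hypothesis co : coordinates K e es.

Lemma coord_lincomb i p : es i (lincomb e p) = p`_i.
Proof.
have [_ _ eses _ _] := co; rewrite dual_map_lincomb.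
have -> : (fun j => es i (e j) : R^o) = (fun j => ('X^j)`_i : R^o).
  by apply/funext => j; rewrite eses coefXn.
by rewrite -[in RHS](lincombX p) coef_lincomb.
Qed.

Lemma coord_ler i (p : {poly R}) : `|p`_i| <= K * `|lincomb e p|.
Proof. by rewrite -coord_lincomb; case: co. Qed.

Lemma coord_eq0 p : lincomb e p = 0 -> p = 0.
Proof.
move=> p0; apply/polyP => i; rewrite coef0; apply/eqP.
by rewrite -normr_le0; apply: le_trans (coord_ler i p) _; rewrite p0 normr0 mulr0.
Qed.

Lemma coord_take n p : `|lincomb e (restr (fun i => i < n)%N p)| <= K * `|lincomb e p|.
Proof.
have [_ _ _ Kn _] := co; apply: le_trans (Kn n _); rewrite (@lincomb_wide _ _ n).
  rewrite le_eqVlt; apply/orP; left; apply/eqP; congr `| _ |.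
  by apply: eq_bigr => i _; rewrite coef_restr ltn_ord coord_lincomb.
by apply/leq_sizeP => j nj; rewrite coef_restr ltnNge nj.
Qed.

End CoordinatesTheory.

(** * Unconditionality and spreading *)

Section Suppression.
Context {R : realType} {V : normedModType R}.
Implicit Types (g : nat -> V) (p q : {poly R}).

(** The supports being disjoint, discarding blocks is the same as discarding the coordinates in
    their supports. *)
Lemma blocks_suppression g K (y : nat -> {poly R}) : suppression K g ->
  (forall i i' j, (y i)`_j != 0 -> (y i')`_j != 0 -> i = i') ->
  suppression K (fun i => lincomb g (y i)).
Proof.
move=> gK yd A p; rewrite -!lincomb_comp.
pose A' j := `[< exists i, A i /\ (y i)`_j != 0 >].
suff -> : lincomb y (restr A p) = restr A' (lincomb y p) by exact: gK.
rewrite lincomb_mult linear_lincomb; congr lincomb; apply/funext => i.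
have [Ai|Ai] := boolP (A i).
  rewrite scale1r; apply/esym/restr_id => j yij; apply/asboolP.
  by exists i.
rewrite scale0r; apply/esym/restr_eq0 => j yij; apply/asboolP => -[i' [Ai' yi'j]].
by move: Ai; rewrite (yd _ _ _ yij yi'j) Ai'.
Qed.

Lemma dominated_suppression (W : normedModType R) (g : nat -> V) (h : nat -> W) K :
  0 < K -> dominated g h -> dominated h g -> suppression K h ->
  exists2 K', 0 < K' & suppression K' g.
Proof.
move=> K0 [C C0 gh] [D D0 hg] hK; exists (C * (K * D)).
  by rewrite !mulr_gt0.
move=> A p; apply: le_trans (gh _) _; rewrite -mulrA ler_pM2l//.
by apply: le_trans (hK A p) _; rewrite -mulrA ler_pM2l.
Qed.

(** A multiplier with values in [[0, B]] is a convex combination of multipliers with values in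
    [{0, B}], which are multiples of projections. The induction pushes one coordinate at a time to
    the end points; coordinates outside the support of [p] are first set to 0. *)
Lemma suppression_ge0_mult g K B v p : 0 < K -> suppression K g -> 0 < B ->
  (forall i, 0 <= v i <= B) ->
  `|lincomb g (mult v p)| <= B * K * `|lincomb g p|.
Proof.
move=> K0 gK B0 vB.
suff H n : forall v, (forall i, 0 <= v i <= B) ->
    (forall i, (n <= i)%N -> v i = 0 \/ v i = B) ->
    `|lincomb g (mult v p)| <= B * K * `|lincomb g p|.
  have -> : mult v p = mult (fun i => if (i < size p)%N then v i else 0) p.
    by apply/polyP => i; rewrite !coef_mult; case: ltnP => // /(nth_default _) ->; rewrite !mulr0.
  apply: (H (size p)) => i; first by case: ifP => //; rewrite lexx ltW.
  by rewrite leqNgt => /negbTE ->; left.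
elim: n => [|n IH] {}v {}vB v01.
  have -> : mult v p = B *: restr (fun i => v i == B) p.
    apply/polyP => i; rewrite coef_mult coefZ coef_restr.
    case: eqP => [->//|]; case: (v01 i (leq0n i)) => [->|//].
    by rewrite mul0r mulr0.
  by rewrite linearZ normrZ gtr0_norm//= -mulrA ler_pM2l.
pose w c i := if i == n then c else v i.
have wP c : 0 <= c <= B -> c = 0 \/ c = B ->
    `|lincomb g (mult (w c) p)| <= B * K * `|lincomb g p|.
  move=> cB c01; apply: IH => i; rewrite /w; first by case: eqP.
  by case: eqP => // /eqP ni ni'; apply: v01; rewrite ltn_neqAle eq_sym ni.
have -> : mult v p = (v n / B) *: mult (w B) p + (1 - v n / B) *: mult (w 0) p.
  apply/polyP => i; rewrite coefD !coefZ !coef_mult /w; case: eqP => [->|_]; last by ring.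
  by rewrite mul0r mulr0 addr0 mulrA divfK ?gt_eqF.
have /andP[vn0 vnB] := vB n.
have t0 : 0 <= v n / B by rewrite divr_ge0// ltW.
have t1 : 0 <= 1 - v n / B by rewrite subr_ge0 ler_pdivrMr// mul1r.
move: (v n / B) t0 t1 => s t0 t1.
rewrite linearD !linearZ_LR /=; apply: le_trans (ler_normD _ _) _.
rewrite !normrZ (ger0_norm t0) (ger0_norm t1).
have := wP B; have := wP 0; rewrite !lexx (ltW B0) => /(_ isT (or_introl erefl)) H0.
move=> /(_ isT (or_intror erefl)) HB.
have := ler_wpM2l t0 HB; have := ler_wpM2l t1 H0; lra.
Qed.

Lemma suppression_mult g K B v p : 0 < K -> suppression K g -> 0 < B ->
  (forall i, `|v i| <= B) ->
  `|lincomb g (mult v p)| <= 2 * B * K * `|lincomb g p|.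
Proof.
move=> K0 gK B0 vB.
have -> : mult v p = mult (fun i => Num.max (v i) 0) p - mult (fun i => Num.max (- v i) 0) p.
  apply/polyP => i; rewrite coefB !coef_mult -mulrBl; congr (_ * _).
  have [v0|v0] := leP 0 (v i).
    by rewrite (max_idPr _) ?subr0// oppr_le0.
  by rewrite (max_idPl _) ?sub0r ?opprK// oppr_ge0 ltW.
rewrite linearB; apply: le_trans (ler_normB _ _) _.
have := @suppression_ge0_mult g K B (fun i => Num.max (v i) 0) p K0 gK B0.
have := @suppression_ge0_mult g K B (fun i => Num.max (- v i) 0) p K0 gK B0.
set x := `|_|; set y := `|_|.
have H1 i : 0 <= Num.max (- v i) 0 <= B.
  rewrite le_max lexx orbT ge_max (ltW B0) andbT lerNl.
  by have := vB i; rewrite ler_norml => /andP[].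
have H2 i : 0 <= Num.max (v i) 0 <= B.
  by rewrite le_max lexx orbT ge_max (ltW B0) andbT; have := vB i; rewrite ler_norml => /andP[].
move=> /(_ H1) yK /(_ H2) xK; lra.
Qed.

Lemma suppression_le g K p q : 0 < K -> suppression K g ->
  (forall i, `|p`_i| <= `|q`_i|) -> `|lincomb g p| <= 2 * K * `|lincomb g q|.
Proof.
move=> K0 gK pq.
(* Where [q] vanishes so does [p], and the quotient is 0 there by convention. *)
have -> : p = mult (fun i => p`_i / q`_i) q.
  apply/polyP => i; rewrite coef_mult; have [q0|q0] := eqVneq q`_i 0.
    by apply/eqP; rewrite q0 mulr0 -normr_le0; apply: le_trans (pq i) _; rewrite q0 normr0.
  by rewrite divfK.
rewrite -[2](mulr1 2); apply: suppression_mult => // i.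
have [q0|q0] := eqVneq q`_i 0; first by rewrite q0 invr0 mulr0 normr0.
by rewrite normf_div ler_pdivrMr ?normr_gt0// mul1r.
Qed.

(* To suppress [g_2i - g_2i+1], spread it over [n.+2] slots: its copies on consecutive
   slots telescope, so that their average has norm of order [1 / n]. *)
Lemma diff_suppression g K : 0 < K -> spreading K g ->
  suppression (K * K) (fun i => g i.*2 - g i.*2.+1).
Proof.
move=> K0 gK A p; set d := fun i => _.
pose X2 : nat -> {poly R} := fun i => 'X^(i.*2) - 'X^(i.*2.+1).
have hP h : {homo h : i j / (i < j)%N} ->
    forall q, `|lincomb (fun i => g (h i.*2) - g (h i.*2.+1)) q| <= K * `|lincomb d q| /\
    `|lincomb d q| <= K * `|lincomb (fun i => g (h i.*2) - g (h i.*2.+1)) q|.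
  move=> hh q; have := gK h hh (lincomb X2 q); rewrite !lincomb_comp.
  have -> : (fun i => lincomb (g \o h) (X2 i)) = (fun i => g (h i.*2) - g (h i.*2.+1)).
    by apply/funext => i; rewrite linearB /= !lincombXn.
  have -> : (fun i => lincomb g (X2 i)) = d.
    by apply/funext => i; rewrite linearB /= !lincombXn.
  by [].
(* The last term does not depend on [n], so it disappears after division by [n.+1] for large [n]. *)
suff H n : n.+1%:R * `|lincomb d (restr A p)| <=
    n.+1%:R * (K * K * `|lincomb d p|) + K * K * `|lincomb d (restr (predC A) p)|.
  rewrite leNgt; apply/negP => lt; move: H.
  set x := `|_|; set y := _ * `|_|; set z := K * K * _ => H.
  have xy0 : 0 < x - y by rewrite subr_gt0.
  have := H (Num.truncn (z / (x - y))).
  have := truncnS_gt (z / (x - y)); rewrite ltr_pdivrMr//.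
  set m := _%:R; nra.
pose w := n.+2.
(* Pair [i] owns the slots from [i * w] on. For [i] in [A] it sits on the two extreme slots for
   every [k]; otherwise it sits on slots [k] and [k.+1]. Summing over [k] repeats the extreme
   difference [n.+1] times on [A] and telescopes to a single one off [A]. *)
pose h k j := (j./2 * w + if odd j then (if A j./2 then n.+1 else k.+1)
                          else (if A j./2 then 0 else k))%N.
have hh k : (k <= n)%N -> {homo h k : i j / (i < j)%N}.
  move=> kn; apply: homo_ltn => [|j]; first exact: ltn_trans.
  rewrite /h /= uphalf_half /w; case: (odd j) => /=; case: ifP => _; rewrite ?add0n ?add1n //.
  - by case: ifP; nia.
  - by case: ifP; nia.
  - by rewrite ltn_add2l.
  - by rewrite ltn_add2l.
pose h' j := (j./2 * w + if odd j then n.+1 else 0)%N.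
have hh' : {homo h' : i j / (i < j)%N}.
  apply: homo_ltn => [|j]; first exact: ltn_trans.
  by rewrite /h' /= uphalf_half /w; case: (odd j) => /=; nia.
pose d' i := g (i * w)%N - g (i * w + n.+1)%N.
have d'E : (fun i => g (h' i.*2) - g (h' i.*2.+1)) = d'.
  by apply/funext => i; rewrite /h' /= odd_double uphalf_double doubleK addn0.
have sumE : \sum_(k < n.+1) lincomb (fun i => g (h k i.*2) - g (h k i.*2.+1)) p =
    n.+1%:R *: lincomb d' (restr A p) + lincomb d' (restr (predC A) p).
  rewrite -lincomb_sum -lincombZ !lincomb_mult -lincombD; congr lincomb.
  apply/funext => i; rewrite /d' /h /= odd_double uphalf_double doubleK /=.
  case: (A i) => /=; rewrite ?scale1r ?scale0r ?addr0 ?add0r.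
    by rewrite addn0 sumr_const card_ord scaler_nat.
  rewrite -(big_mkord xpredT (fun k => g (i * w + k)%N - g (i * w + k.+1)%N)).
  under eq_bigr do rewrite -opprB.
  by rewrite sumrN (telescope_sumr (fun k => g (i * w + k)%N))// opprB addn0.
have nS : n.+1%:R * `|lincomb d' (restr A p)| <=
    n.+1%:R * (K * `|lincomb d p|) + K * `|lincomb d (restr (predC A) p)|.
  have -> : n.+1%:R * `|lincomb d' (restr A p)| = `|n.+1%:R *: lincomb d' (restr A p)|.
    by rewrite normrZ normr_nat.
  have -> : n.+1%:R *: lincomb d' (restr A p) =
    \sum_(k < n.+1) lincomb (fun i => g (h k i.*2) - g (h k i.*2.+1)) p
      - lincomb d' (restr (predC A) p) by rewrite sumE addrK.
  apply: le_trans (ler_normB _ _) _; apply: lerD.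
    apply: le_trans (ler_norm_sum _ _ _) _.
    apply: (@le_trans _ _ (\sum_(k < n.+1) K * `|lincomb d p|)).
      by apply: ler_sum => k _; have [] := hP _ (hh k (ltn_ord k)) p.
    by rewrite sumr_const card_ord mulr_natl.
  by rewrite -d'E; have [] := hP _ hh' (restr (predC A) p).
have := hP _ hh' (restr A p); rewrite d'E => -[_ H2].
have := ler_wpM2l (ltW K0) nS; have := ler_wpM2l (ler0n R n.+1) H2; lra.
Qed.

End Suppression.

(** * Uniform equivalence with subsequences, and unconditionality *)

Section RosenthalSpreading.
Context {R : realType} {X : normedModType R} {K : R}.
Context {e : nat -> X} {es : nat -> dual X}.
Hypotheses (co : coordinates K e es) (e1 : forall i, `|e i| = 1).

Let K0 : 0 < K. Proof. by case: co. Qed.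

Lemma subseq_coord_ler k i (p : {poly R}) : injective k ->
  `|p`_i| <= K * `|lincomb (e \o k) p|.
Proof.
by move=> kI; rewrite -lincomb_spread -(coef_spread p i kI); exact: (coord_ler co).
Qed.

(** Each of the first [r] coefficients is at most [K] times the norm, and exchanging a unit vector
    moves it by at most 2. *)
Lemma finite_modification k k' r p : injective k ->
  (forall i, (r <= i)%N -> k i = k' i) ->
  `|lincomb (e \o k') p| <= (1 + 2 * K * r%:R) * `|lincomb (e \o k) p|.
Proof.
move=> kI kk'; rewrite -[lincomb (e \o k') p](subrK (lincomb (e \o k) p)) -lincombB.
apply: le_trans (ler_normD _ _) _; rewrite addrC mulrDl mul1r lerD2l.
rewrite (@lincomb_wide _ _ (r + size p)) ?leq_addl//.
apply: le_trans (ler_norm_sum _ _ _) _; rewrite big_split_ord/= addrC big1 => [|i _].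
  rewrite add0r; apply: (@le_trans _ _ (\sum_(i < r) (2 * K * `|lincomb (e \o k) p|))).
    apply: ler_sum => i _; rewrite normrZ -mulrA mulrC.
    apply: ler_pM => //; last exact: subseq_coord_ler.
    by apply: le_trans (ler_normB _ _) _; rewrite !e1.
  by rewrite sumr_const card_ord -mulr_natr; lra.
by rewrite kk' ?leq_addr// subrr scaler0 normr0.
Qed.

Hypothesis eR : forall u : nat -> X, normalized_block_basis e u ->
  exists2 k : nat -> nat, {homo k : i j / (i < j)%N}
    & equivalent_seq (fun n => u (k n)) e.

Let equiv (C : R) M := forall p, `|lincomb (e \o M) p| <= C * `|lincomb e p| /\
  `|lincomb e p| <= C * `|lincomb (e \o M) p|.

Let equiv_modification C k k' r : 0 <= C -> injective k -> injective k' ->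
  (forall i, (r <= i)%N -> k i = k' i) ->
  equiv C k -> equiv ((1 + 2 * K * r%:R) * C) k'.
Proof.
move=> C0 kI k'I kk' kC p; have [H1 H2] := kC p.
have D0 : 0 <= 1 + 2 * K * r%:R by rewrite addr_ge0// !mulr_ge0// ltW.
split.
  apply: le_trans (finite_modification p kI kk') _.
  by rewrite -(mulrA _ C) ler_wpM2l.
apply: le_trans H2 _; rewrite (mulrC (_ + _)) -(mulrA C) ler_wpM2l//.
by apply: finite_modification => // i ri; rewrite kk'.
Qed.

Lemma subseq_block M : {homo M : i j / (i < j)%N} ->
  normalized_block_basis e (e \o M).
Proof.
move=> Mh.
have -> : e \o M = fun n => lincomb e 'X^(M n) by apply/funext => n; rewrite lincombXn.
apply: normalized_block => [m n i j mn|n]; last by rewrite lincombXn e1.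
rewrite !coefXn; case: (i =P M m) => [->|]; last by rewrite eqxx.
by case: (j =P M n) => [-> _ _|]; [exact: Mh|rewrite eqxx].
Qed.

(* The admissible constant is allowed to grow with the first index [M 0], which
   makes the set of good subsequences closed while still letting finitely many
   initial terms be replaced. *)
Lemma rosenthal_spreading : exists2 K', 0 < K' & spreading K' e.
Proof.
pose g (s : nat) : R := (1 + 2 * K * s%:R) * s%:R.
pose U := [set M : nat -> nat | ~ equiv (g (M 0%N)) M].
have [M nM|M [Mh [bad|good]]] := @open_ramsey U.
- have [p pM] : exists p, ~ (`|lincomb (e \o M) p| <= g (M 0%N) * `|lincomb e p| /\
     `|lincomb e p| <= g (M 0%N) * `|lincomb (e \o M) p|) by exact/existsNP.
  exists (size p).+1 => N NM; rewrite /U /= => /(_ p).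
  have NE : lincomb (e \o N) p = lincomb (e \o M) p.
    by apply: eq_lincomb => i ip /=; rewrite NM// ltnW.
  by rewrite NE NM.
- exfalso; pose k0 n := (2 ^ n)%N.
  have k0h : {homo k0 : i j / (i < j)%N} by move=> i j ij; rewrite /k0 ltn_exp2l.
  have [l lh] := eR (subseq_block (fun i j ij => Mh _ _ (k0h _ _ ij))).
  move=> [C C1 CE].
  have C0 : 0 < C by exact: lt_le_trans C1.
  have Cl : equiv C (M \o k0 \o l).
    move=> p; have [] := CE (size p) (fun i => p`_i).
    by rewrite ler_pdivrMl.
  pose r := (Num.truncn C).+1.
  have Cr : C <= r%:R by apply/ltW; exact: truncnS_gt.
  (* The first [r.+1] indices become consecutive ones starting beyond [r]; the powers of 2 in [k0]
     leave room for them before [k0 (l r.+1)]. The first index is now large enough for [g] to exceed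
     the modified constant, against [bad]. *)
  pose k i := if (i <= r)%N then (k0 (l r) + i)%N else k0 (l i).
  have rl : (r <= l r)%N := homo_ltn_ge lh r.
  have l2 : (l r < k0 (l r))%N by rewrite /k0 ltn_expl.
  have kh : {homo k : i j / (i < j)%N}.
    apply: homo_ltn => [|i]; first exact: ltn_trans.
    rewrite /k; case: (ltngtP i r) => ir.
    - by rewrite ltn_add2l.
    - by apply: k0h; exact: lh.
    - have : (2 ^ (l r).+1 <= k0 (l i.+1))%N.
        by rewrite /k0 leq_exp2l// lh// ir.
      by rewrite expnS ir; move: l2 rl; rewrite /k0; lia.
  apply: (bad _ kh).
  have : equiv ((1 + 2 * K * r.+1%:R) * C) (M \o k).
    apply: (@equiv_modification C (M \o k0 \o l)) => //.
    - exact: ltW.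
    - by apply: homo_ltn_inj => i j ij; apply/Mh/k0h/lh.
    - by apply: homo_ltn_inj => i j ij; apply/Mh/kh.
    - by move=> i ri; rewrite /= /k leqNgt ri.
  have rs : (r.+1 <= (M \o k) 0)%N.
    rewrite /= /k leq0n addn0; apply: leq_trans (homo_ltn_ge Mh _).
    exact: leq_ltn_trans rl l2.
  have Dg : (1 + 2 * K * r.+1%:R) * C <= g ((M \o k) 0%N).
    rewrite /g; set s := (M \o k) 0%N in rs *.
    have rs' : r.+1%:R <= s%:R :> R by rewrite ler_nat.
    apply: ler_pM.
    - by rewrite addr_ge0// !mulr_ge0// ltW.
    - exact: ltW.
    - by rewrite lerD2l ler_wpM2l// mulr_ge0// ltW.
    - by apply: le_trans Cr _; rewrite ler_nat; exact: ltnW.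
  move=> H p; have [H1 H2] := H p.
  by split; [apply: le_trans H1 _|apply: le_trans H2 _]; rewrite ler_wpM2r.
pose c := Num.max 1 ((1 + 2 * K * 1%:R) * g (M 0%N)).
have c1 : 1 <= c by rewrite le_max lexx.
have c0 : 0 < c by exact: lt_le_trans c1.
have Mc k : {homo k : i j / (i < j)%N} -> equiv c (M \o k).
  (* Resetting the first index to 0 makes the constant [g (M 0%N)] for every [k], at the price of
     changing back one term. *)
  move=> kh; pose k' i := if i is 0 then 0%N else k i.
  have k'h : {homo k' : i j / (i < j)%N}.
    move=> [|i] [|j]//= ij; last exact: kh.
    exact: leq_ltn_trans (leq0n _) (kh _ _ ij).
  have /contrapT gk' : ~ ~ equiv (g ((M \o k') 0%N)) (M \o k') := good _ k'h.
  have : equiv ((1 + 2 * K * 1%:R) * g (M 0%N)) (M \o k).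
    apply: (@equiv_modification _ (M \o k')) => //.
    - by rewrite /g !mulr_ge0// addr_ge0// !mulr_ge0// ltW.
    - by apply: homo_ltn_inj => i j ij; apply/Mh/k'h.
    - by apply: homo_ltn_inj => i j ij; apply/Mh/kh.
    - by move=> [|i].
  move=> H p; have [H1 H2] := H p.
  by split; [apply: le_trans H1 _|apply: le_trans H2 _]; rewrite ler_wpM2r// le_max lexx orbT.
exists (c * c); first exact: mulr_gt0.
move=> k kh p; have [H1 H2] := Mc _ kh p.
(* Applied to spread coefficients, the equivalence of [e \o M] with [e] relates [e \o M \o k] to
   [e \o k], whereas [H1] and [H2] relate it to [e]. *)
have [H3 H4] := Mc id (fun i j ij => ij) (spread k p).
move: H3 H4; rewrite !lincomb_spread => H3 H4; split.
  apply: le_trans H4 _; rewrite -mulrA ler_pM2l//.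
apply: le_trans H2 _; rewrite -mulrA ler_pM2l//.
Qed.

Lemma rosenthal_suppression : exists2 K', 0 < K' & suppression K' e.
Proof.
have [K' K'0 eK'] := rosenthal_spreading.
have dK := diff_suppression K'0 eK'; set d := fun i => _ in dK.
pose X2 : nat -> {poly R} := fun i => 'X^(i.*2) - 'X^(i.*2.+1).
have dE i : d i = lincomb e (X2 i) by rewrite linearB /= !lincombXn.
have X20 i : X2 i != 0.
  apply/eqP => /polyP /(_ i.*2); rewrite coefB !coefXn coef0 eqxx ltn_eqF//.
  by rewrite subr0 => /eqP; rewrite oner_eq0.
have d0 i : `|d i| != 0.
  by rewrite normr_eq0; apply: contraNneq (X20 i) => di0; rewrite (coord_eq0 co (p := X2 i))// -dE.
have X2s i j : (X2 i)`_j != 0 -> (i.*2 <= j <= i.*2.+1)%N.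
  rewrite coefB !coefXn; case: (j =P i.*2) => [->|_]; first by rewrite leqnn leqnSn.
  by case: (j =P i.*2.+1) => [->|_]; [rewrite leqnn leqnSn|rewrite subrr eqxx].
pose y i : {poly R} := `|d i|^-1 *: X2 i.
have yE i : lincomb e (y i) = `|d i|^-1 *: d i by rewrite linearZ /= -dE.
have yb : normalized_block_basis e (fun n => lincomb e (y n)).
  apply: normalized_block => [m n i j mn|n].
    rewrite !coefZ !mulf_eq0 !negb_or => /andP[_ /X2s mi] /andP[_ /X2s nj].
    by move: mi nj mn; rewrite -!muln2; lia.
  by rewrite yE normrZ normfV normr_id mulVf.
have [k kh /equivalent_seqP[uk ku]] := eR yb.
apply: (dominated_suppression _ ku uk (K := K' * K')); first exact: mulr_gt0.
(* The rescaled and thinned out differences are disjoint blocks of [d], hence inherit its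
   suppression constant. *)
have -> : (fun n => lincomb e (y (k n))) =
    (fun n => lincomb d (`|d (k n)|^-1 *: 'X^(k n))).
  by apply/funext => n; rewrite yE linearZ /= lincombXn.
apply: blocks_suppression => // i i' j; rewrite !coefZ !coefXn.
case: (j =P k i) => [->|]; last by rewrite mulr0 eqxx.
case: (k i =P k i') => [/(homo_ltn_inj kh)//|]; by rewrite mulr0 eqxx.
Qed.

End RosenthalSpreading.

Lemma sum_tensor (R : pzRingType) n m (F G : nat -> R) : (0 < m)%N ->
  \sum_(i < n * m) F (i %/ m)%N * G (i %% m)%N =
  (\sum_(i < n) F i) * (\sum_(i < m) G i).
Proof.
move=> m0; rewrite -(big_mkord xpredT (fun i => F (i %/ m)%N * G (i %% m)%N)).
rewrite big_nat_mul mulr_suml -(big_mkord xpredT (fun i => F i * \sum_(l < m) G l)).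
apply: eq_bigr => j _; rewrite mulSn -{1}[(j * m)%N]add0n big_addn addnK.
rewrite big_mkord mulr_sumr; apply: eq_bigr => l _.
by rewrite addnC divnMDl// modnMDl divn_small// modn_small// addn0.
Qed.

Lemma sum_half_le (R : realType) n : \sum_(i < n) 2^-1 ^+ i <= 2 :> R.
Proof.
suff -> : \sum_(i < n) 2^-1 ^+ i = 2 - 2 * 2^-1 ^+ n :> R.
  by rewrite gerBl mulr_ge0// exprn_ge0.
elim: n => [|n IH]; first by rewrite big_ord0 expr0; lra.
rewrite big_ord_recr/= IH exprS; lra.
Qed.

(** * Tensor products of finite vectors *)

Section Tensor.
Context {R : comNzRingType}.
Implicit Types (a b p : {poly R}).

Lemma mulXn_spread p n : p * 'X^n = spread (fun i => i + n)%N p.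
Proof.
rewrite -{1}(lincombX p) /lincomb mulr_suml; apply: eq_bigr => i _.
by rewrite -scalerAl exprD.
Qed.

(* The tensor product of [a] and [b], for [b] of length at most [m], is the polynomial
   [(a \Po 'X^m) * b]. *)
Lemma tensor_lincomb a b m : (a \Po 'X^m) * b = lincomb (fun j => b * 'X^(j * m)) a.
Proof.
rewrite comp_polyE mulr_suml; apply: eq_bigr => i _.
by rewrite -scalerAl -exprM mulnC mulrC.
Qed.

Lemma coef_tensor a b m i : (0 < m)%N -> (size b <= m)%N ->
  ((a \Po 'X^m) * b)`_i = a`_(i %/ m) * b`_(i %% m).
Proof.
move=> m0 bm; rewrite tensor_lincomb coef_lincomb.
under eq_bigr => j _ do rewrite coefMXn.
have [ip|pi] := ltnP (i %/ m) (size a); last first.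
  rewrite [a`_(i %/ m)]nth_default// mul0r big1// => j _.
  suff /negbTE -> : ~~ (i < j * m)%N.
    rewrite [b`_ _]nth_default ?mulr0//; apply: leq_trans bm _.
    rewrite leq_subRL -?mulSn; last by rewrite -leq_divRL//; apply: leq_trans pi; exact: ltnW.
    by rewrite -mulSnr -leq_divRL//; exact: leq_trans pi.
  by rewrite -leqNgt -leq_divRL//; apply: leq_trans pi; exact: ltnW.
rewrite (bigD1 (Ordinal ip))//= ltnNge leq_trunc_div /= big1 ?addr0.
  by rewrite [X in b`_(X - _)](divn_eq i m) addKn.
move=> j /eqP ji; case: ltnP => ij; first by rewrite mulr0.
have ji' : (j < i %/ m)%N.
  rewrite ltn_neqAle leq_divRL// ij andbT; apply/eqP => jE.
  by apply: ji; exact: val_inj.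
rewrite [b`_ _]nth_default ?mulr0//; apply: leq_trans bm _.
by rewrite leq_subRL// -mulSnr -leq_divRL.
Qed.

(** The copies of [b] need not be adjacent: they are moved to windows starting at [t j], which lets
    [spreading] compare the tensor product with copies lying inside the blocks of a thinned
    sequence. *)
Lemma spread_tensor a b m (t : nat -> nat) : (0 < m)%N -> (size b <= m)%N ->
  spread (fun i => t (i %/ m) + i %% m)%N ((a \Po 'X^m) * b) =
  lincomb (fun j => b * 'X^(t j)) a.
Proof.
move=> m0 bm; rewrite tensor_lincomb linear_lincomb; congr lincomb.
apply/funext => j; rewrite /= !mulXn_spread /spread lincomb_comp.
apply: eq_lincomb => i ib; rewrite lincombXn.
have im : (i < m)%N by exact: leq_trans bm.
by rewrite (addnC i (j * m)%N) divnMDl// modnMDl divn_small// modn_small// addn0 addnC.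
Qed.

End Tensor.

(** * The upper tensor estimate, by gluing bad vectors *)

Section TensorUpper.
Context {R : realType} {V : normedModType R} (g : nat -> V) (K L : R).
Hypotheses (K0 : 0 < K) (L0 : 0 < L) (gK : spreading K g) (gL : suppression L g).
Hypothesis g0 : forall i, g i != 0.

Lemma suppression_eq0 p : lincomb g p = 0 -> p = 0.
Proof.
move=> p0; apply/polyP => i; rewrite coef0; apply/eqP.
have : `|lincomb g (restr (pred1 i) p)| <= 0.
  by apply: le_trans (gL _ _) _; rewrite p0 normr0 mulr0.
have -> : restr (pred1 i) p = p`_i *: 'X^i.
  apply/polyP => j; rewrite coef_restr coefZ coefXn /=.
  by case: eqP => [->|_]; rewrite ?mulr1 ?mulr0.
by rewrite linearZ /= lincombXn normr_le0 scaler_eq0 (negbTE (g0 i)) orbF.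
Qed.

Hypothesis gR : forall u : nat -> V, normalized_block_basis g u ->
  exists2 k : nat -> nat, {homo k : i j / (i < j)%N} &
    dominated (fun n => u (k n)) g.

Section Contradiction.
Variables (m : nat -> nat) (a b : nat -> {poly R}).
Hypotheses (bm : forall n, (size (b n) <= m n)%N)
  (b1 : forall n, `|lincomb g (b n)| = 1)
  (big_tensor : forall n, 4 ^+ n * `|lincomb g (a n)| <
     `|lincomb g ((a n \Po 'X^(m n)) * b n)|).

(** Block [i] begins at [s i] and contains windows for [b 0], ..., [b i] side by side; the window of
    [b n] begins at [t i n] and has length [m n]. *)
Let Mn n := (\sum_(i < n) m i)%N.
Let s i := (\sum_(j < i) Mn j.+1)%N.
Let t i n := (s i + Mn n)%N.
Let y i : {poly R} := \sum_(n < i.+1) 2^-1 ^+ n *: (b n * 'X^(t i n)).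

Let b0 n : b n != 0.
Proof. by apply/eqP => bn0; have /eqP := b1 n; rewrite bn0 linear0 normr0 eq_sym oner_eq0. Qed.

Let m0 n : (0 < m n)%N.
Proof. by apply: leq_trans (bm n); rewrite size_poly_gt0. Qed.

Let Mn_le : {homo Mn : i j / (i <= j)%N}.
Proof.
apply: homo_leq => [//||i]; first exact: leq_trans.
by rewrite /Mn big_ord_recr leq_addr.
Qed.

Let s_le : {homo s : i j / (i <= j)%N}.
Proof.
apply: homo_leq => [//||i]; first exact: leq_trans.
by rewrite /s big_ord_recr leq_addr.
Qed.

Let tm i n : (t i n + m n = t i n.+1)%N.
Proof. by rewrite /t /Mn [in RHS]big_ord_recr /= addnA. Qed.

Let t_next i n : (n <= i)%N -> (t i n + m n <= s i.+1)%N.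
Proof. by move=> ni; rewrite tm /t /s big_ord_recr leq_add2l; exact: Mn_le. Qed.

Let t_lt i i' n n' : (n <= i)%N -> (i < i')%N -> (t i n + m n <= t i' n')%N.
Proof.
by move=> ni ii'; apply: leq_trans (t_next ni) (leq_trans (s_le ii') (leq_addr _ _)).
Qed.

Let inB i n j := (t i n <= j < t i n + m n)%N.

Let B_disjoint i n i' n' j : (n <= i)%N -> (n' <= i')%N -> inB i n j -> inB i' n' j ->
  i = i' /\ n = n'.
Proof.
rewrite /inB => ni ni' /andP[l1 u1] /andP[l2 u2].
have [ii'|ii'|ii'] := ltngtP i i'.
- have := t_lt n' ni ii'; by rewrite leqNgt (leq_ltn_trans l2 u1).
- have := t_lt n ni' ii'; by rewrite leqNgt (leq_ltn_trans l1 u2).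
split=> //; subst i'; have [nn'|nn'|//] := ltngtP n n'.
- have : (t i n.+1 <= t i n')%N by rewrite /t leq_add2l; exact: Mn_le.
  by rewrite -tm leqNgt (leq_ltn_trans l2 u1).
- have : (t i n'.+1 <= t i n)%N by rewrite /t leq_add2l; exact: Mn_le.
  by rewrite -tm leqNgt (leq_ltn_trans l1 u2).
Qed.

Let copyB i n j : (b n * 'X^(t i n))`_j != 0 -> inB i n j.
Proof.
rewrite coefMXn /inB; case: ltnP => /= [_|tj bj]; first by rewrite eqxx.
rewrite -ltn_subLR//; apply: leq_trans (bm n); rewrite ltnNge.
by apply: contra_neqN bj => /(nth_default _) ->.
Qed.

Let yB i j : (y i)`_j != 0 -> exists2 n, (n <= i)%N & inB i n j.
Proof.
rewrite /y coef_sum => yij; apply: contrapT => nB; move/eqP: yij; apply.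
apply: big1 => n _; rewrite coefZ; apply/eqP; rewrite mulf_eq0; apply/orP; right.
apply: contrapT => /negP /copyB nj; apply: nB; exists n => //.
by rewrite -ltnS.
Qed.

(** The union of the windows of [b n] over all blocks long enough to contain one. *)
Let An n j := `[< exists2 i, (n <= i)%N & inB i n j >].

Let restr_y n i : (n <= i)%N ->
  restr (An n) (y i) = 2^-1 ^+ n *: (b n * 'X^(t i n)).
Proof.
move=> ni; rewrite /y linear_sum /= (bigD1 (Ordinal (ni : n < i.+1)%N))//=.
rewrite linearZ /= restr_id => [|j /copyB nj]; last by apply/asboolP; exists i.
rewrite big1 ?addr0// => n' /eqP nn'; rewrite linearZ /= restr_eq0 ?scaler0// => j /copyB n'j.
apply/asboolP => -[i' ni' i'j].
have [_ n'n] := B_disjoint (ltn_ord n' : (n' <= i)%N) ni' n'j i'j.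
by apply: nn'; exact: val_inj.
Qed.

Let y0 i : y i != 0.
Proof.
apply/eqP => yi0; have := restr_y (leq0n i); rewrite yi0 linear0 expr0 scale1r.
move=> /esym/eqP; rewrite mulf_eq0 (negbTE (b0 0)) /= -size_poly_eq0 size_polyXn.
by [].
Qed.

Let nu i := `|lincomb g (y i)|.

Let nu_gt0 i : 0 < nu i.
Proof.
rewrite normr_gt0; apply: contra_neq (y0 i); exact: suppression_eq0.
Qed.

Let nu_le i : nu i <= 2 * K.
Proof.
rewrite /nu linear_sum; apply: le_trans (ler_norm_sum _ _ _) _.
apply: (@le_trans _ _ (\sum_(n < i.+1) 2^-1 ^+ n * K)).
  apply: ler_sum => n _; rewrite linearZ /= normrZ ger0_norm ?exprn_ge0//.
  rewrite ler_wpM2l ?exprn_ge0// mulXn_spread lincomb_spread.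
  have [|+ _] := gK (k := (fun i0 => i0 + t i n)%N) _ (b n); last by rewrite b1 mulr1.
  by move=> j j' jj'; rewrite ltn_add2r.
rewrite -mulr_suml ler_wpM2r ?(ltW K0)//.
exact: sum_half_le.
Qed.

Let u_block : normalized_block_basis g (fun i => lincomb g ((nu i)^-1 *: y i)).
Proof.
apply: normalized_block => [i i' j j' ii'|i]; last first.
  by rewrite linearZ /= normrZ gtr0_norm ?invr_gt0// mulVf// gt_eqF.
rewrite !coefZ !mulf_eq0 !negb_or => /andP[_ /yB[n ni /andP[_ nj]]].
move=> /andP[_ /yB[n' ni' /andP[n'j _]]].
exact: leq_trans nj (leq_trans (t_lt n' ni ii') n'j).
Qed.

(** Combining the selected blocks with coefficients [a n] and projecting onto the windows of [b n]
    gives the tensor product, up to spreading and the weight of [b n]. Undoing that weight costs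
    [2 ^+ n], less than the [4 ^+ n] of [big_tensor]. *)
Lemma tensor_upper_contradiction : False.
Proof.
have [k kh [D D0 kD]] := gR u_block.
pose E := D * (2 * K * L).
have E0 : 0 < E by rewrite !mulr_gt0.
have ykE p : `|lincomb g (lincomb (y \o k) p)| <= E * `|lincomb g p|.
  have -> : lincomb g (lincomb (y \o k) p) =
      lincomb (fun n => lincomb g ((nu (k n))^-1 *: y (k n))) (mult (nu \o k) p).
    rewrite lincomb_mult lincomb_comp; congr lincomb; apply/funext => i.
    by rewrite linearZ /= scalerA mulfV ?scale1r// gt_eqF.
  apply: le_trans (kD _) _; rewrite -mulrA ler_pM2l//.
  apply: suppression_ge0_mult => //; first by rewrite mulr_gt0.
  by move=> i /=; rewrite ltW//= nu_le.
pose Q := K * L * E * K; have Q0 : 0 < Q by rewrite !mulr_gt0.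
have key n : `|lincomb g ((a n \Po 'X^(m n)) * b n)| <= 2 ^+ n * Q * `|lincomb g (a n)|.
  (* The shift by [n] is there because only blocks numbered from [n] on contain a copy of [b n]. *)
  pose tj j := t (k (j + n)%N) n.
  have nk j : (n <= k (j + n)%N)%N.
    exact: leq_trans (leq_addl _ _) (homo_ltn_ge kh _).
  have tj_lt i j : (i < j)%N -> (tj i + m n <= tj j)%N.
    by move=> ij; apply: t_lt => //; apply: kh; rewrite ltn_add2r.
  pose h i := (tj (i %/ m n) + i %% m n)%N.
  have hh : {homo h : i j / (i < j)%N}.
    move=> i j ij; have := leq_div2r (m n) (ltnW ij).
    rewrite leq_eqVlt => /orP[/eqP ijm|ijm]; last first.
      rewrite /h; apply: leq_trans (leq_addr _ _); apply: leq_trans (tj_lt _ _ ijm).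
      by rewrite ltn_add2l ltn_mod.
    rewrite /h ijm ltn_add2l.
    move: ij; rewrite [in X in X -> _](divn_eq i (m n)).
    by rewrite [in X in X -> _](divn_eq j (m n)) ijm ltn_add2l.
  have [_ H1] := gK hh ((a n \Po 'X^(m n)) * b n).
  apply: le_trans H1 _; rewrite -lincomb_spread spread_tensor//.
  have H2 : lincomb (fun j => b n * 'X^(tj j)) (a n) =
      2 ^+ n *: restr (An n) (lincomb (y \o k) (a n * 'X^n)).
    rewrite mulXn_spread lincomb_spread (linear_lincomb (restr (An n))) -lincombZ.
    congr lincomb.
    apply/funext => j /=; rewrite restr_y// scalerA -exprMn mulfV// expr1n scale1r.
    by [].
  rewrite H2 linearZ /= normrZ ger0_norm ?exprn_ge0//.
  have H3 := gL (An n) (lincomb (y \o k) (a n * 'X^n)).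
  have H4 := ykE (a n * 'X^n).
  have H5 : `|lincomb g (a n * 'X^n)| <= K * `|lincomb g (a n)|.
    rewrite mulXn_spread lincomb_spread.
    have [|+ _] := gK (k := (fun i0 => i0 + n)%N) _ (a n); last by [].
    by move=> j j' jj'; rewrite ltn_add2r.
  have H6 := le_trans H4 (ler_wpM2l (ltW E0) H5).
  have H7 := le_trans H3 (ler_wpM2l (ltW L0) H6).
  have := ler_wpM2l (ltW K0) (ler_wpM2l (exprn_ge0 n (ler0n R 2)) H7).
  move=> /le_trans; apply; rewrite /Q; lra.
pose n := (Num.truncn Q).+1.
have nQ : Q < 2 ^+ n.
  apply: lt_le_trans (truncnS_gt Q) _; rewrite -natrX ler_nat.
  by apply: ltnW; exact: ltn_expl.
have := lt_le_trans (big_tensor n) (key n).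
have -> : 4 = 2 * 2 :> R by rewrite -natrM.
rewrite exprMn -!(mulrA (2 ^+ n)) ltr_pM2l ?exprn_gt0//.
by rewrite ltNge ler_wpM2r// ltW.
Qed.

End Contradiction.

Lemma tensor_upper : exists2 C, 0 < C & forall m (a b : {poly R}),
  (size b <= m)%N ->
  `|lincomb g ((a \Po 'X^m) * b)| <= C * (`|lincomb g a| * `|lincomb g b|).
Proof.
apply: contrapT => nC.
have /choice[mab mabP] (n : nat) : exists mab : nat * {poly R} * {poly R},
  [/\ (size mab.2 <= mab.1.1)%N, `|lincomb g mab.2| = 1 &
     4 ^+ n * `|lincomb g mab.1.2| <
     `|lincomb g ((mab.1.2 \Po 'X^(mab.1.1)) * mab.2)|].
  apply: contrapT => nm; apply: nC; exists (4 ^+ n); first by rewrite exprn_gt0.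
  move=> m a b bm; rewrite leNgt; apply/negP => lt; apply: nm.
  have b0 : 0 < `|lincomb g b|.
    rewrite normr_gt0; apply/eqP => /suppression_eq0 b0.
    by move: lt; rewrite b0 mulr0 linear0 normr0 mulr0 mulr0 ltxx.
  exists (m, a, `|lincomb g b|^-1 *: b); split=> /=.
  - exact: leq_trans (size_scale_leq _ _) bm.
  - by rewrite linearZ /= normrZ normfV normr_id mulVf// gt_eqF.
  - rewrite -scalerAr linearZ /= normrZ normfV normr_id ltr_pdivlMl//.
    by rewrite (mulrC `|lincomb g b|) -mulrA.
apply: (@tensor_upper_contradiction (fun n => (mab n).1.1)
  (fun n => (mab n).1.2) (fun n => (mab n).2)).
- by move=> n; case: (mabP n).
- by move=> n; case: (mabP n).
- by move=> n; case: (mabP n).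
Qed.

End TensorUpper.

(** * Duality *)

Section FiniteHahnBanach.
Context {R : realType}.
Implicit Types (N : {poly R} -> R) (p q v : {poly R}).

Definition sublinear N := (forall p q, N (p + q) <= N p + N q) /\
  (forall c p, 0 <= c -> N (c *: p) = c * N p).

Lemma sublinear0 N : sublinear N -> N 0 = 0.
Proof. by move=> [_ NZ]; have := NZ 0 0 (lexx _); rewrite scale0r mul0r. Qed.

Lemma sublinearN N p : sublinear N -> - N (- p) <= N p.
Proof.
move=> sN; have [ND _] := sN; rewrite lerNl -subr_ge0 opprK addrC.
by rewrite -(sublinear0 sN) -(subrr p).
Qed.

(* The infimum of [N (p + t *: v) - t * N v] over [0 <= t] is linear along [v]; doing
   this for finitely many [v] replaces Zorn's lemma. *)
Lemma sublinear_step N v : sublinear N -> exists N', [/\ sublinear N',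
  forall p, N' p <= N p & N' (- v) <= - N v].
Proof.
move=> sN; have [ND NZ] := sN.
pose S p := [set N (p + t *: v) - t * N v | t in [set t : R | 0 <= t]].
have Slb p : lbound (S p) (- N (- p)).
  move=> _ [t /= t0 <-]; have := ND (p + t *: v) (- p).
  by rewrite addrAC subrr add0r NZ//; lra.
have Sinf p : has_inf (S p).
  split; last by exists (- N (- p)); exact: Slb.
  by exists (N (p + 0 *: v) - 0 * N v); exists 0 => /=.
have Sle p t : 0 <= t -> inf (S p) <= N (p + t *: v) - t * N v.
  by move=> t0; apply: ge_inf; [case: (Sinf p)|exists t].
have N'D p q : inf (S (p + q)) <= inf (S p) + inf (S q).
  rewrite -lerBlDr; apply: lb_le_inf; first by case: (Sinf p).
  move=> _ [s /= s0 <-]; rewrite lerBlDr -lerBlDl.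
  apply: lb_le_inf; first by case: (Sinf q).
  move=> _ [t /= t0 <-]; rewrite lerBlDr.
  have := Sle (p + q) (t + s) (addr_ge0 t0 s0).
  have := ND (q + t *: v) (p + s *: v).
  have -> : q + t *: v + (p + s *: v) = p + q + (t + s) *: v.
    by rewrite scalerDl addrACA (addrC q).
  lra.
have N'Z c p : 0 < c -> inf (S (c *: p)) <= c * inf (S p).
  move=> c0; rewrite -ler_pdivrMl//; apply: lb_le_inf; first by case: (Sinf p).
  move=> _ [t /= t0 <-]; rewrite ler_pdivrMl//.
  have := Sle (c *: p) (c * t) (mulr_ge0 (ltW c0) t0).
  move=> /le_trans; apply.
  by rewrite -scalerA -scalerDr NZ ?(ltW c0)// mulrBr mulrA.
exists (fun p => inf (S p)); split; [split=> [//|c p]|move=> p|].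
- rewrite le_eqVlt => /orP[/eqP <-|c0].
    rewrite scale0r mul0r; apply/eqP; rewrite eq_le; apply/andP; split.
      by have := Sle 0 0 (lexx _); rewrite scale0r mul0r subr0 addr0 (sublinear0 sN).
    apply: lb_le_inf; first by case: (Sinf 0).
    by move=> _ [t /= t0 <-]; rewrite add0r NZ// subrr.
  apply/eqP; rewrite eq_le N'Z//= -ler_pdivlMl//.
  rewrite -[in leLHS](scale1r p) -(mulVf (lt0r_neq0 c0)) -scalerA.
  by apply: N'Z; rewrite invr_gt0.
- by have := Sle p 0 (lexx _); rewrite scale0r mul0r subr0 addr0.
- have := Sle (- v) 1 ler01.
  by rewrite scale1r mul1r addNr (sublinear0 sN) sub0r.
Qed.

Lemma sublinear_linearize N (vs : seq {poly R}) : sublinear N ->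
  exists N', [/\ sublinear N', forall p, N' p <= N p &
    forall v, v \in vs -> N' (- v) <= - N' v].
Proof.
elim: vs N => [|v vs IH] N sN; first by exists N.
have [N1 [sN1 N1N N1v]] := sublinear_step v sN.
have [N2 [sN2 N2N1 N2v]] := IH _ sN1.
exists N2; split=> // [p|w]; first exact: le_trans (N2N1 p) (N1N p).
rewrite inE => /orP[/eqP ->|/N2v//].
apply: le_trans (N2N1 _) (le_trans N1v _); rewrite lerN2.
exact: le_trans (N2N1 v) (N1N v).
Qed.

Lemma finite_hahn_banach N p : sublinear N -> exists b : nat -> R,
  \sum_(i < size p) p`_i * b i = N p /\
  forall q, (size q <= size p)%N -> \sum_(i < size p) q`_i * b i <= N q.
Proof.
move=> sN; have [N1 [sN1 N1N N1p]] := sublinear_step p sN.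
have [N2 [sN2 N2N1 N2v]] := sublinear_linearize [seq 'X^i | i <- iota 0 (size p)] sN1.
have [N2D N2Z] := sN2; set n := size p.
pose b i := N2 'X^i.
have lin q : (size q <= n)%N -> N2 q <= \sum_(i < n) q`_i * b i.
  move=> qn; rewrite -[in leLHS](lincombX q) (lincomb_wide _ qn).
  suff H m : (m <= n)%N ->
      N2 (\sum_(i < m) q`_i *: 'X^i) <= \sum_(i < m) q`_i * b i by exact: H.
  elim: m => [|m IH] mn; first by rewrite !big_ord0 sublinear0.
  rewrite !big_ord_recr /=; apply: le_trans (N2D _ _) _; apply: lerD (IH (ltnW mn)) _.
  have [q0|q0] := leP 0 q`_m; first by rewrite N2Z.
  rewrite -[in leLHS](opprK q`_m) scaleNr -scalerN N2Z ?oppr_ge0 ?(ltW q0)//.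
  have := N2v 'X^m; rewrite map_f ?mem_iota// => /(_ isT); rewrite -/(b m) => H.
  have q0' : 0 <= - q`_m by rewrite oppr_ge0 ltW.
  by apply: le_trans (ler_wpM2l q0' H) _; rewrite mulrNN.
have lin' q : (size q <= n)%N -> \sum_(i < n) q`_i * b i <= N2 q.
  move=> qn; have := lin (- q); rewrite size_polyN => /(_ qn).
  under eq_bigr do rewrite coefN mulNr.
  rewrite sumrN; have := sublinearN q sN2; lra.
exists b; split=> [|q qn]; last first.
  exact: le_trans (lin' q qn) (le_trans (N2N1 q) (N1N q)).
apply/eqP; rewrite eq_le (le_trans (lin' p _) (le_trans (N2N1 p) (N1N p)))//=.
apply: le_trans (lin p _) => //; apply: le_trans (sublinearN p sN2).
by rewrite lerNr; exact: le_trans (N2N1 _) N1p.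
Qed.

End FiniteHahnBanach.

Section Duality.
Context {R : realType} {X : normedModType R} {K : R}.
Context {e : nat -> X} {es : nat -> dual X}.
Hypothesis co : coordinates K e es.

(** The scalar product of coefficient vectors, written as a [lincomb] of scalars so that [mult] and
    [spread] move across it by the general lemmas. *)
Definition pairing (q p : {poly R}) : R := lincomb (fun i => p`_i : R^o) q.

Let K0 : 0 < K. Proof. by case: co. Qed.

Lemma pairingE q p : (lincomb es q) (lincomb e p) = pairing q p.
Proof.
rewrite dual_lincomb; congr lincomb; apply/funext => i.
exact: (coord_lincomb co).
Qed.

Lemma pairing_le q p : `|pairing q p| <= `|lincomb es q| * `|lincomb e p|.
Proof. by rewrite -pairingE; exact: ler_dual. Qed.

(** [lincomb es q] sees only the first [size q] coordinates of [x], so testing on finite vectors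
    suffices, and truncating [x] costs the factor [K]. *)
Lemma dual_upper C q : 0 <= C ->
  (forall p, `|pairing q p| <= C * `|lincomb e p|) -> `|lincomb es q| <= C * K.
Proof.
move=> C0 qC; apply: dual_norm_le => [|x]; first by rewrite mulr_ge0// ltW.
have [_ _ _ Kn _] := co.
have -> : (lincomb es q) x = pairing q (\poly_(i < size q) es i x).
  by rewrite dual_lincomb; apply: eq_lincomb => i iq; rewrite coef_poly iq.
apply: le_trans (qC _) _; rewrite lincomb_poly -mulrA ler_wpM2l//.
Qed.

(** The functional found on the first [size p] coordinates is extended to longer vectors by
    truncation and then to [X] by [dual_upper]; each extension costs a factor [K]. *)
Lemma norming (p : {poly R}) : exists2 q : {poly R}, (size q <= size p)%N &
  pairing q p = `|lincomb e p| /\ `|lincomb es q| <= K * K.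
Proof.
have sN : sublinear (fun p => `|lincomb e p|).
  split=> [p1 p2|c p1 c0]; first by rewrite linearD; exact: ler_normD.
  by rewrite linearZ /= normrZ ger0_norm.
have [b [bp bq]] := finite_hahn_banach p sN.
pose q := \poly_(i < size p) b i.
have qE p' : pairing q p' = \sum_(i < size p) p'`_i * b i.
  rewrite /pairing lincomb_poly; apply: eq_bigr => i _; exact: mulrC.
exists q; first exact: size_poly.
split; first by rewrite qE.
apply: dual_upper => [|p']; first exact: ltW.
have H p1 : pairing q p1 <= K * `|lincomb e p1|.
  apply: le_trans (coord_take co (size p) p1); rewrite qE.
  apply: le_trans (bq _ _); last first.
    by apply/leq_sizeP => j nj; rewrite coef_restr ltnNge nj.
  by rewrite le_eqVlt; apply/orP; left; apply/eqP/eq_bigr => i _; rewrite coef_restr ltn_ord.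
rewrite ler_norml H andbT lerNl.
have := H (- p'); rewrite linearN /= normrN.
suff -> : pairing q (- p') = - pairing q p' by [].
by rewrite !qE -sumrN; apply: eq_bigr => i _; rewrite coefN mulNr.
Qed.

Lemma dual_suppression L : 0 <= L -> suppression L e -> suppression (L * K) es.
Proof.
move=> L0 eL A q; rewrite mulrAC; apply: dual_upper; first by rewrite mulr_ge0.
move=> p; have -> : pairing (restr A q) p = pairing q (restr A p).
  rewrite /pairing lincomb_mult; congr lincomb; apply/funext => i.
  by rewrite coef_mult.
apply: le_trans (pairing_le _ _) _; rewrite mulrAC -mulrA mulrC.
by rewrite mulrA ler_wpM2r.
Qed.

(** The adjoint of [spread k] is [gather], which reads coefficients along [k]. Spreading [gather]
    again is the projection onto the range of [k], whence the suppression constant; [L + 1] covers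
    the losses [L] and 1 of the two directions. *)
Lemma dual_spreading K1 L : 0 < K1 -> 0 < L -> spreading K1 e -> suppression L e ->
  exists2 K2, 0 < K2 & spreading K2 es.
Proof.
move=> K10 L0 eK1 eL; exists (K1 * (L + 1) * K); first by rewrite !mulr_gt0// addr_gt0.
move=> k kh q; have kI := homo_ltn_inj kh.
rewrite -lincomb_spread; split; rewrite mulrAC; apply: dual_upper => [|p].
- by rewrite !mulr_ge0// ltW// addr_gt0.
- pose gather := \poly_(i < size p) p`_(k i).
  have gE i : gather`_i = p`_(k i).
    rewrite coef_poly; case: ltnP => // pi; rewrite nth_default//.
    exact: leq_trans pi (homo_ltn_ge kh i).
  have -> : pairing (spread k q) p = pairing q gather.
    by rewrite /pairing lincomb_spread; congr lincomb; apply/funext => i; rewrite gE.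
  apply: le_trans (pairing_le _ _) _.
  have -> : K1 * (L + 1) * `|lincomb es q| * `|lincomb e p| =
     `|lincomb es q| * (K1 * ((L + 1) * `|lincomb e p|)) by ring.
  rewrite ler_wpM2l//; have [_ H1] := eK1 k kh gather.
  apply: le_trans H1 _; rewrite ler_pM2l// -lincomb_spread.
  have -> : spread k gather = restr (fun j => `[< exists i, k i = j >]) p.
    apply/polyP => j; rewrite coef_restr; case: asboolP => [[i <-]|nk].
      by rewrite coef_spread// gE.
    by rewrite coef_spread_eq0// => i ij; apply: nk; exists i.
  apply: le_trans (eL _ _) _; rewrite ler_wpM2r// lerDl//.
- by rewrite !mulr_ge0// ltW// addr_gt0.
- have -> : pairing q p = pairing (spread k q) (spread k p).
    rewrite /pairing lincomb_spread; congr lincomb; apply/funext => i.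
    by rewrite /= coef_spread.
  apply: le_trans (pairing_le _ _) _.
  have -> : K1 * (L + 1) * `|lincomb es (spread k q)| * `|lincomb e p| =
     `|lincomb es (spread k q)| * (K1 * ((L + 1) * `|lincomb e p|)) by ring.
  rewrite ler_wpM2l// lincomb_spread; have [H1 _] := eK1 k kh p.
  apply: le_trans H1 _; rewrite ler_pM2l//.
  by rewrite ler_peMl// lerDr ltW.
Qed.

Lemma dual_coord_neq0 i : es i != 0.
Proof.
have [_ _ eses _ _] := co; apply/eqP => esi.
have := eses i i; rewrite esi eqxx => /eqP.
have -> : (0 : dual X) (e i) = 0 by [].
by rewrite eq_sym oner_eq0.
Qed.

(** If [a'] norms [a] and [b'] norms [b], the tensor product of [a'] and [b'] pairs with that of [a]
    and [b] to the product of the norms. *)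
Lemma tensor_lower : (exists2 C, 0 < C & forall m (a b : {poly R}),
    (size b <= m)%N ->
    `|lincomb es ((a \Po 'X^m) * b)| <= C * (`|lincomb es a| * `|lincomb es b|)) ->
  exists2 C, 0 < C & forall m (a b : {poly R}), (size b <= m)%N ->
    `|lincomb e a| * `|lincomb e b| <= C * `|lincomb e ((a \Po 'X^m) * b)|.
Proof.
move=> [C C0 CP]; exists (C * ((K * K) * (K * K))).
  by rewrite !mulr_gt0.
move=> m a b bm.
have [b0|m0] := posnP m.
  have -> : b = 0 by apply/eqP; rewrite -size_poly_leq0 -b0.
  by rewrite linear0 normr0 !mulr0 linear0 normr0 mulr0.
have [a' aa' [a'a a'K]] := norming a; have [b' bb' [b'b b'K]] := norming b.
have b'm := leq_trans bb' bm.
have -> : `|lincomb e a| * `|lincomb e b| =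
    pairing ((a' \Po 'X^m) * b') ((a \Po 'X^m) * b).
  rewrite -a'a -b'b /pairing.
  rewrite (lincomb_wide _ aa') (lincomb_wide _ b'm) (@lincomb_wide _ _ (size a * m)).
    rewrite -(sum_tensor _ (fun i => a'`_i *: (a`_i : R^o)) (fun i => b'`_i *: (b`_i : R^o)) m0).
    by apply: eq_bigr => i _; rewrite !coef_tensor// /GRing.scale /= mulrACA.
  apply/leq_sizeP => i; rewrite -leq_divRL// => ai; rewrite coef_tensor//.
  by rewrite (nth_default _ (leq_trans aa' ai)) mul0r.
apply: le_trans (ler_norm _) (le_trans (pairing_le _ _) _).
rewrite ler_wpM2r//; apply: le_trans (CP _ _ _ b'm) _; rewrite ler_pM2l//.
exact: ler_pM.
Qed.

End Duality.

(** * The Rosenthal basis of the dual *)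

(** Coefficients are at most [C] times the norm and the errors sum to at most [2 * d], so the
    combination moves by at most half of its norm. *)
Lemma perturbation (R : realType) (V : normedModType R) (u z : nat -> V) (C d : R) :
  0 < C -> 0 <= d -> 4 * d * C <= 1 ->
  (forall i (p : {poly R}), `|p`_i| <= C * `|lincomb u p|) ->
  (forall i, `|z i - u i| <= d * 2^-1 ^+ i) -> dominated z u /\ dominated u z.
Proof.
move=> C0 d0 dC uC zu.
have H p : `|lincomb z p - lincomb u p| <= 2^-1 * `|lincomb u p|.
  rewrite -lincombB; apply: le_trans (ler_norm_sum _ _ _) _.
  apply: (@le_trans _ _ (\sum_(i < size p) C * d * `|lincomb u p| * 2^-1 ^+ i)).
    apply: ler_sum => i _; rewrite normrZ.
    apply: le_trans (ler_pM _ _ (uC i p) (zu i)) _ => //.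
    set x := `|_|; set y := _ ^+ _; lra.
  rewrite -mulr_sumr; have := sum_half_le R (size p).
  set s := \sum_(_ < _) _ => s2.
  have x0 : 0 <= `|lincomb u p| by [].
  have dC0 : 0 <= C * d by rewrite mulr_ge0// ltW.
  apply: le_trans (ler_wpM2l (mulr_ge0 dC0 x0) s2) _.
  move: (`|_|) x0 => x x0; nra.
split; [exists 2 => // p|exists 2 => // p].
  have := ler_normD (lincomb z p - lincomb u p) (lincomb u p).
  rewrite subrK; have := H p; have := normr_ge0 (lincomb u p); lra.
have := ler_normB (lincomb z p) (lincomb z p - lincomb u p).
rewrite subKr; have := H p; have := normr_ge0 (lincomb u p); lra.
Qed.

Lemma ultra_cvg_bounded (R : realType) (F : set_system nat) (a : nat -> R) B :
  UltraFilter F -> (forall n, `|a n| <= B) -> exists l : R, a @ F --> l.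
Proof.
move=> FU aB; have FF : ProperFilter F by exact: ultra_proper.
have [|l [_ lcl]] := @segment_compact R (- B) B (a @ F) _.
  apply: (@filterE _ F) => n; rewrite /= in_itv /= -ler_norml; exact: aB.
exists l => A lA; have [//|FA] := in_ultra_setVsetC (a @^-1` A) FU.
by have [x [/= nAx Ax]] := lcl (~` A) A FA lA.
Qed.

(** The limits of the coordinates along the ultrafilter may be nonzero and need not be the
    coordinates of a vector; the difference of two terms eliminates them. *)
Lemma close_coordinates (R : realType) (Y : normedModType R) (fs : nat -> dual Y)
    (w : nat -> Y) (B : R) : (forall n, `|w n| <= B) ->
  forall q N d, 0 < d -> exists n n', [/\ (N <= n)%N, (n < n')%N &
    forall j, (j < q)%N -> `|fs j (w n - w n')| <= d].
Proof.
move=> wB q N d d0; have [F [FU Foo]] := free_ultrafilter.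
have FF : ProperFilter F by exact: ultra_proper.
have /choice[l lP] (j : nat) : exists l : R, (fun n => fs j (w n)) @ F --> l.
  apply: (@ultra_cvg_bounded _ _ _ (`|fs j| * B)) => n.
  by apply: le_trans (ler_dual _ _) _; rewrite ler_wpM2l.
have FA : F [set n | forall j, (j < q)%N -> `|l j - fs j (w n)| <= d / 2].
  elim: q => [|q IH]; first by apply: filterS filterT.
  have : F [set n | `|l q - fs q (w n)| <= d / 2].
    by have /cvgrPdist_le/(_ (d / 2)) := lP q; apply; rewrite divr_gt0.
  apply: filterS2 IH => n /= nq nlq j; rewrite ltnS leq_eqVlt => /orP[/eqP ->//|].
  exact: nq.
have [n [nA Nn]] := filter_ex (filterI FA (Foo _ (nbhs_infty_ge N))).
have [n' [n'A nn']] := filter_ex (filterI FA (Foo _ (nbhs_infty_gt n))).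
exists n, n'; split=> // j jq.
have -> : fs j (w n - w n') = (l j - fs j (w n')) - (l j - fs j (w n)).
  have -> : fs j (w n - w n') = fs j (w n) - fs j (w n') by exact: (linearB (dual_lin (fs j))).
  by ring.
apply: le_trans (ler_normB _ _) _; rewrite [leRHS]splitr lerD//.
  exact: n'A.
exact: nA.
Qed.

Section Selection.
Context {R : realType} {Y : normedModType R} {K : R}.
Context {f : nat -> Y} {fs : nat -> dual Y}.
Hypotheses (co : coordinates K f fs) (f1 : forall i, `|f i| = 1).
Hypothesis fR : forall u : nat -> Y, normalized_block_basis f u ->
  exists2 k : nat -> nat, {homo k : i j / (i < j)%N}
    & equivalent_seq (fun n => u (k n)) f.
Variables (w : nat -> Y) (B c : R).
Hypotheses (wB : forall n, `|w n| <= B) (c0 : 0 < c)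
  (wc : forall n n', (n < n')%N -> c <= `|w n - w n'|).

Let K0 : 0 < K. Proof. by case: co. Qed.

Let z n n' := `|w n - w n'|^-1 *: (w n - w n').

Let z1 n n' : (n < n')%N -> `|z n n'| = 1.
Proof.
move=> /wc cw; rewrite /z normrZ normfV normr_id mulVf// gt_eqF//.
exact: lt_le_trans cw.
Qed.

Let S q (x : Y) := \sum_(j < q) fs j x *: f j.

Let selection_step q N eps : 0 < eps -> exists n n' q', [/\ (N <= n)%N, (n < n')%N, (q < q')%N,
  `|S q (z n n')| <= eps & `|z n n' - S q' (z n n')| <= eps].
Proof.
(* Normalizing the difference divides by at least [c], and [q] coordinates are added up; [q.+1]
   keeps the denominator nonzero. *)
move=> eps0; pose d := eps * c / q.+1%:R.
have d0 : 0 < d by rewrite divr_gt0// mulr_gt0.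
have [n [n' [Nn nn' nd]]] := close_coordinates fs wB q N d0.
have [_ /(_ (z n n'))/cvgrPdist_le/(_ _ eps0) [q0 _ q0P] _ _ _] := co.
exists n, n', (maxn q0 q.+1); split=> //.
- by rewrite leq_max ltnSn orbT.
- apply: le_trans (ler_norm_sum _ _ _) _.
  apply: (@le_trans _ _ (\sum_(j < q) c^-1 * d)).
    apply: ler_sum => j _; rewrite normrZ f1 mulr1.
    have -> : fs j (z n n') = `|w n - w n'|^-1 * fs j (w n - w n').
      exact: (linearZ_LR (dual_lin (fs j))).
    rewrite normrM normfV normr_id; apply: ler_pM => //.
      by rewrite lef_pV2 ?posrE ?wc//; apply: lt_le_trans (wc nn').
    exact: nd.
  rewrite sumr_const card_ord -mulr_natr /d.
  have -> : c^-1 * (eps * c / q.+1%:R) * q%:R = eps * (q%:R / q.+1%:R).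
    have : q.+1%:R != 0 :> R by rewrite pnatr_eq0.
    move: (q.+1%:R : R) (q%:R : R) => s t s0.
    by field; rewrite s0 lt0r_neq0.
  by rewrite ler_piMr ?(ltW eps0)// ler_pdivrMr ?ltr0n// mul1r ler_nat.
- have := q0P (maxn q0 q.+1); rewrite /= leq_maxl => /(_ isT).
  by rewrite /series /= big_mkord.
Qed.

(* Pairs of indices whose coordinates with respect to [f] nearly agree up to a large
   rank exist by compactness along an ultrafilter. *)
Lemma selection : exists n n' : nat -> nat,
  [/\ forall i, (n i < n' i)%N, forall i j, (i < j)%N -> (n' i < n j)%N &
   equivalent_seq (fun i => `|w (n i) - w (n' i)|^-1 *: (w (n i) - w (n' i))) f].
Proof.
(* The blocks below have coordinate constant [2 * K] and are missed by [4 * eta * 2^-1 ^+ i], so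
   [perturbation] asks for [32 * K * eta <= 1]. With [K + 1] also [eps i <= 32^-1], which keeps the
   norms [nu i] positive. *)
pose eta : R := (32 * (K + 1))^-1.
have K10 : 0 < 32 * (K + 1) by rewrite mulr_gt0// addr_gt0.
have eta0 : 0 < eta by rewrite invr_gt0.
have etaK : eta * (32 * (K + 1)) = 1 by rewrite mulVf// gt_eqF.
pose eps i := eta * 2^-1 ^+ i.
have eps0 i : 0 < eps i by rewrite mulr_gt0// exprn_gt0.
have eps_le i : eps i <= eta by rewrite ler_piMr ?(ltW eta0)// exprn_ile1// invf_le1// ler1n.
have eps4 i : eps i <= 32^-1.
  by apply: le_trans (eps_le i) _; rewrite lef_pV2 ?posrE// ler_peMr// lerDr ltW.
have /choice[nx nxP] (qNi : nat * nat * nat) : exists r : nat * nat * nat,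
   [/\ (qNi.1.2 <= r.1.1)%N, (r.1.1 < r.1.2)%N, (qNi.1.1 < r.2)%N,
     `|S qNi.1.1 (z r.1.1 r.1.2)| <= eps qNi.2 &
     `|z r.1.1 r.1.2 - S r.2 (z r.1.1 r.1.2)| <= eps qNi.2].
  have [n [n' [q' H]]] := selection_step qNi.1.1 qNi.1.2 (eps0 qNi.2).
  by exists (n, n', q').
(* The state consists of the rank reached by the previous blocks and the least index that may still
   be used. *)
pose st := fix st i : nat * nat := if i is i'.+1 then
   ((nx (st i', i')).2, (nx (st i', i')).1.2.+1) else (0, 0)%N.
pose r i := nx (st i, i).
pose n i := (r i).1.1; pose n' i := (r i).1.2; pose q i := (st i).1.
have rP i : [/\ ((st i).2 <= n i)%N, (n i < n' i)%N, (q i < q i.+1)%N,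
   `|S (q i) (z (n i) (n' i))| <= eps i &
   `|z (n i) (n' i) - S (q i.+1) (z (n i) (n' i))| <= eps i].
  exact: (nxP (st i, i)).
have nn' i : (n i < n' i)%N by case: (rP i).
have n'nS i : (n' i < n i.+1)%N by case: (rP i.+1).
have n'n i j : (i < j)%N -> (n' i < n j)%N.
  elim: j => // j IH; rewrite ltnS leq_eqVlt => /orP[/eqP ->//|/IH ij].
  by apply: ltn_trans ij _; apply: ltn_trans (nn' j) _.
have qh : {homo q : i j / (i <= j)%N}.
  apply: homo_leq => [//||i]; first exact: leq_trans.
  by apply: ltnW; case: (rP i).
pose y i : {poly R} := \poly_(j < q i.+1) (if (q i <= j)%N then fs j (z (n i) (n' i)) else 0).
have yE i : lincomb f (y i) = S (q i.+1) (z (n i) (n' i)) - S (q i) (z (n i) (n' i)).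
  have [_ _ qq _ _] := rP i; rewrite lincomb_poly /S.
  rewrite -!(big_mkord xpredT (fun j => fs j (z (n i) (n' i)) *: f j)).
  rewrite [\sum_(0 <= _ < q i.+1) _](big_cat_nat (leq0n (q i)) (ltnW qq)) /= addrAC subrr add0r.
  rewrite -(big_mkord xpredT (fun j => (if (q i <= j)%N then fs j (z (n i) (n' i)) else 0) *: f j)).
  rewrite (big_cat_nat (leq0n (q i)) (ltnW qq)) /= big_nat big1 ?add0r.
    by rewrite big_nat [RHS]big_nat; apply: eq_bigr => j /andP[-> _].
  by move=> j /andP[_ jq]; rewrite leqNgt jq scale0r.
have yz i : `|z (n i) (n' i) - lincomb f (y i)| <= 2 * eps i.
  have [_ _ _ H1 H2] := rP i; rewrite yE opprB addrA addrAC.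
  by apply: le_trans (ler_normD _ _) _; rewrite mulr_natl mulr2n lerD.
pose nu i := `|lincomb f (y i)|.
have nu1 i : `|nu i - 1| <= 2 * eps i.
  have := ler_dist_dist (z (n i) (n' i)) (lincomb f (y i)); rewrite z1// => H.
  by rewrite distrC; exact: le_trans H (yz i).
have nu0 i : 0 < nu i.
  have := nu1 i; have := eps4 i; rewrite ler_norml => H /andP[]; lra.
have ysupp i j : (y i)`_j != 0 -> (q i <= j < q i.+1)%N.
  by rewrite coef_poly; case: ltnP => [_|_]; [case: leqP => //|]; rewrite eqxx.
pose u i := lincomb f ((nu i)^-1 *: y i).
have uE i : u i = (nu i)^-1 *: lincomb f (y i) by rewrite /u linearZ.
have u_block : normalized_block_basis f u.
  apply: normalized_block => [i i' j j' ii'|i]; last first.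
    by rewrite linearZ /= normrZ gtr0_norm ?invr_gt0// mulVf// gt_eqF.
  rewrite !coefZ !mulf_eq0 !negb_or => /andP[_ /ysupp/andP[_ jq]].
  move=> /andP[_ /ysupp/andP[qj' _]].
  exact: leq_trans jq (leq_trans (qh _ _ ii') qj').
have uz i : `|z (n i) (n' i) - u i| <= 4 * eta * 2^-1 ^+ i.
  rewrite -(subrKA (lincomb f (y i))); apply: le_trans (ler_normD _ _) _.
  have -> : lincomb f (y i) - u i = (1 - (nu i)^-1) *: lincomb f (y i).
    by rewrite uE scalerBl scale1r.
  rewrite normrZ -/(nu i) -[X in _ * X](gtr0_norm (nu0 i)) -normrM mulrBl mul1r mulVf ?gt_eqF//.
  by have := yz i; have := nu1 i; rewrite /eps; lra.
have [k kh eqv] := fR u_block.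
exists (n \o k), (n' \o k); split => [i|i j ij|]; [exact: nn'|exact/n'n/kh|].
apply/equivalent_seqP; move/equivalent_seqP: eqv => [uf fu].
have uC i (p : {poly R}) : `|p`_i| <= 2 * K * `|lincomb u p|.
  have -> : lincomb u p = lincomb f (lincomb (fun i => (nu i)^-1 *: y i) p).
    by rewrite lincomb_comp.
  set P := lincomb _ p.
  have piE : p`_i *: u i = lincomb f (restr (fun j => j < q i.+1)%N P)
                        - lincomb f (restr (fun j => j < q i)%N P).
    rewrite -linearB /= /u -linearZ /=; congr lincomb; apply/polyP => j.
    rewrite coefB !coef_restr coefZ coefZ.
    have Pj : (q i <= j < q i.+1)%N -> P`_j = p`_i * ((nu i)^-1 * (y i)`_j).
      move=> /andP[qj jq]; rewrite coef_lincomb.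
      have other i' : i' != i -> (y i')`_j = 0.
        move=> ii'; apply/eqP; apply: contraT => /ysupp/andP[q'j jq'].
        move: ii'; rewrite neq_ltn => /orP[/qh|/qh] H.
          by move: (leq_trans jq' (leq_trans H qj)); rewrite ltnn.
        by move: (leq_trans jq (leq_trans H q'j)); rewrite ltnn.
      have [ip|pi] := ltnP i (size p).
        rewrite (bigD1 (Ordinal ip))//= coefZ big1 ?addr0// => i' /eqP ii'.
        rewrite coefZ other ?mulr0//; apply/eqP => ii; apply: ii'; exact: val_inj.
      rewrite nth_default// mul0r big1// => i' _; rewrite coefZ other ?mulr0//.
      by rewrite ltn_eqF// (leq_trans _ pi).
    have [jq|qj] := ltnP j (q i).
      rewrite (leq_trans jq (qh _ _ (leqnSn i))) subrr.
      have [->|/ysupp] := eqVneq (y i)`_j 0; first by rewrite !mulr0.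
      by rewrite leqNgt jq.
    have [jq|jq] := ltnP j (q i.+1); first by rewrite subr0 Pj// qj.
    rewrite subrr; have [->|/ysupp] := eqVneq (y i)`_j 0; first by rewrite !mulr0.
    by rewrite ltnNge jq andbF.
  have -> : `|p`_i| = `|p`_i *: u i|.
    by rewrite normrZ uE normrZ (gtr0_norm (x := (nu i)^-1)) ?invr_gt0// mulVf ?mulr1// gt_eqF.
  rewrite piE; apply: le_trans (ler_normB _ _) _.
  by rewrite -mulrA mulr_natl mulr2n lerD//; exact: (coord_take co).
have ukC i (p : {poly R}) : `|p`_i| <= 2 * K * `|lincomb (fun i => u (k i)) p|.
  by rewrite -lincomb_spread -(coef_spread p i (homo_ltn_inj kh)); exact: uC.
have [||||zu uz'] := perturbation _ _ _ ukC (z := fun i => z (n (k i)) (n' (k i))) (d := 4 * eta).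
- by rewrite mulr_gt0.
- by rewrite mulr_ge0// ltW.
- by have := etaK; have := eta0; nra.
- move=> i; apply: le_trans (uz (k i)) _; rewrite ler_wpM2l ?mulr_ge0 ?(ltW eta0)//.
  by rewrite ler_wiXn2l// ?invf_le1 ?ler1n// homo_ltn_ge.
split; [exact: dominated_trans zu uf|exact: dominated_trans fu uz'].
Qed.

End Selection.

Lemma rosenthal_basis_structure (R : realType) (X : completeNormedModType R)
    (e : nat -> X) : rosenthal_basis e -> exists K es S L,
  [/\ coordinates K e es, 0 < S, spreading S e, 0 < L & suppression L e].
Proof.
move=> [e1 eb eR]; have [K [es co]] := schauder_coordinates e1 eb.
have [S S0 eS] := rosenthal_spreading co e1 eR.
have [L L0 eL] := rosenthal_suppression co e1 eR.
by exists K, es, S, L.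
Qed.

Section PairsSuppression.
Context {R : realType} {V : normedModType R} (u : nat -> V) (L : R).
Hypothesis uL : suppression L u.

(** The two ranges are disjoint, so projecting a combination of differences onto the range of [n]
    keeps exactly the first terms. *)
Lemma pairs_suppression (n n' : nat -> nat) q : (forall i j, n i <> n' j) ->
  `|lincomb (u \o n) q| <= L * `|lincomb (fun i => u (n i) - u (n' i)) q|.
Proof.
move=> nn'; rewrite (lincombB (u \o n) (u \o n')).
rewrite -(lincomb_spread u n) -(lincomb_spread u n') -(linearB (lincomb u)).
pose A j := `[< exists i, n i = j >].
suff E : spread n q = restr A (spread n q - spread n' q) by rewrite {1}E; exact: uL.
rewrite (linearB (restr A)) /= restr_id => [|j nj]; last first.
  apply/asboolP; apply: contrapT => nex; move/eqP: nj; apply.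
  by apply: coef_spread_eq0 => i ij; apply: nex; exists i.
rewrite restr_eq0 ?subr0// => j n'j; apply/asboolP => -[i ij].
by move/eqP: n'j; apply; apply: coef_spread_eq0 => l lj; apply: (nn' i l); rewrite ij lj.
Qed.

Lemma suppression_separated b n n' : 0 < L -> (forall i, b <= `|u i|) ->
  (n < n')%N -> b / L <= `|u n - u n'|.
Proof.
move=> L0 ub nn'; rewrite ler_pdivrMr// mulrC; apply: le_trans (ub n) _.
have := uL (pred1 n) ('X^n - 'X^n').
rewrite (linearB (restr (pred1 n))) !(linearB (lincomb u)) /= !lincombXn.
rewrite restr_id => [|j]; last by rewrite coefXn /=; case: (j =P n) => //; rewrite eqxx.
rewrite restr_eq0 => [|j]; first by rewrite (linear0 (lincomb u)) subr0 lincombXn.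
by rewrite coefXn /=; case: (j =P n') => [->|]; rewrite ?eqxx// gtn_eqF.
Qed.

End PairsSuppression.

Section RosenthalDomination.
Context {R : realType} {Y : completeNormedModType R} (f : nat -> Y).
Hypothesis fR : rosenthal_basis f.
Variables (u : nat -> Y) (L b B : R).
Hypotheses (L0 : 0 < L) (uL : suppression L u).
Hypotheses (b0 : 0 < b) (ub : forall i, b <= `|u i|) (uB : forall i, `|u i| <= B).

Let usep n n' : (n < n')%N -> b / L <= `|u n - u n'|.
Proof. exact: suppression_separated. Qed.

Let c0 : 0 < b / L. Proof. exact: divr_gt0. Qed.

Let B0 : 0 < B. Proof. exact: lt_le_trans b0 (le_trans (ub 0) (uB 0)). Qed.

(** [selection] controls normalized differences of [u]; [pairs_suppression] recovers the first terms
    from them, and the normalizing factors are multipliers bounded by [2 * B]. *)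
Lemma rosenthal_dominates : exists2 n : nat -> nat,
  {homo n : i j / (i < j)%N} & dominated (fun i => u (n i)) f.
Proof.
have [K [fs [S [Lf [co S0 fS Lf0 fLf]]]]] := rosenthal_basis_structure fR.
have [f1 fb frs] := fR.
have [n [n' [nn' n'n /equivalent_seqP[zf _]]]] := selection co f1 frs uB c0 usep.
have nh : {homo n : i j / (i < j)%N} by move=> i j /n'n; exact: ltn_trans (nn' i).
have ndisj i j : n i <> n' j.
  have [ij|ji|->] := ltngtP i j.
  - by move=> e; have := ltn_trans (nh _ _ ij) (nn' j); rewrite e ltnn.
  - by move=> e; have := n'n _ _ ji; rewrite e ltnn.
  - by move=> e; have := nn' j; rewrite e ltnn.
exists n => //; have [D D0 zD] := zf.
exists (L * (D * (2 * B * Lf))); first by rewrite !mulr_gt0.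
move=> p; apply: le_trans (pairs_suppression uL p ndisj) _.
rewrite -mulrA ler_pM2l//.
pose nu i := `|u (n i) - u (n' i)|.
have nu0 i : 0 < nu i by exact: lt_le_trans (usep (nn' i)).
have -> : lincomb (fun i => u (n i) - u (n' i)) p =
    lincomb (fun i => (nu i)^-1 *: (u (n i) - u (n' i))) (mult nu p).
  rewrite lincomb_mult; congr lincomb; apply/funext => i.
  by rewrite scalerA mulfV ?scale1r// gt_eqF.
apply: le_trans (zD _) _; rewrite -mulrA ler_pM2l//.
apply: suppression_ge0_mult => //; first by rewrite mulr_gt0.
move=> i; rewrite ltW//=; apply: le_trans (ler_normB _ _) _.
by rewrite mulr_natl mulr2n lerD.
Qed.

(** Here the differences only have to be bounded from above: the triangle inequality splits them
    into two subsequences of [u], and [spreading] bounds both by [u] itself. *)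
Lemma rosenthal_dominated S : 0 < S -> spreading S u -> dominated f u.
Proof.
move=> S0 uS; have [K [fs [_ [_ [co _ _ _ _]]]]] := rosenthal_basis_structure fR.
have [f1 fb frs] := fR.
have [n [n' [nn' n'n /equivalent_seqP[_ fz]]]] := selection co f1 frs uB c0 usep.
have nh : {homo n : i j / (i < j)%N} by move=> i j /n'n; exact: ltn_trans (nn' i).
have nh' : {homo n' : i j / (i < j)%N} by move=> i j /n'n /ltn_trans; apply.
apply: dominated_trans fz _.
exists (2 * S * ((b / L)^-1 * L)); first by rewrite !mulr_gt0// invr_gt0.
move=> p; pose nu i := `|u (n i) - u (n' i)|.
have nu0 i : 0 < nu i by exact: lt_le_trans (usep (nn' i)).
have -> : lincomb (fun i => `|u (n i) - u (n' i)|^-1 *: (u (n i) - u (n' i))) p =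
    lincomb (u \o n) (mult (fun i => (nu i)^-1) p) -
    lincomb (u \o n') (mult (fun i => (nu i)^-1) p).
  by rewrite -lincombB lincomb_mult.
set q := mult _ p.
have qp : `|lincomb u q| <= (b / L)^-1 * L * `|lincomb u p|.
  apply: suppression_ge0_mult => // [|i]; first by rewrite invr_gt0.
  by rewrite invr_ge0 ltW//= lef_pV2 ?posrE// usep.
apply: le_trans (ler_normB _ _) _.
have [H1 _] := uS n nh q; have [H2 _] := uS n' nh' q.
have := ler_wpM2l (ltW S0) qp; lra.
Qed.

End RosenthalDomination.

Section DualBasis.
Context {R : realType} {X : completeNormedModType R}.
Variable f : nat -> dual X.
Hypothesis fR : rosenthal_basis f.

Section OneBasis.
Variables (e : nat -> X) (es : nat -> dual X) (K S L : R).
Hypotheses (e1 : forall i, `|e i| = 1) (co : coordinates K e es).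
Hypotheses (S0 : 0 < S) (eS : spreading S e) (L0 : 0 < L) (eL : suppression L e).

Let K0 : 0 < K. Proof. by case: co. Qed.

Let es_ge1 i : 1 <= `|es i|.
Proof.
have [_ _ eses _ _] := co.
have := ler_dual (es i) (e i); by rewrite eses eqxx e1 mulr1 normr1.
Qed.

Let es_leK i : `|es i| <= K.
Proof. by have [_ _ _ _ esK] := co; apply: dual_norm_le => //; exact: ltW. Qed.

Let esL : suppression (L * K) es.
Proof. exact: (dual_suppression co (ltW L0) eL). Qed.

Lemma coordinates_equivalent : dominated es f /\ dominated f es.
Proof.
have [S' S'0 esS] := dual_spreading co S0 L0 eS eL.
have LK0 : 0 < L * K by rewrite mulr_gt0.
split; last exact: (rosenthal_dominated fR LK0 esL ltr01 es_ge1 es_leK S'0 esS).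
have [n nh nf] := rosenthal_dominates fR LK0 esL ltr01 es_ge1 es_leK.
apply: dominated_trans nf; exists S' => // p.
by have [] := esS n nh p.
Qed.

(** [tensor_upper] asks of a block basis only that some subsequence be dominated by [es];
    [rosenthal_dominates] provides this because blocks of [es] are again unconditional and [f] is
    dominated by [es]. *)
Lemma rosenthal_tensor : exists2 C, 0 < C & forall m (a b : {poly R}),
  (size b <= m)%N ->
  `|lincomb e a| * `|lincomb e b| <= C * `|lincomb e ((a \Po 'X^m) * b)|.
Proof.
apply: (tensor_lower co).
have [S' S'0 esS] := dual_spreading co S0 L0 eS eL.
have LK0 : 0 < L * K by rewrite mulr_gt0.
apply: (tensor_upper S'0 LK0 esS esL (dual_coord_neq0 co)).
move=> u /normalized_blockP[y [-> yb y1]].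
have uL : suppression (L * K) (fun n => lincomb es (y n)).
  apply: (blocks_suppression esL) => i i' j yij yi'j.
  have [ii'|ii'|//] := ltngtP i i'.
  - by have := yb _ _ _ _ ii' yij yi'j; rewrite ltnn.
  - by have := yb _ _ _ _ ii' yi'j yij; rewrite ltnn.
have [||n nh nf] := rosenthal_dominates fR LK0 uL ltr01 (B := 1).
- by move=> i; rewrite y1.
- by move=> i; rewrite y1.
exists n => //; apply: dominated_trans nf _.
by have [] := coordinates_equivalent.
Qed.

End OneBasis.

(** Norm [p] by a combination of [es]. The same coefficients on [es'] have comparable norm, through
    [f], and give the same pairing with [p]. *)
Lemma rosenthal_basis_dominated (e e' : nat -> X) : rosenthal_basis e ->
  rosenthal_basis e' -> dominated e e'.
Proof.
move=> eR e'R.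
have [K [es [S [L [co S0 eS L0 eL]]]]] := rosenthal_basis_structure eR.
have [K' [es' [S' [L' [co' S'0 eS' L'0 eL']]]]] := rosenthal_basis_structure e'R.
have [e1 _ _] := eR; have [e'1 _ _] := e'R.
have [_ fes] := coordinates_equivalent e1 co S0 eS L0 eL.
have [es'f _] := coordinates_equivalent e'1 co' S'0 eS' L'0 eL'.
have [C C0 es'es] := dominated_trans es'f fes.
have K0 : 0 < K by case: co.
exists (C * (K * K)); first by rewrite !mulr_gt0.
move=> p; have [q _ [<- qK]] := norming co p.
apply: le_trans (ler_norm _) (le_trans (pairing_le co' q p) _).
rewrite ler_wpM2r//; apply: le_trans (es'es q) _; rewrite ler_pM2l//.
Qed.

Lemma rosenthal_basis_tensor (e : nat -> X) : rosenthal_basis e ->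
  exists2 C, 0 < C & forall m (a b : {poly R}), (size b <= m)%N ->
  `|lincomb e ((a \Po 'X^m) * b)| <= C * (`|lincomb e a| * `|lincomb e b|) /\
  `|lincomb e a| * `|lincomb e b| <= C * `|lincomb e ((a \Po 'X^m) * b)|.
Proof.
move=> eR; have [e1 _ ers] := eR.
have [K [es [S [L [co S0 eS L0 eL]]]]] := rosenthal_basis_structure eR.
have [C C0 CP] := rosenthal_tensor e1 co S0 eS L0 eL.
have [|u ub|D D0 DP] := @tensor_upper R X e S L S0 L0 eS eL.
- by move=> i; rewrite -normr_gt0 e1.
- by have [k kh /equivalent_seqP[ue _]] := ers u ub; exists k.
exists (Num.max C D); first by rewrite lt_max C0.
move=> m a b bm; split.
  by apply: le_trans (DP m a b bm) _; rewrite ler_wpM2r ?mulr_ge0// le_max lexx orbT.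
by apply: le_trans (CP m a b bm) _; rewrite ler_wpM2r// le_max lexx.
Qed.

End DualBasis.

(** * Power type of the norm *)

Section RealLemmas.
Context {R : realType}.

(** As in Fekete's lemma: [u + c] is subadditive and [u - c] superadditive, so the infimum of
    [(u k + c) / k] is trapped between the two families of quotients. *)
Lemma quasi_additive (u : nat -> R) c : 0 <= c ->
  (forall k l, `|u (k + l)%N - u k - u l| <= c) ->
  exists t, forall k, `|u k - k%:R * t| <= c.
Proof.
move=> c0 uc.
have up k m : u (k * m)%N + c <= k%:R * (u m + c) \/ k = 0%N.
  case: k => [|k]; [by right|left]; elim: k => [|k IH]; first by rewrite mul1n mul1r.
  have := uc m (k.+1 * m)%N; rewrite -mulSn ler_norml => /andP[_].
  by rewrite -(natr1 k.+1); move: IH; lra.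
have lo k m : k%:R * (u m - c) <= u (k * m)%N - c \/ k = 0%N.
  case: k => [|k]; [by right|left]; elim: k => [|k IH]; first by rewrite mul1n mul1r.
  have := uc m (k.+1 * m)%N; rewrite -mulSn ler_norml => /andP[+ _].
  by rewrite -(natr1 k.+1); move: IH; lra.
pose A := [set (u k.+1 + c) / k.+1%:R | k in setT].
have lb m : (0 < m)%N -> lbound A ((u m - c) / m%:R).
  move=> m0 _ [k _ <-]; rewrite ler_pdivrMr ?ltr0n// mulrAC ler_pdivlMr ?ltr0n//.
  have [H1|H1] := up m k.+1; last by rewrite H1 in m0.
  have [H2|//] := lo k.+1 m; rewrite mulnC in H2; lra.
have hi : has_inf A.
  split; first by exists ((u 1%N + c) / 1%:R); exists 0%N.
  by exists ((u 1%N - c) / 1%:R); exact: lb.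
exists (inf A) => -[|k].
  by have := uc 0%N 0%N; rewrite addn0 mul0r subr0 subrr sub0r normrN.
have H1 : inf A <= (u k.+1 + c) / k.+1%:R.
  by apply: ge_inf; [case: hi|exists k].
have H2 : (u k.+1 - c) / k.+1%:R <= inf A.
  by apply: lb_le_inf; [case: hi|exact: lb].
move: H1 H2; rewrite ler_pdivlMr ?ltr0n// ler_pdivrMr ?ltr0n// => H1 H2.
rewrite ler_norml; apply/andP; split; lra.
Qed.

Lemma bernoulli_ineq (h : R) n : 0 <= h -> 1 + n%:R * h <= (1 + h) ^+ n.
Proof.
move=> h0; elim: n => [|n IH]; first by rewrite expr0 mul0r addr0.
rewrite exprS -natr1.
have : (1 + h) * (1 + n%:R * h) <= (1 + h) * (1 + h) ^+ n.
  by rewrite ler_wpM2l// addr_ge0.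
have : 0 <= n%:R * h * h by rewrite !mulr_ge0.
lra.
Qed.

(** This replaces the passage to [k]-th roots: if [y < x], the powers of [x / y] outgrow any affine
    function. Bernoulli's inequality alone is only linear, so it is applied with exponent [j] and
    squared, that is, [k = 2 * j]. *)
Lemma exp_growth_le (x y a b : R) : 0 <= x -> 0 <= y -> 0 <= a -> 0 <= b ->
  (forall k, x ^+ k <= (a * k%:R + b) * y ^+ k) -> x <= y.
Proof.
move=> x0 y0 a0 b0 H; rewrite leNgt; apply/negP => yx.
have [y_eq|y_neq] := eqVneq y 0.
  by have := H 1%N; rewrite !expr1 y_eq mulr0 leNgt -{1}y_eq yx.
have yp : 0 < y by rewrite lt_def y_neq.
pose h := x / y - 1.
have h0 : 0 < h by rewrite subr_gt0 ltr_pdivlMr// mul1r.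
have xE : x / y = 1 + h by rewrite /h addrC subrK.
have Hk k : (1 + h) ^+ k <= a * k%:R + b.
  by rewrite -xE expr_div_n ler_pdivrMr ?exprn_gt0.
pose j := (Num.truncn ((a * 2 + b) / h ^+ 2)).+1.
have jP : a * 2 + b < j%:R * h ^+ 2.
  by rewrite -ltr_pdivrMr ?exprn_gt0//; exact: truncnS_gt.
have j1 : 1 <= j%:R :> R by rewrite ler1n.
have := Hk (2 * j)%N; rewrite mulnC exprM natrM.
have := bernoulli_ineq j (ltW h0); set r := _ ^+ j => rj.
have : (j%:R * h) ^+ 2 <= r ^+ 2.
  rewrite ler_sqr ?nnegrE; first by apply: le_trans rj; rewrite lerDr.
    by rewrite mulr_ge0// ltW.
  by rewrite exprn_ge0// addr_ge0// ltW.
rewrite exprMn; set s := h ^+ 2 in jP *; set t := (j%:R : R) in jP j1 *.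
nra.
Qed.

Lemma dyadic_level (x : R) : 0 < x <= 1 ->
  exists l : nat, x <= 2^-1 ^+ l /\ 2^-1 ^+ l <= 2 * x.
Proof.
move=> /andP[x0 x1].
have ex : exists l, 2^-1 ^+ l.+1 < x.
  exists (Num.truncn x^-1); rewrite exprVn invf_plt ?posrE ?exprn_gt0//.
  apply: lt_trans (truncnS_gt _) _; rewrite -natrX ltr_nat.
  exact: ltn_expl.
have [l lx lmin] := ex_minnP ex; exists l; split; last first.
  by move: lx; rewrite exprS; lra.
case: l lx lmin => [|l] lx lmin; first by rewrite expr0.
rewrite leNgt; apply/negP => /lmin; by rewrite ltnn.
Qed.

End RealLemmas.

Section Ones.
Context {R : nzRingType}.

Definition ones n : {poly R} := \poly_(i < n) 1.

Lemma coef_ones n i : (ones n)`_i = (i < n)%:R.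
Proof. by rewrite coef_poly; case: ltnP. Qed.

End Ones.

Lemma restr_ones (R : comNzRingType) (A : pred nat) n : exists2 k : nat -> nat,
  {homo k : i j / (i < j)%N} &
  restr A (ones n) = spread k (ones (\sum_(i < n) A i)) :> {poly R}.
Proof.
set c := (\sum_(i < _) _)%N.
(* The induction needs [k] beyond the count too: it runs through the indices from [n] on, so that
   [k c = n] when [n] itself belongs to [A]. *)
suff [k [kh _ ->]] : exists k : nat -> nat, [/\ {homo k : i j / (i < j)%N},
    forall i, (c <= i)%N -> k i = (n + (i - c))%N &
    restr A (ones n) = spread k (ones c) :> {poly R}] by exists k.
rewrite /c {c}; elim: n => [|n [k [kh kc kE]]].
  exists id; split=> // [i _|]; first by rewrite big_ord0 add0n subn0.
  rewrite big_ord0; have -> : ones 0 = 0 :> {poly R}.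
    by apply/polyP => i; rewrite coef_ones coef0.
  by rewrite !linear0.
have onesS m : ones m.+1 = ones m + 'X^m :> {poly R}.
  apply/polyP => i; rewrite coefD !coef_ones coefXn ltnS.
  by case: ltngtP => _; rewrite ?addr0 ?add0r.
set c := (\sum_(i < n) A i)%N in kc kE.
have restrX : restr A 'X^n = if A n then 'X^n else 0 :> {poly R}.
  apply/polyP => i; rewrite coef_restr coefXn; case: (i =P n) => [->|/eqP/negbTE ni].
    by case: ifP; rewrite ?coefXn ?eqxx ?coef0.
  by rewrite if_same; case: ifP; rewrite ?coef0// coefXn ni.
have [An|nAn] := boolP (A n).
  exists k; rewrite big_ord_recr /= An -/c addn1; split=> //.
    by move=> i ci; rewrite kc 1?ltnW//; lia.
  rewrite !onesS !linearD /= restrX An kE; congr (_ + _).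
  by rewrite /spread lincombXn kc// subnn addn0.
exists (fun i => if (i < c)%N then k i else (k i).+1).
rewrite big_ord_recr /= (negbTE nAn) -/c addn0; split.
- move=> i j ij /=; case: (ltnP i c) => ic; case: (ltnP j c) => jc.
  + exact: kh.
  + by apply: ltn_trans (kh _ _ ij) _.
  + by move: (leq_ltn_trans ic (ltn_trans ij jc)); rewrite ltnn.
  + by rewrite ltnS; exact: kh.
- by move=> i ci; rewrite ltnNge ci /= kc.
- rewrite onesS linearD /= restrX (negbTE nAn) addr0 kE; apply: eq_lincomb => i.
  by move=> /leq_trans /(_ (size_poly _ _)) ->.
Qed.

(** * The fundamental function of the basis *)

Section Growth.
Context {R : realType} {V : normedModType R} (e : nat -> V) (S L C : R).
Hypotheses (e1 : forall i, `|e i| = 1) (S0 : 0 < S) (eS : spreading S e).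
Hypotheses (L0 : 0 < L) (eL : suppression L e) (C0 : 0 < C).
Hypothesis eC : forall m (a b : {poly R}), (size b <= m)%N ->
  `|lincomb e ((a \Po 'X^m) * b)| <= C * (`|lincomb e a| * `|lincomb e b|) /\
  `|lincomb e a| * `|lincomb e b| <= C * `|lincomb e ((a \Po 'X^m) * b)|.

Definition fundamental n := `|lincomb e (ones n)|.

Lemma fundamental0 : fundamental 0 = 0.
Proof.
rewrite /fundamental; have -> : ones 0 = 0 :> {poly R}.
  by apply/polyP => i; rewrite coef_ones coef0.
by rewrite linear0 normr0.
Qed.

Lemma fundamental1 : fundamental 1 = 1.
Proof. by rewrite /fundamental lincomb_poly big_ord1 scale1r. Qed.

Lemma fundamental_le n : fundamental n <= n%:R.
Proof.
rewrite /fundamental lincomb_poly; apply: le_trans (ler_norm_sum _ _ _) _.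
under eq_bigr do rewrite scale1r e1.
by rewrite sumr_const card_ord.
Qed.

Lemma fundamental_mono m n : (m <= n)%N -> fundamental m <= 2 * L * fundamental n.
Proof.
move=> mn; apply: suppression_le => // i; rewrite !coef_ones.
by case: (ltnP i m) => [im|_]; rewrite ?normr0// (leq_trans im mn).
Qed.

Lemma fundamental_gt0 n : (0 < n)%N -> 0 < fundamental n.
Proof.
move=> n0; have := fundamental_mono n0; rewrite fundamental1 => H.
by have := lt_le_trans ltr01 H; rewrite pmulr_rgt0 ?mulr_gt0.
Qed.

Lemma fundamental_mul m n : (0 < n)%N ->
  fundamental (m * n) <= C * (fundamental m * fundamental n) /\
  fundamental m * fundamental n <= C * fundamental (m * n).
Proof.
move=> n0; have -> : fundamental (m * n) = `|lincomb e ((ones m \Po 'X^n) * ones n)|.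
  rewrite /fundamental; congr `| lincomb _ _ |; apply/polyP => i.
  rewrite coef_tensor ?size_poly// !coef_ones ltn_mod n0 mulr1.
  by rewrite ltn_divLR.
by apply: eC; exact: size_poly.
Qed.

Lemma fundamental_restr A n :
  `|lincomb e (restr A (ones n))| <= S * fundamental (\sum_(i < n) A i) /\
  fundamental (\sum_(i < n) A i) <= S * `|lincomb e (restr A (ones n))|.
Proof. by have [k kh ->] := restr_ones R A n; rewrite lincomb_spread; exact: eS. Qed.

(** The tensor estimates make the logarithm of [fundamental (2 ^ k)] additive in [k] up to [ln C],
    hence linear up to a bounded error. *)
Lemma fundamental_power : exists t D : R, [/\ 0 <= t <= 1, 0 < D &
  forall n, (0 < n)%N -> fundamental n <= D * n%:R `^ t /\ n%:R `^ t <= D * fundamental n].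
Proof.
pose u k := ln (fundamental (2 ^ k)).
have l0 k : 0 < fundamental (2 ^ k) by rewrite fundamental_gt0// expn_gt0.
have C1 : 1 <= C by have [H _] := @fundamental_mul 1 1 isT; move: H; rewrite fundamental1 !mulr1.
pose c := ln C; have c0 : 0 <= c by rewrite ln_ge0.
have uc k l : `|u (k + l)%N - u k - u l| <= c.
  have [H1 H2] := @fundamental_mul (2 ^ k) (2 ^ l) (expn_gt0 2 l).
  move: H1 H2; rewrite -expnD => H1 H2.
  move: H1; rewrite -ler_ln ?posrE ?mulr_gt0// lnM ?posrE ?mulr_gt0// lnM ?posrE// => H1.
  move: H2; rewrite -ler_ln ?posrE ?mulr_gt0// lnM ?posrE// lnM ?posrE// => H2.
  rewrite ler_norml /u /c; apply/andP; split; lra.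
have [s sP] := quasi_additive c0 uc.
have ln2 : 0 < ln 2 :> R by rewrite ln_gt0// ltr1n.
pose t := s / ln 2.
have pw k : (2 ^ k)%:R `^ t = expR (k%:R * s) :> R.
  rewrite /powR pnatr_eq0 expn_eq0 /= natrX lnXn// -[ln 2 *+ k]mulr_natl /t.
  by congr expR; field; rewrite gt_eqF.
have up k : fundamental (2 ^ k) <= expR c * (2 ^ k)%:R `^ t.
  rewrite pw -expRD -[leLHS]lnK ?posrE// ler_expR -/(u k).
  have := sP k; rewrite ler_norml => /andP[_]; lra.
have lo k : (2 ^ k)%:R `^ t <= expR c * fundamental (2 ^ k).
  rewrite pw -[fundamental _]lnK ?posrE// -expRD ler_expR -/(u k).
  have := sP k; rewrite ler_norml => /andP[+ _]; lra.
(* A negative slope would let [fundamental (2 ^ k)] tend to 0, against monotonicity up to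
   [2 * L]. *)
have s_ge0 : 0 <= s.
  rewrite leNgt; apply/negP => s0.
  pose M := c + `|ln (2 * L)|.
  have H k : - M <= k%:R * s.
    have := @fundamental_mono 1 (2 ^ k) (expn_gt0 2 k); rewrite fundamental1.
    rewrite -ler_ln ?posrE ?mulr_gt0// ln1 lnM ?posrE ?mulr_gt0// -/(u k) => H1.
    have := sP k; rewrite ler_norml => /andP[_]; have := ler_norm (ln (2 * L)).
    rewrite /M; lra.
  have := H (Num.truncn (M / - s)).+1.
  have := truncnS_gt (M / - s); rewrite ltr_pdivrMr ?oppr_gt0//; lra.
have s_le : s <= ln 2.
  rewrite -subr_ge0 leNgt; apply/negP => s0.
  have H k : k%:R * s <= k%:R * ln 2 + c.
    have := fundamental_le (2 ^ k); rewrite -ler_ln ?posrE// ?ltr0n ?expn_gt0//.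
    rewrite natrX lnXn// -[ln 2 *+ k]mulr_natl -/(u k) => H1.
    have := sP k; rewrite ler_norml => /andP[+ _]; lra.
  have := H (Num.truncn (c / - (ln 2 - s))).+1.
  have := truncnS_gt (c / - (ln 2 - s)); rewrite ltr_pdivrMr ?oppr_gt0//; lra.
have t01 : 0 <= t <= 1.
  by rewrite divr_ge0 ?(ltW ln2)//= ler_pdivrMr// mul1r.
have /andP[t0 t1] := t01.
(* Interpolation between consecutive powers of 2: monotonicity costs [2 * L], and doubling the
   argument costs at most 2 because [t <= 1]. *)
exists t, (4 * L * expR c); split=> //; first by rewrite !mulr_gt0// expR_gt0.
move=> n n0; pose k := trunc_log 2 n.
have /andP[kn nk] := trunc_log_bounds (isT : (1 < 2)%N) n0.
have p2 : 2 `^ t <= 2 :> R by rewrite -[leRHS]powRr1// ler_powR// ler1n.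
have Sk : (2 ^ k.+1)%:R `^ t <= 2 * (2 ^ k)%:R `^ t :> R.
  by rewrite expnS natrM powRM// ler_wpM2r// powR_ge0.
have kn' : (2 ^ k)%:R `^ t <= n%:R `^ t :> R.
  by rewrite ge0_ler_powR// ?nnegrE// ler_nat.
have nk' : n%:R `^ t <= (2 ^ k.+1)%:R `^ t :> R.
  by rewrite ge0_ler_powR// ?nnegrE// ler_nat ltnW.
have ec := expR_gt0 c.
have Lc : 0 < 2 * L * expR c by rewrite !mulr_gt0.
split.
  have H1 := fundamental_mono (ltnW nk).
  have H2 := ler_wpM2l (ltW (mulr_gt0 (ltr0n R 2) L0)) (up k.+1).
  have H3 := ler_wpM2l (ltW Lc) (le_trans Sk (ler_wpM2l (ler0n R 2) kn')).
  rewrite -/k in H1 H2 *; lra.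
have H1 := fundamental_mono kn; rewrite -/k in H1.
have H2 := ler_wpM2l (ltW ec) H1.
have := lo k; lra.
Qed.

End Growth.

Section PowerSum.
Context {R : realType} (q : R).
Hypothesis q0 : 0 < q.
Implicit Types (p : {poly R}).

Definition psum p := \sum_(i < size p) `|p`_i| `^ q.

Lemma psum_wide n p : (size p <= n)%N -> psum p = \sum_(i < n) `|p`_i| `^ q.
Proof.
move=> pn; rewrite /psum (big_ord_widen n (fun i => `|p`_i| `^ q) pn).
rewrite big_mkcond; apply: eq_bigr => i _; case: ltnP => // ip.
by rewrite nth_default // normr0 powR0// gt_eqF.
Qed.

Lemma psum_ge0 p : 0 <= psum p.
Proof. by apply: sumr_ge0 => i _; exact: powR_ge0. Qed.

Lemma le_psum p p' : (forall i, `|p`_i| <= `|p'`_i|) -> psum p <= psum p'.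
Proof.
move=> pp'; rewrite (psum_wide (leq_maxl (size p) (size p'))).
rewrite (psum_wide (leq_maxr (size p) (size p'))); apply: ler_sum => i _.
by rewrite ge0_ler_powR ?nnegrE// ltW.
Qed.

Lemma psumZ c p : psum (c *: p) = `|c| `^ q * psum p.
Proof.
rewrite (psum_wide (size_scale_leq c p)) mulr_sumr; apply: eq_bigr => i _.
by rewrite coefZ normrM powRM.
Qed.

Lemma powR_invK x : 0 <= x -> (x `^ q) `^ q^-1 = x.
Proof. by move=> x0; rewrite -powRrM mulfV ?gt_eqF// powRr1. Qed.

Lemma powRK_inv x : 0 <= x -> (x `^ q^-1) `^ q = x.
Proof. by move=> x0; rewrite -powRrM mulVf ?gt_eqF// powRr1. Qed.

Lemma psum_normZ c p : psum (c *: p) `^ q^-1 = `|c| * psum p `^ q^-1.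
Proof. by rewrite psumZ powRM ?powR_ge0 ?psum_ge0// powR_invK. Qed.

Lemma psum_tensor (a b : {poly R}) m : (0 < m)%N -> (size b <= m)%N ->
  psum ((a \Po 'X^m) * b) = psum a * psum b.
Proof.
move=> m0 bm; rewrite (@psum_wide (size a * m)).
  under eq_bigr do rewrite coef_tensor// normrM powRM//.
  rewrite (sum_tensor _ (fun i => `|a`_i| `^ q) (fun i => `|b`_i| `^ q))//.
  by rewrite (psum_wide bm).
apply/leq_sizeP => i; rewrite -leq_divRL// => ai; rewrite coef_tensor//.
by rewrite nth_default// mul0r.
Qed.

End PowerSum.

Lemma powRX (R : realType) (x t : R) k : 0 <= x -> (x ^+ k) `^ t = (x `^ t) ^+ k.
Proof.
move=> x0; elim: k => [|k IH]; first by rewrite !expr0 powR1.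
by rewrite !exprS powRM ?exprn_ge0// IH.
Qed.

Section Dyadic.
Context {R : realType}.
Implicit Types (a z : {poly R}).

Definition dyadic M z :=
  forall i, z`_i = 0 \/ exists2 l, (l <= M)%N & z`_i = 2^-1 ^+ l.

Fixpoint tpow a n k : {poly R} :=
  if k is k'.+1 then (a \Po 'X^(n ^ k')) * tpow a n k' else 1.

Variables (a : {poly R}) (n : nat).
Hypotheses (n0 : (0 < n)%N) (an : (size a <= n)%N).

Let nk k : (0 < n ^ k)%N. Proof. by rewrite expn_gt0 n0. Qed.

Lemma size_tpow k : (size (tpow a n k) <= n ^ k)%N.
Proof.
elim: k => [|k IH]; first by rewrite size_poly1.
apply/leq_sizeP => i; rewrite expnS -leq_divRL// => ni; rewrite coef_tensor//.
by rewrite nth_default ?mul0r//; exact: leq_trans an ni.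
Qed.

(** Exponents add under tensor products, so the number of possible values is affine in [k] although
    the length is exponential. *)
Lemma dyadic_tpow M k : dyadic M a -> dyadic (k * M) (tpow a n k).
Proof.
move=> aM; elim: k => [|k IH] i.
  rewrite coef1; case: eqP => _; [right|by left].
  by exists 0%N; rewrite ?expr0.
rewrite coef_tensor ?size_tpow//.
have [->|[l lM ->]] := aM (i %/ n ^ k)%N; first by rewrite mul0r; left.
have [->|[l' l'M ->]] := IH (i %% n ^ k)%N; first by rewrite mulr0; left.
by right; exists (l + l')%N; rewrite ?exprD// mulSn leq_add.
Qed.

Lemma psum_tpow q k : 0 < q -> psum q (tpow a n k) = psum q a ^+ k.
Proof.
move=> q0; elim: k => [|k IH].
  rewrite (@psum_wide _ _ q0 1) ?size_poly1// big_ord1 coef1 eqxx normr1 powR1.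
  by rewrite expr0.
by rewrite psum_tensor ?size_tpow// IH exprS.
Qed.

End Dyadic.

(** * Comparison with power sums by tensor powers *)

Section Classification.
Context {R : realType} {V : normedModType R} (e : nat -> V) (S L C : R).
Hypotheses (e1 : forall i, `|e i| = 1) (S0 : 0 < S) (eS : spreading S e).
Hypotheses (L0 : 0 < L) (eL : suppression L e) (C0 : 0 < C).
Hypothesis eC : forall m (a b : {poly R}), (size b <= m)%N ->
  `|lincomb e ((a \Po 'X^m) * b)| <= C * (`|lincomb e a| * `|lincomb e b|) /\
  `|lincomb e a| * `|lincomb e b| <= C * `|lincomb e ((a \Po 'X^m) * b)|.

Section PowerType.
Variables (q D : R).
Hypotheses (q1 : 1 <= q) (D0 : 0 < D).
Hypothesis fundamentalq : forall n, (0 < n)%N ->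
  fundamental e n <= D * n%:R `^ q^-1 /\ n%:R `^ q^-1 <= D * fundamental e n.

Let q0 : 0 < q. Proof. exact: lt_le_trans q1. Qed.

Let fundamental_q n : fundamental e n <= D * n%:R `^ q^-1 /\ n%:R `^ q^-1 <= D * fundamental e n.
Proof.
case: n => [|n]; last exact: fundamentalq.
by rewrite fundamental0 mulr0 powR0 ?mulr0// invr_eq0 gt_eqF.
Qed.

Section OneDyadic.
Variables (z : {poly R}) (M : nat).
Hypothesis zM : dyadic M z.

Let A l i := z`_i == 2^-1 ^+ l.
Let n l := (\sum_(i < size z) A l i)%N.
Let X l : R := (n l)%:R * (2^-1 ^+ l) `^ q.

Let h0 l : 0 < 2^-1 ^+ l :> R. Proof. by rewrite exprn_gt0. Qed.

Let half_inj l l' : 2^-1 ^+ l = 2^-1 ^+ l' :> R -> l = l'.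
Proof.
rewrite !exprVn => /invr_inj/eqP; rewrite -!natrX eqr_nat => /eqP.
by move/eqP; rewrite eqn_exp2l// => /eqP.
Qed.

Let zE : z = \sum_(l < M.+1) 2^-1 ^+ l *: restr (A l) (ones (size z)).
Proof.
apply/polyP => i; rewrite coef_sum.
under eq_bigr do rewrite coefZ coef_restr coef_ones.
have [iz|zi] := ltnP i (size z); last first.
  by rewrite nth_default// big1// => l _; rewrite if_same mulr0.
have [z0|[l0 l0M zl0]] := zM i.
  rewrite z0 big1// => l _; rewrite /A z0 ifN ?mulr0//.
  by rewrite eq_sym gt_eqF.
rewrite (bigD1 (Ordinal (l0M : l0 < M.+1)%N))//= big1 ?addr0.
  by rewrite /A zl0 eqxx mulr1.
move=> l /eqP ll0; rewrite ifN ?mulr0//; apply/eqP; rewrite zl0 => /half_inj E.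
by apply: ll0; exact: val_inj.
Qed.

Let psumE : psum q z = \sum_(l < M.+1) X l.
Proof.
rewrite /X; under [RHS]eq_bigr do rewrite natr_sum mulr_suml.
rewrite exchange_big /=; apply: eq_bigr => i _.
have [z0|[l0 l0M zl0]] := zM i.
  rewrite z0 normr0 powR0 ?gt_eqF// big1// => l _.
  by rewrite /A z0 [0 == _]eq_sym gt_eqF// mul0r.
rewrite (bigD1 (Ordinal (l0M : l0 < M.+1)%N))//= big1 ?addr0.
  by rewrite /A zl0 eqxx mul1r ger0_norm// ltW.
move=> l /eqP ll0; rewrite /A zl0; case: eqP => [/half_inj E|_]; last by rewrite mul0r.
by case: ll0; exact: val_inj.
Qed.

Let X0 l : 0 <= X l. Proof. by rewrite mulr_ge0// powR_ge0. Qed.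

Let XE l : X l `^ q^-1 = 2^-1 ^+ l * (n l)%:R `^ q^-1.
Proof. by rewrite powRM ?powR_ge0// powR_invK ?(ltW (h0 l))// mulrC. Qed.

(** On a level set [z] is a multiple of a 0-1 vector, whose norm [fundamental_restr] determines; the
    triangle inequality over the levels loses the factor [M.+1]. *)
Lemma dyadic_upper :
  `|lincomb e z| <= S * D * M.+1%:R * psum q z `^ q^-1.
Proof.
rewrite {1}zE linear_sum; apply: le_trans (ler_norm_sum _ _ _) _.
apply: (@le_trans _ _ (\sum_(l < M.+1) S * D * psum q z `^ q^-1)).
  apply: ler_sum => l _; rewrite linearZ /= normrZ gtr0_norm//.
  have [H1 _] := fundamental_restr eS (A l) (size z).
  apply: le_trans (ler_wpM2l (ltW (h0 l)) H1) _.
  have [H2 _] := fundamental_q (n l).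
  have H3 : X l `^ q^-1 <= psum q z `^ q^-1.
    rewrite ge0_ler_powR ?nnegrE ?psum_ge0 ?invr_ge0 ?(ltW q0)//.
    by rewrite psumE (bigD1 l)//= lerDl sumr_ge0.
  rewrite XE in H3.
  have := ler_wpM2l (mulr_ge0 (ltW S0) (ltW (h0 l))) H2.
  have := ler_wpM2l (mulr_ge0 (ltW S0) (ltW D0)) H3; rewrite -/(n l); lra.
by rewrite sumr_const card_ord -[leLHS]mulr_natr; lra.
Qed.

(** Each level is a projection of [z], so its share of the power sum is at most [Y] to the power
    [q]. The root of the number of levels is at most [M.+1] because [q] is at least 1. *)
Lemma dyadic_lower :
  psum q z `^ q^-1 <= D * S * L * M.+1%:R * `|lincomb e z|.
Proof.
pose Y := D * S * L * `|lincomb e z|.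
have Y0 : 0 <= Y by rewrite !mulr_ge0// ltW.
have XY l : X l <= Y `^ q.
  rewrite -(powRK_inv q0 (X0 l)) ge0_ler_powR ?nnegrE ?powR_ge0// ?(ltW q0)// XE.
  have [_ H1] := fundamental_q (n l).
  have [_ H2] := fundamental_restr eS (A l) (size z).
  have H3 : 2^-1 ^+ l * `|lincomb e (restr (A l) (ones (size z)))| <= L * `|lincomb e z|.
    have -> : 2^-1 ^+ l * `|lincomb e (restr (A l) (ones (size z)))| =
        `|lincomb e (restr (A l) z)|.
      rewrite -[X in X * _](gtr0_norm (h0 l)) -normrZ -linearZ /=; congr `|lincomb _ _|.
      apply/polyP => i; rewrite coefZ !coef_restr coef_ones /A.
      case: eqP => [zl|_]; last by rewrite mulr0.
      have [iz|zi] := ltnP i (size z); first by rewrite mulr1 zl.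
      by have := h0 l; rewrite -zl nth_default// ltxx.
    exact: eL.
  have := ler_wpM2l (ltW (h0 l)) H1.
  have := ler_wpM2l (mulr_ge0 (ltW D0) (ltW (h0 l))) H2.
  have := ler_wpM2l (mulr_ge0 (ltW D0) (ltW S0)) H3.
  rewrite /Y -/(n l); lra.
have H : psum q z <= M.+1%:R * Y `^ q.
  rewrite psumE; apply: (@le_trans _ _ (\sum_(l < M.+1) Y `^ q)); first exact: ler_sum.
  by rewrite sumr_const card_ord mulr_natl.
apply: (@le_trans _ _ ((M.+1%:R * Y `^ q) `^ q^-1)).
  by rewrite ge0_ler_powR ?nnegrE ?psum_ge0 ?mulr_ge0 ?powR_ge0 ?invr_ge0 ?(ltW q0).
rewrite powRM ?powR_ge0// powR_invK//.
have M1 : M.+1%:R `^ q^-1 <= M.+1%:R :> R.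
  by rewrite -[leRHS]powRr1// ler_powR ?ler1n// invf_le1.
have := ler_wpM2r Y0 M1; rewrite /Y; lra.
Qed.

End OneDyadic.

Let N_tpow (a : {poly R}) n k : (0 < n)%N -> (size a <= n)%N ->
  `|lincomb e (tpow a n k)| <= C ^+ k * `|lincomb e a| ^+ k /\
  `|lincomb e a| ^+ k <= C ^+ k * `|lincomb e (tpow a n k)|.
Proof.
move=> n0 an; elim: k => [|k [IH1 IH2]].
  by rewrite /= !expr0 !mul1r -(expr0 'X) lincombXn e1.
have [H1 H2] := eC a (size_tpow n0 an k); rewrite /= !exprS; split.
  apply: le_trans H1 _; rewrite -!mulrA ler_pM2l// [leRHS]mulrCA.
  by rewrite ler_wpM2l.
apply: le_trans (ler_wpM2l (normr_ge0 _) IH2) _; rewrite mulrCA [leRHS]mulrAC.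
by rewrite mulrC ler_wpM2r// exprn_ge0// ltW.
Qed.

(** For the tensor power of order [k] the bounds above lose a factor affine in [k], which
    [exp_growth_le] removes. What remains is the tensor constant [C], independent of [M]. *)
Lemma dyadic_equiv a M : dyadic M a ->
  `|lincomb e a| <= C * psum q a `^ q^-1 /\ psum q a `^ q^-1 <= C * `|lincomb e a|.
Proof.
move=> aM; pose n := (size a).+1; have n0 : (0 < n)%N by [].
have an : (size a <= n)%N by [].
have P0 := powR_ge0 (psum q a) q^-1.
have PE k : psum q (tpow a n k) `^ q^-1 = (psum q a `^ q^-1) ^+ k.
  by rewrite psum_tpow// powRX// psum_ge0.
have Ck k : 0 <= C ^+ k by rewrite exprn_ge0// ltW.
split.
  apply: (@exp_growth_le _ _ _ (S * D * M%:R) (S * D)) => [||||k] //.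
  - by rewrite mulr_ge0// ltW.
  - by rewrite !mulr_ge0// ltW.
  - by rewrite mulr_ge0// ltW.
  have [_ H1] := N_tpow k n0 an.
  have := dyadic_upper (dyadic_tpow n0 an k aM); rewrite PE => H2.
  apply: le_trans H1 _; have := ler_wpM2l (Ck k) H2.
  rewrite -natr1 natrM exprMn; lra.
apply: (@exp_growth_le _ _ _ (D * S * L * M%:R) (D * S * L)) => [||||k] //.
- by rewrite mulr_ge0// ltW.
- by rewrite !mulr_ge0// ltW.
- by rewrite !mulr_ge0// ltW.
have [H1 _] := N_tpow k n0 an.
have := dyadic_lower (dyadic_tpow n0 an k aM); rewrite PE => H2.
apply: le_trans H2 _.
have K0 : 0 <= D * S * L * (k * M).+1%:R by rewrite !mulr_ge0// ltW.
have := ler_wpM2l K0 H1.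
rewrite -natr1 natrM exprMn; lra.
Qed.

(** After division by [B], absolute values lie in [[0, 1]] and are rounded up to powers of 1/2.
    Unconditionality pays [2 * L] for the change and rounding pays 2. The number of levels depends
    on [p], which is harmless because [dyadic_equiv] is uniform in it. *)
Lemma power_equiv : exists2 E, 0 < E & forall p,
  `|lincomb e p| <= E * psum q p `^ q^-1 /\ psum q p `^ q^-1 <= E * `|lincomb e p|.
Proof.
exists (4 * L * C); first by rewrite !mulr_gt0.
move=> p; pose B := 1 + \sum_(i < size p) `|p`_i|.
have B0 : 0 < B by rewrite ltr_wpDr// sumr_ge0.
have pB i : `|p`_i| <= B.
  have [ip|pi] := ltnP i (size p); last by rewrite nth_default// normr0 ltW.
  by rewrite /B (bigD1 (Ordinal ip))//= addrCA lerDl addr_ge0// sumr_ge0.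
have /choice[l lP] (i : nat) : exists l : nat, p`_i != 0 ->
    `|p`_i| <= B * 2^-1 ^+ l /\ B * 2^-1 ^+ l <= 2 * `|p`_i|.
  have [->|pi0] := eqVneq p`_i 0; first by exists 0%N.
  have [|l [H1 H2]] := @dyadic_level _ (`|p`_i| / B).
    by rewrite divr_gt0 ?normr_gt0//= ler_pdivrMr// mul1r.
  exists l => _; rewrite mulrC -ler_pdivrMr//; split=> //.
  by rewrite -ler_pdivlMr// mulrA in H2 *.
pose a : {poly R} := \poly_(i < size p) (if p`_i == 0 then 0 else 2^-1 ^+ l i).
have aM : dyadic (\max_(i < size p) l i) a.
  move=> i; rewrite coef_poly; case: ltnP => [ip|_]; last by left.
  case: eqP => _; [by left|right]; exists (l i) => //.
  exact: (@leq_bigmax _ (fun i : 'I_(size p) => l i) (Ordinal ip)).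
have aE i : a`_i = if p`_i == 0 then 0 else 2^-1 ^+ l i.
  by rewrite coef_poly; case: ltnP => // pi; rewrite nth_default// eqxx.
have pa i : `|p`_i| <= `|(B *: a)`_i|.
  rewrite coefZ aE; case: eqP => [->|/eqP/lP[H _]]; first by rewrite mulr0.
  by rewrite [leRHS]ger0_norm// mulr_ge0 ?exprn_ge0// ltW.
have ap i : `|(B *: a)`_i| <= `|(2 *: p)`_i|.
  rewrite !coefZ aE; case: eqP => [->|/eqP/lP[_ H]]; first by rewrite !mulr0.
  rewrite [leLHS]ger0_norm ?mulr_ge0 ?exprn_ge0 ?(ltW B0)//.
  by rewrite normrM [`|2|]ger0_norm.
have [aC1 aC2] := dyadic_equiv aM.
have B_ge0 := ltW B0.
have N1 := suppression_le L0 eL pa; rewrite linearZ /= normrZ (ger0_norm B_ge0) in N1.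
have N2 := suppression_le L0 eL ap; rewrite !linearZ /= !normrZ (ger0_norm B_ge0) in N2.
have P1 : psum q p `^ q^-1 <= B * psum q a `^ q^-1.
  rewrite -[X in X * _](ger0_norm B_ge0) -(psum_normZ q0).
  by rewrite ge0_ler_powR ?nnegrE ?psum_ge0 ?invr_ge0 ?(ltW q0)//; exact: le_psum.
have P2 : B * psum q a `^ q^-1 <= 2 * psum q p `^ q^-1.
  rewrite -[X in X * _](ger0_norm B_ge0) -(psum_normZ q0).
  rewrite -[X in _ <= X * _](ger0_norm (ler0n R 2)) -(psum_normZ q0).
  by rewrite ge0_ler_powR ?nnegrE ?psum_ge0 ?invr_ge0 ?(ltW q0)//; exact: le_psum.
rewrite ger0_norm// in N2.
have LC : 0 <= 2 * L * C by rewrite !mulr_ge0// ltW.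
split.
  have := ler_wpM2l (mulr_ge0 (mulr_ge0 (ler0n R 2) (ltW L0)) B_ge0) aC1.
  have := ler_wpM2l LC P2; lra.
have := ler_wpM2l B_ge0 aC2; have := ler_wpM2l (ltW C0) N2; lra.
Qed.

End PowerType.

(** For [t = 0] only the upper estimate against the sup norm is recorded; the lower one is the
    boundedness of coordinates. Otherwise [q] is the inverse of [t]. *)
Lemma classification :
  (exists2 E, 0 < E & forall (p : {poly R}) M, (forall i, `|p`_i| <= M) ->
     `|lincomb e p| <= E * M) \/
  (exists q E, [/\ 1 <= q, 0 < E & forall p,
     `|lincomb e p| <= E * psum q p `^ q^-1 /\
     psum q p `^ q^-1 <= E * `|lincomb e p|]).
Proof.
have [t [D [/andP[t0 t1] D0 lamt]]] := fundamental_power e1 L0 eL C0 eC.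
move: t0; rewrite le_eqVlt => /orP[/eqP t0|t0].
  left; exists (2 * L * D); first by rewrite !mulr_gt0.
  move=> p M pM; have M0 : 0 <= M by exact: le_trans (normr_ge0 _) (pM 0%N).
  have : `|lincomb e p| <= 2 * L * `|lincomb e (M *: ones (size p))|.
    apply: suppression_le => // i; rewrite coefZ coef_ones.
    have [_|pi] := ltnP i (size p); last by rewrite nth_default// normr0.
    by rewrite mulr1 (ger0_norm M0).
  rewrite linearZ /= normrZ (ger0_norm M0) -/(fundamental e (size p)) => H.
  have [p0|p0] := posnP (size p).
    by move: H; rewrite p0 fundamental0 !mulr0 => /le_trans; apply; rewrite !mulr_ge0// ltW.
  have [] := lamt _ p0; rewrite -t0 powRr0 mulr1 => H1 _.
  apply: le_trans H _.
  have := ler_wpM2l (mulr_ge0 (mulr_ge0 (ler0n R 2) (ltW L0)) M0) H1; lra.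
right; exists t^-1.
have q1 : 1 <= t^-1 by rewrite invf_ge1.
have [|E E0 EP] := @power_equiv t^-1 D q1 D0; first by rewrite invrK.
by exists E.
Qed.

End Classification.

(** * The model spaces and the conclusion *)

Section LpFacts.
Context {R : realType} (p : R) (p1 : 1 <= p).
Implicit Types (u v : lp p1).

Let p0 : 0 < p. Proof. exact: lt_le_trans p1. Qed.

Definition lp_coord k u : R^o := lp_seq u k.

Lemma lp_coord_is_linear k : linear (lp_coord k). Proof. by []. Qed.

HB.instance Definition _ k :=
  GRing.isLinear.Build R (lp p1) R^o *:%R (lp_coord k) (lp_coord_is_linear k).

Lemma lp_seq_lincomb (q : {poly R}) k :
  lp_seq (lincomb (@lp_unit R p p1) q) k = q`_k.
Proof.
rewrite [LHS](linear_lincomb (lp_coord k)).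
rewrite -[in RHS](lincombX q) coef_lincomb; apply: eq_bigr => i _.
by rewrite coefXn.
Qed.

Lemma lp_norm_series u :
  (\sum_(k <oo) `|(lp_seq u k)%:E| `^ p)%E = (`|u| `^ p)%:E.
Proof.
have := lp_normE u; set T := (\sum_(_ <oo) _)%E => H.
have T0 : (0 <= T)%E by apply: nneseries_ge0 => k _ _; exact: poweR_ge0.
have : ((lp_norm u)%:E `^ p = (T `^ p^-1) `^ p)%E by rewrite H.
rewrite -poweRrM mulVf ?gt_eqF// poweRe1// => <-.
Qed.

Lemma lp_partial_le u n : \sum_(k < n) `|lp_seq u k| `^ p <= `|u| `^ p.
Proof.
rewrite -lee_fin -lp_norm_series -sumEFin -(big_mkord xpredT (fun k => (`|lp_seq u k| `^ p)%:E)).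
by apply: nneseries_lim_ge => k _ _; rewrite lee_fin powR_ge0.
Qed.

Lemma lp_norm_le u M : 0 <= M ->
  (forall n, \sum_(k < n) `|lp_seq u k| `^ p <= M `^ p) -> `|u| <= M.
Proof.
move=> M0 uM; have : `|u| `^ p <= M `^ p.
  rewrite -lee_fin -lp_norm_series; apply: lime_le.
    by apply: is_cvg_nneseries => k _ _; exact: poweR_ge0.
  apply: nearW => n; rewrite big_mkord; have := uM n.
  by rewrite -lee_fin -sumEFin.
by rewrite leNgt => uM'; rewrite leNgt; apply: contra uM' => Mu; rewrite gt0_ltr_powR ?nnegrE.
Qed.

Lemma lp_member (a : nat -> R) B :
  (forall n, \sum_(k < n) `|a k| `^ p <= B) -> exists u, forall k, lp_seq u k = a k.
Proof.
move=> aB.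
have ap : a \in Lfun (@counting nat R) p%:E.
  rewrite !inE /=; apply/andP; split; first by rewrite inE.
  rewrite inE /= /finite_norm Lnorm_counting //; apply: poweR_lty.
  apply: (@le_lt_trans _ _ B%:E); last exact: ltry.
  apply: lime_le; first by apply: is_cvg_nneseries => k _ _; exact: poweR_ge0.
  apply: nearW => n; rewrite big_mkord; have := aB n.
  by rewrite -lee_fin -sumEFin.
by exists (Lfun_Sub (p1 : (1 <= p%:E)%E) ap).
Qed.

Lemma lp_unit_norm (q : {poly R}) :
  `|lincomb (@lp_unit R p p1) q| = psum p q `^ p^-1.
Proof.
apply/eqP; rewrite eq_le; apply/andP; split.
  apply: lp_norm_le => [|n]; first exact: powR_ge0.
  rewrite powRK_inv ?psum_ge0//; under eq_bigr do rewrite lp_seq_lincomb.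
  rewrite (psum_wide p0 (leq_maxl (size q) n)).
  rewrite (big_ord_widen _ (fun i => `|q`_i| `^ p) (leq_maxr (size q) n)).
  by rewrite big_mkcond /=; apply: ler_sum => i _; case: ifP => // _; exact: powR_ge0.
have := lp_partial_le (lincomb (@lp_unit R p p1) q) (size q).
under eq_bigr do rewrite lp_seq_lincomb.
rewrite -/(psum p q) => H; rewrite -[leRHS](powR_invK p0)//.
by rewrite ge0_ler_powR ?nnegrE ?psum_ge0 ?powR_ge0 ?invr_ge0 ?(ltW p0).
Qed.

Lemma lp_series u : series (fun i => lp_seq u i *: @lp_unit R p p1 i) @ \oo --> u.
Proof.
pose s n := \sum_(k < n) `|lp_seq u k| `^ p.
have s_nd : nondecreasing_seq s.
  by apply/nondecreasing_seqP => n; rewrite /s big_ord_recr lerDl powR_ge0.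
have s_cvg : cvgn s.
  apply: nondecreasing_is_cvgn => //; exists (`|u| `^ p) => _ [n _ <-].
  exact: lp_partial_le.
apply/cvgrPdist_le => eps eps0.
have ep : 0 < eps `^ p by rewrite powR_gt0.
have /cvgrPdist_le/(_ _ ep) [n0 _ n0P] := s_cvg.
exists n0 => // n /= n0n.
have sl := nondecreasing_cvgn_le s_nd s_cvg.
apply: lp_norm_le => [|m]; first exact: ltW.
have -> : series (fun i => lp_seq u i *: @lp_unit R p p1 i) n =
    lincomb (@lp_unit R p p1) (\poly_(i < n) lp_seq u i).
  by rewrite lincomb_poly /series /= big_mkord.
have E k : lp_seq (u - lincomb (@lp_unit R p p1) (\poly_(i < n) lp_seq u i)) k =
    if (k < n)%N then 0 else lp_seq u k.
  have -> v : lp_seq (u - v) k = lp_seq u k - lp_seq v k by exact: (linearB (lp_coord k)).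
  rewrite lp_seq_lincomb coef_poly.
  by case: ifP; rewrite ?subrr ?subr0.
under eq_bigr do rewrite E.
apply: (@le_trans _ _ (s (maxn m n) - s n)).
  rewrite /s -!(big_mkord xpredT (fun k => `|lp_seq u k| `^ p)).
  rewrite -(big_mkord xpredT (fun k => `|if (k < n)%N then 0 else lp_seq u k| `^ p)).
  rewrite (big_cat_nat (leq0n n) (leq_maxr m n)) /= addrAC subrr add0r.
  apply: (@le_trans _ _ (\sum_(0 <= k < maxn m n) `|if (k < n)%N then 0 else lp_seq u k| `^ p)).
    rewrite (big_cat_nat (leq0n m) (leq_maxl m n)) /= lerDl.
    by apply: sumr_ge0 => k _; exact: powR_ge0.
  rewrite (big_cat_nat (leq0n n) (leq_maxr m n)) /= big_nat big1 ?add0r.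
    rewrite big_nat [leRHS]big_nat; apply: ler_sum => k /andP[nk _].
    by rewrite ltnNge nk.
  by move=> k /andP[_ ->]; rewrite normr0 powR0// gt_eqF.
have := n0P n n0n; have := sl (maxn m n); have := sl n.
move=> sn sm; rewrite ger0_norm ?subr_ge0//; lra.
Qed.

End LpFacts.

Section C0Facts.
Context {R : realType}.

Definition c0_coord k (u : c0 R) : R^o := u k.

Lemma c0_coord_is_linear k : linear (c0_coord k). Proof. by []. Qed.

HB.instance Definition _ k :=
  GRing.isLinear.Build R (c0 R) R^o *:%R (c0_coord k) (c0_coord_is_linear k).

Lemma c0_seq_lincomb (q : {poly R}) k :
  c0_seq (lincomb (@c0_unit R) q) k = q`_k.
Proof.
rewrite [LHS](linear_lincomb (c0_coord k)).
rewrite -[in RHS](lincombX q) coef_lincomb; apply: eq_bigr => i _.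
by rewrite coefXn.
Qed.

Lemma c0_series (u : c0 R) : series (fun i => c0_seq u i *: @c0_unit R i) @ \oo --> u.
Proof.
apply/cvgrPdist_le => eps eps0.
have : c0_seq u @ \oo --> (0 : R^o) by have := c0_seqP u; rewrite inE.
move=> /cvgr0Pnorm_le /(_ _ eps0) [n0 _ n0P].
exists n0 => // n /= n0n; apply: c0_norm_lub => k.
have -> : series (fun i => c0_seq u i *: @c0_unit R i) n =
    lincomb (@c0_unit R) (\poly_(i < n) c0_seq u i).
  by rewrite lincomb_poly /series /= big_mkord.
have -> v : (u - v) k = u k - v k by exact: (linearB (c0_coord k)).
rewrite c0_seq_lincomb coef_poly.
case: ltnP => [_|nk]; first by rewrite subrr normr0 ltW.
by rewrite subr0; apply: n0P; exact: leq_trans nk.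
Qed.

End C0Facts.

(** * From equivalent bases to isomorphic spaces *)

Lemma cvg_norm_ler (R : realType) (V W : normedModType R) (u : nat -> V)
    (v : nat -> W) l l' (E : R) : u @ \oo --> l -> v @ \oo --> l' ->
  (forall n, `|u n| <= E * `|v n|) -> `|l| <= E * `|l'|.
Proof.
move=> ul vl uv.
have nul : (fun n => `|u n|) @ \oo --> `|l| by exact: cvg_norm.
have nvl : (fun n => E * `|v n|) @ \oo --> E * `|l'|.
  by apply: cvgMr; exact: cvg_norm.
by apply: ler_cvg_to nul nvl _; exact: nearW.
Qed.

(** Vectors correspond when they have the same coordinates. Completeness of [X] sums the coordinates
    of [w] in [X]; since [W] is not assumed complete, the other direction is a hypothesis, checked
    in each model by its membership condition. *)
Lemma isomorphic_of_equivalent (R : realType) (X : completeNormedModType R)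
    (W : normedModType R) K (e : nat -> X) (es : nat -> dual X) (g : nat -> W)
    (c : nat -> {linear W -> R^o}) :
  coordinates K e es -> dominated e g -> dominated g e ->
  (forall w, series (fun i => c i w *: g i) @ \oo --> w) ->
  (forall x, exists w, forall i, c i w = es i x) -> isomorphic X W.
Proof.
move=> co [D D0 eg] [E E0 ge] cg xw.
have [K0 ecvg eses _ esK] := co.
have serE (V : normedModType R) (a : nat -> R) (h : nat -> V) n :
    series (fun i => a i *: h i) n = lincomb h (\poly_(i < n) a i).
  by rewrite lincomb_poly /series /= big_mkord.
have sumE (V : normedModType R) (a : nat -> R) (h : nat -> V) m n :
    \sum_(m <= i < n) a i *: h i = lincomb h (\poly_(i < n) (if (m <= i)%N then a i else 0)).
  rewrite lincomb_poly big_geq_mkord big_mkcond /=; apply: eq_bigr => i _.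
  by case: ifP; rewrite ?scale0r.
have c_inj w w' : (forall i, c i w = c i w') -> w = w'.
  move=> ww'; have := cg w.
  have -> : (fun i => c i w *: g i) = (fun i => c i w' *: g i).
    by apply/funext => i; rewrite ww'.
  by move=> H; exact: (cvg_unique _ H (cg w')).
have es_inj x x' : (forall i, es i x = es i x') -> x = x'.
  move=> xx'; have := ecvg x.
  have -> : (fun i => es i x *: e i) = (fun i => es i x' *: e i).
    by apply/funext => i; rewrite xx'.
  by move=> H; exact: (cvg_unique _ H (ecvg x')).
have wx w : exists x, forall i, es i x = c i w.
  have : cvgn (series (fun i => c i w *: e i)).
    apply/cauchy_cvgP/cauchy_seriesP => eps eps0.
    have /cvg_cauchy/cauchy_seriesP/(_ (eps / D)) : cvgn (series (fun i => c i w *: g i)).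
      by apply/cvg_ex; exists w.
    rewrite divr_gt0// => /(_ isT); apply: filterS => -[m n] /=.
    rewrite !sumE ltr_pdivlMr// mulrC; exact: le_lt_trans.
  move=> /cvg_ex[x xP]; exists x => i.
  have : (es i \o series (fun i => c i w *: e i)) @ \oo --> es i x.
    by apply: continuous_cvg; [exact: dual_continuous|exact: xP].
  move=> /(cvg_unique _); apply=> //; apply: cvg_near_cst; exists i.+1 => // n /= ni.
  by rewrite serE (coord_lincomb co) coef_poly ni.
have [T TP] := choice xw; have [S SP] := choice wx.
have T_lin : linear T.
  move=> a x y; apply: c_inj => i; rewrite linearP /= !TP.
  exact: dual_linear.
have S_lin : linear S.
  move=> a x y; apply: es_inj => i; rewrite dual_linear !SP linearP.
  by [].
pose T' : {linear X -> W} := HB.pack T (GRing.isLinear.Build _ _ _ _ T T_lin).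
pose S' : {linear W -> X} := HB.pack S (GRing.isLinear.Build _ _ _ _ S S_lin).
have TE x : `|T x| <= E * `|x|.
  apply: (cvg_norm_ler (cg (T x)) (ecvg x)) => n; rewrite !serE.
  by under eq_poly do rewrite TP; exact: ge.
have SD w : `|S w| <= D * `|w|.
  apply: (cvg_norm_ler (ecvg (S w)) (cg w)) => n; rewrite !serE.
  by under eq_poly do rewrite SP; exact: eg.
exists T', S'; split.
- apply/linear_bounded_continuous/bounded_funP => r; exists (E * r) => x xr.
  by apply: le_trans (TE x) _; rewrite ler_pM2l.
- apply/linear_bounded_continuous/bounded_funP => r; exists (D * r) => x xr.
  by apply: le_trans (SD x) _; rewrite ler_pM2l.
- by move=> x; apply: es_inj => i; rewrite SP TP.
- by move=> w; apply: c_inj => i; rewrite TP SP.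
Qed.

Lemma schauder_dense (R : realType) (Y : normedModType R) (f : nat -> Y) :
  (forall i, `|f i| = 1) -> schauder_basis f ->
  exists h : nat -> Y, forall y (eps : R), 0 < eps -> exists n, `|y - h n| <= eps.
Proof.
move=> f1 fb.
pose rc (s : seq rat) : nat -> R := fun i => ratr (nth 0 s i).
pose h n : Y := if unpickle n is Some s then \sum_(i < size s) rc s i *: f i else 0.
exists h => y eps eps0; have [a [ay _]] := fb y.
have e20 : 0 < eps / 2 by rewrite divr_gt0.
have /cvgrPdist_le/(_ _ e20) [n _ nP] := ay.
pose d := eps / 2 / n.+1%:R; have d0 : 0 < d by rewrite !divr_gt0.
have /choice[r rP] (i : nat) : exists r : rat, `|a i - ratr r| <= d.
  have /rat_in_itvoo[r] : a i - d < a i + d by lra.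
  rewrite in_itv /= => /andP[r1 r2]; exists r.
  by rewrite ler_norml; apply/andP; split; lra.
exists (pickle (mkseq r n)); rewrite /h pickleK size_mkseq.
rewrite -(subrKA (series (fun i => a i *: f i) n)) [leRHS]splitr.
apply: le_trans (ler_normD _ _) (lerD (nP n (leqnn n)) _).
rewrite /series /= big_mkord -sumrB; apply: le_trans (ler_norm_sum _ _ _) _.
apply: (@le_trans _ _ (\sum_(i < n) d)).
  apply: ler_sum => i _; rewrite /rc nth_mkseq// -scalerBl normrZ f1 mulr1.
  exact: rP.
rewrite sumr_const card_ord -[leLHS]mulr_natr /d -(mulrA (eps / 2)) ler_piMr ?(ltW e20)//.
by rewrite mulrC ler_pdivrMr// mul1r ler_nat.
Qed.

(* If [e] dominated the unit vector basis of l_1, then [X*] would contain a functional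
   with arbitrary prescribed values in {0, 1} on [e], so it would not be separable. *)
Lemma l1_not_dominated (R : realType) (X : normedModType R) K (e : nat -> X)
    (es : nat -> dual X) (f : nat -> dual X) E :
  (forall i, `|e i| = 1) -> coordinates K e es ->
  (forall i, `|f i| = 1) -> schauder_basis f ->
  0 < E -> ~ (forall p : {poly R}, \sum_(i < size p) `|p`_i| <= E * `|lincomb e p|).
Proof.
move=> e1 co f1 fb E0 l1.
have [K0 ecvg eses Kn _] := co.
have [h hP] := schauder_dense f1 fb.
(* A diagonal choice: [s i] is at distance at least 1/2 from [h i (e i)], so a functional with
   values [s] on [e] stays at distance at least 1/2 from every [h i]. *)
pose s i : R := if 2^-1 <= `|h i (e i)| then 0 else 1.
have s01 i : `|s i| <= 1 by rewrite /s; case: ifP; rewrite ?normr0 ?normr1.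
have partial x n : \sum_(i < n) `|es i x| <= E * K * `|x|.
  have := l1 (\poly_(i < n) es i x); rewrite lincomb_poly => H.
  apply: le_trans (_ : E * `|\sum_(i < n) es i x *: e i| <= _); last first.
    by rewrite -mulrA ler_pM2l.
  apply: le_trans H; set p := \poly_(i < n) _.
  have pE i : (i < n)%N -> `|es i x| = `|p`_i| by rewrite coef_poly => ->.
  under eq_bigr => i _ do rewrite (pE i (ltn_ord i)).
  rewrite (big_ord_widen n (fun i => `|p`_i|) (size_poly _ _)) [leRHS]big_mkcond /=.
  apply: ler_sum => i _; case: ltnP => // pi; by rewrite nth_default// normr0.
have sE x n : `|series (fun i => s i * es i x : R^o) n| <= E * K * `|x|.
  rewrite /series /= big_mkord; apply: le_trans (ler_norm_sum _ _ _) _.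
  apply: le_trans (partial x n); apply: ler_sum => i _.
  by rewrite normrM ler_piMl.
have /choice[phi phiP] (x : X) : exists l : R^o,
    series (fun i => s i * es i x : R^o) @ \oo --> l.
  apply/cvg_ex; apply: normed_cvg; apply: nondecreasing_is_cvgn.
    by apply: (@nondecreasing_series R (fun k => `|s k * es k x|) xpredT) => k _ _.
  exists (E * K * `|x|) => _ [n _ <-].
  suff : \sum_(0 <= k < n) `|s k * es k x| <= E * K * `|x| by [].
  rewrite big_mkord; apply: le_trans (partial x n); apply: ler_sum => i _.
  by rewrite normrM ler_piMl.
have phi_lin : linear phi.
  move=> a x y; have := phiP (a *: x + y).
  have -> : series (fun i => s i * es i (a *: x + y) : R^o) =
    (fun n => a *: series (fun i => s i * es i x : R^o) n + series (fun i => s i * es i y : R^o) n).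
    apply/funext => n; rewrite /series /= scaler_sumr -big_split.
    apply: eq_bigr => i _ /=; rewrite dual_linear.
    by rewrite mulrDr /GRing.scale /= mulrCA.
  move=> H; apply: (cvg_unique _ H) => //.
  by apply: cvgD; [apply: cvgZr|]; exact: phiP.
have phiE x : `|phi x| <= E * K * `|x| by exact: cvg_norm_le (phiP x) (sE x).
have [g gphi] := dual_of phi_lin phiE.
have ge i : g (e i) = s i.
  rewrite gphi; apply: (cvg_unique _ (phiP (e i))) => //.
  apply: cvg_near_cst; exists i.+1 => // n /= ni.
  rewrite /series /= big_mkord (bigD1 (Ordinal ni))//= eses eqxx mulr1 big1 ?addr0//.
  move=> j /eqP ji; rewrite eses; case: eqP => [jE|_]; rewrite ?mulr0//.
  by case: ji; exact: val_inj.
have [|n gn] := hP g 4^-1; first by rewrite invr_gt0.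
have := ler_dual (g - h n) (e n); rewrite e1 mulr1 dualB ge => H.
have := le_trans H gn; rewrite /s; case: (leP 2^-1 `|h n (e n)|) => hn;
  rewrite ler_norml => /andP[H1 H2].
  move: hn; rewrite ler_normr => /orP[|]; lra.
move: hn; rewrite ltr_norml => /andP[]; lra.
Qed.

Section Conclusion.
Context {R : realType} {X : completeNormedModType R}.

Lemma c0_case (e : nat -> X) K (es : nat -> dual X) E :
  (forall i, `|e i| = 1) -> coordinates K e es -> 0 < E ->
  (forall (p : {poly R}) M, (forall i, `|p`_i| <= M) -> `|lincomb e p| <= E * M) ->
  [/\ dominated e (@c0_unit R), dominated (@c0_unit R) e & isomorphic X (c0 R)].
Proof.
move=> e1 co E0 eE.
have ec : dominated e (@c0_unit R).
  exists E => // p; apply: eE => i.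
  by rewrite -c0_seq_lincomb; exact: c0_norm_ub.
have [K0 ecvg _ _ _] := co.
have ce : dominated (@c0_unit R) e.
  exists K => // p; apply: c0_norm_lub => i; rewrite c0_seq_lincomb.
  exact: coord_ler co i p.
split=> //; apply: (isomorphic_of_equivalent (c := fun i => c0_coord i) co ec ce).
  exact: c0_series.
move=> x.
(* The coordinates of [x] have the absolute values of the norms of the terms of a convergent series,
   hence tend to 0. *)
suff xc : (fun i => es i x : R^o) \in @c0_pred R by exists (C0 xc).
rewrite inE /=; apply/cvgr0Pnorm_le => eps eps0.
have : (fun i => es i x *: e i) @ \oo --> 0.
  by apply: cvg_series_cvg_0; apply/cvg_ex; exists x; exact: ecvg.
move=> /cvgr0Pnorm_le/(_ _ eps0); apply: filterS => i.
by rewrite normrZ e1 mulr1.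
Qed.

Lemma lp_case (e : nat -> X) K (es : nat -> dual X) E q (q1 : 1 <= q) :
  coordinates K e es -> 0 < E ->
  (forall p, `|lincomb e p| <= E * psum q p `^ q^-1 /\
     psum q p `^ q^-1 <= E * `|lincomb e p|) ->
  [/\ dominated e (@lp_unit R q q1), dominated (@lp_unit R q q1) e
    & isomorphic X (lp q1)].
Proof.
move=> co E0 eE; have q0 : 0 < q by exact: lt_le_trans q1.
have el : dominated e (@lp_unit R q q1).
  by exists E => // p; rewrite lp_unit_norm; case: (eE p).
have le : dominated (@lp_unit R q q1) e.
  by exists E => // p; rewrite lp_unit_norm; case: (eE p).
have [K0 _ _ Kn _] := co.
split=> //; apply: (isomorphic_of_equivalent (c := fun i => lp_coord i) co el le).
  exact: lp_series.
move=> x; apply: (@lp_member _ _ _ _ ((E * (K * `|x|)) `^ q)) => n.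
pose p := \poly_(i < n) es i x.
have -> : \sum_(k < n) `|es k x| `^ q = psum q p.
  rewrite (psum_wide q0 (size_poly _ _)); apply: eq_bigr => i _.
  by rewrite coef_poly ltn_ord.
rewrite -(powRK_inv q0 (psum_ge0 q p)) ge0_ler_powR ?nnegrE ?powR_ge0 ?(ltW q0)//.
  by rewrite !mulr_ge0// ltW.
have [_ H] := eE p; apply: le_trans H _; rewrite ler_pM2l// lincomb_poly.
exact: Kn.
Qed.

End Conclusion.

Theorem proposition6 (R : realType) (X : completeNormedModType R)
    (hX : exists e : nat -> X, rosenthal_basis e)
    (hXdual : exists f : nat -> dual X, rosenthal_basis f) :
  (isomorphic X (c0 R) /\
     forall e : nat -> X, rosenthal_basis e ->
       equivalent_seq e (@c0_unit R)) \/
  (exists (p : R) (p1 : 1 < p),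
     isomorphic X (lp (ltW p1)) /\
     forall e : nat -> X, rosenthal_basis e ->
       equivalent_seq e (@lp_unit R p (ltW p1))).
Proof.
have [e eR] := hX; have [f fR] := hXdual.
have [e1 _ _] := eR; have [f1 fb _] := fR.
have [K [es [S [L [co S0 eS L0 eL]]]]] := rosenthal_basis_structure eR.
have [C C0 eC] := rosenthal_basis_tensor fR eR.
have [[E E0 eE]|[q [E [q1 E0 eE]]]] := classification e1 S0 eS L0 eL C0 eC.
  have [ec ce iso] := c0_case e1 co E0 eE.
  left; split=> // e' e'R; apply/equivalent_seqP; split.
    exact: dominated_trans (rosenthal_basis_dominated fR e'R eR) ec.
  exact: dominated_trans ce (rosenthal_basis_dominated fR eR e'R).
right; have q_gt1 : 1 < q.
  rewrite lt_neqAle q1 andbT; apply/eqP => q_eq; move: eE; rewrite -q_eq => eE.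
  apply: (l1_not_dominated e1 co f1 fb E0) => p; have [_] := eE p.
  rewrite invr1 powRr1 ?psum_ge0// /psum.
  by under eq_bigr do rewrite powRr1//.
exists q, q_gt1; have [el le iso] := lp_case (ltW q_gt1) co E0 eE.
split=> // e' e'R; apply/equivalent_seqP; split.
  exact: dominated_trans (rosenthal_basis_dominated fR e'R eR) el.
exact: dominated_trans le (rosenthal_basis_dominated fR eR e'R).
Qed.
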